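(* Let $|\psi\rangle$ be an $n$-qubit state vector, given in a representation in which computing its Schmidt decomposition is efficient (e.g. a matrix product state), with Schmidt decomposition with respect to the cut separating one target qubit from the remaining $n-1$ qubits $$|\psi\rangle=s\,|u_0\rangle_{\mathrm{target}}\otimes|v_0\rangle_{\mathrm{rest}}+\sqrt{1-s^2}\,|u_1\rangle_{\mathrm{target}}\otimes|v_1\rangle_{\mathrm{rest}},$$ and let $\mathcal{N}[\cdot]=\sum_{i=1}^rK_i(\cdot)K_i^\dagger$ be a single-qubit noise channel acting on the target qubit. Then there exists an efficient and deterministic algorithm that returns the von Neumann optimal local unraveling, i.e. a unitary $U_{\mathrm{opt}}$, transforming the Kraus representation according to $K'_{i'}=\sum_{i=1}^{r}U_{i,i'}K_i$, such that $$U_{\mathrm{opt}}\in\operatorname*{arg\,min}_{U}\left\{\sum_{i=1}^{r'}p'_i\,E\!\left(\frac{1}{\sqrt{p'_i}}K'_i|\psi\rangle_{\mathrm{target:rest}}\right)\right\},$$ where $p'_i=\|K'_i|\psi\rangle\|_2^2$ and $E$ is the von Neumann entanglement entropy.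
   Context: A single-qubit channel is a CPTP map on $2\times2$ matrices, $\sum_iK_i^\dagger K_i=\mathbb{1}$; $K_i$ acts on $|\psi\rangle$ as $K_i\otimes\mathbb{1}_{\mathrm{rest}}$. The minimization is over all unitaries $U\in\mathbb{U}(r')$ with $r'\ge r$ arbitrary (the list $K_1,\dots,K_r$ being padded with zeros to length $r'$), equivalently over all Kraus decompositions of $\mathcal{N}$; terms with $p'_i=0$ contribute $0$. For a pure state $|\phi\rangle$ and bipartition $A:B$, $E(|\phi\rangle_{A:B})=-\mathrm{Tr}[\rho_A\log\rho_A]$ with $\rho_A=\mathrm{Tr}_B|\phi\rangle\langle\phi|$; here $A$ is the target qubit and $B$ the other $n-1$ qubits. ''Efficient'' means polynomial time, given the efficient computation of the Schmidt decomposition. *)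

(* Defs.v *)
From HB Require Import structures.
From mathcomp Require Import all_boot all_order all_algebra.
From mathcomp Require Import complex.
From mathcomp Require Import all_classical all_reals all_analysis.

Set Implicit Arguments.
Unset Strict Implicit.
Unset Printing Implicit Defensive.

Import Order.TTheory GRing.Theory Num.Theory.
Local Open Scope ring_scope.
Local Open Scope complex_scope.
Local Open Scope sesquilinear_scope.

(* Vectors are families of amplitudes in the computational basis [I]. *)
Notation ket R I := {ffun I -> R[i]}.

Definition dotk (R : realType) (I : finType) (f g : ket R I) : R[i] :=
  \sum_(x : I) (f x)^* * g x.

Definition sqnorm (R : realType) (I : finType) (f : ket R I) : R :=
  complex.Re (\sum_(x : I) `|f x| ^+ 2).

Definition orthonormal2 (R : realType) (I : finType) (f0 f1 : ket R I) : Prop :=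
  [/\ dotk f0 f0 = 1, dotk f1 f1 = 1 & dotk f0 f1 = 0].

Definition bits (I : finType) := {ffun I -> 'I_2}.

Definition others (n : nat) (t : 'I_n) := {k : 'I_n | k != t}.

Definition merge_bits (n : nat) (t : 'I_n) (a : 'I_2) (b : bits (others t)) :
    bits 'I_n :=
  [ffun k => if insub k is Some k' then b k' else a].

(* The n-qubit vector [psi] regarded as a vector of target (x) rest. *)
Definition target_cut (R : realType) (n : nat) (t : 'I_n) (psi : ket R (bits 'I_n)) :
    ket R ('I_2 * bits (others t))%type :=
  [ffun x => psi (merge_bits x.1 x.2)].

Definition schmidt_decomposition (R : realType) (B : finType)
    (phi : ket R ('I_2 * B)%type) (s : R) (u0 u1 : ket R 'I_2) (v0 v1 : ket R B) :
    Prop :=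
  [/\ 0 <= s <= 1, orthonormal2 u0 u1, orthonormal2 v0 v1 &
      forall a b, phi (a, b) =
        s%:C * u0 a * v0 b + (Num.sqrt (1 - s ^+ 2))%:C * u1 a * v1 b].

Definition local_apply (R : realType) (B : finType) (K : 'M[R[i]]_2)
    (phi : ket R ('I_2 * B)%type) : ket R ('I_2 * B)%type :=
  [ffun x => \sum_(a < 2) K x.1 a * phi (a, x.2)].

Definition reduced_density (R : realType) (B : finType)
    (phi : ket R ('I_2 * B)%type) : 'M[R[i]]_2 :=
  \matrix_(a, a') \sum_(b : B) phi (a, b) * (phi (a', b))^*.

(* Spectral functional calculus for a positive semidefinite [A].  Since
   [ln 0 = 0] here, [A *m logmx A] obeys the convention 0 log 0 = 0.  The
   logarithm is the natural one. *)
Definition logmx (R : realType) (d : nat) (A : 'M[R[i]]_d) : 'M[R[i]]_d :=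
  invmx (spectralmx A)
  *m diag_mx (map_mx (fun z : R[i] => (ln (complex.Re z))%:C) (spectral_diag A))
  *m spectralmx A.

Definition vn_entropy (R : realType) (d : nat) (rho : 'M[R[i]]_d) : R :=
  - complex.Re (\tr (rho *m logmx rho)).

Definition entanglement (R : realType) (B : finType)
    (phi : ket R ('I_2 * B)%type) : R :=
  vn_entropy (reduced_density phi).

Definition is_channel (R : realType) (r : nat) (K : 'I_r -> 'M[R[i]]_2) : Prop :=
  \sum_(i < r) (K i)^t* *m K i = 1%:M.

Definition pad (R : realType) (r r' : nat) (K : 'I_r -> 'M[R[i]]_2) (i : 'I_r') :
    'M[R[i]]_2 :=
  if insub (val i) is Some i0 then K i0 else 0.

Definition mixed_kraus (R : realType) (r r' : nat) (K : 'I_r -> 'M[R[i]]_2)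
    (U : 'M[R[i]]_r') (j : 'I_r') : 'M[R[i]]_2 :=
  \sum_(i < r') U i j *: pad K i.

Definition average_entanglement (R : realType) (B : finType) (r r' : nat)
    (phi : ket R ('I_2 * B)%type) (K : 'I_r -> 'M[R[i]]_2) (U : 'M[R[i]]_r') : R :=
  \sum_(j < r')
    let phi' := local_apply (mixed_kraus K U j) phi in
    let p := sqnorm phi' in
    p * entanglement [ffun x => ((Num.sqrt p)^-1)%:C * phi' x].

(* [U] attains the minimum over unitaries of all sizes at least [r]. *)
Definition optimal_unraveling (R : realType) (B : finType) (r r' : nat)
    (phi : ket R ('I_2 * B)%type) (K : 'I_r -> 'M[R[i]]_2) (U : 'M[R[i]]_r') : Prop :=
  [/\ (r <= r')%N, U \is unitarymx &
      forall (m : nat) (W : 'M[R[i]]_m), (r <= m)%N -> W \is unitarymx ->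
        average_entanglement phi K U <= average_entanglement phi K W].

(* A real RAM: while-programs over integer registers and two-dimensional arrays
   of exact complex numbers.  Integers index the arrays and support only
   addition and truncated subtraction.  Complex numbers support the field
   operations, conjugation, the roots [k.-root z] and the order of R[i]
   ([x <= y] iff Im x = Im y and Re x <= Re y); the only constants are the
   naturals and the imaginary unit.  A program is a piece of syntax, so it cannot
   depend on the input or on its size, and its expressions have bounded size:
   assignments and tests are charged one step. *)
Inductive iexp :=
| INat of nat
| IReg of nat
| IAdd of iexp & iexp
| ISub of iexp & iexp.

Inductive cexp :=
| CNat of nat
| CImag
| CCell of nat & iexp & iexp
| CAdd of cexp & cexp
| COpp of cexp
| CMul of cexp & cexp
| CInv of cexp
| CConj of cexp
| CRoot of nat & cexp.

Inductive bexp :=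
| BIle of iexp & iexp
| BCle of cexp & cexp
| BNot of bexp
| BAnd of bexp & bexp.

Inductive cmd :=
| Skip
| ISet of nat & iexp
| CSet of nat & iexp & iexp & cexp
| Seq of cmd & cmd
| If of bexp & cmd & cmd
| While of bexp & cmd.

Record store (R : realType) := Store {
  reg : nat -> nat;
  cell : nat -> nat -> nat -> R[i] }.

Fixpoint ieval (R : realType) (st : store R) (e : iexp) : nat :=
  match e with
  | INat k => k
  | IReg x => reg st x
  | IAdd e1 e2 => (ieval st e1 + ieval st e2)%N
  | ISub e1 e2 => (ieval st e1 - ieval st e2)%N
  end.

Fixpoint ceval (R : realType) (st : store R) (e : cexp) : R[i] :=
  match e with
  | CNat k => k%:R
  | CImag => 'i
  | CCell x i j => cell st x (ieval st i) (ieval st j)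
  | CAdd e1 e2 => ceval st e1 + ceval st e2
  | COpp e1 => - ceval st e1
  | CMul e1 e2 => ceval st e1 * ceval st e2
  | CInv e1 => (ceval st e1)^-1
  | CConj e1 => Num.conj (ceval st e1)
  | CRoot k e1 => k.-root (ceval st e1)
  end.

Fixpoint beval (R : realType) (st : store R) (b : bexp) : bool :=
  match b with
  | BIle e1 e2 => (ieval st e1 <= ieval st e2)%N
  | BCle e1 e2 => ceval st e1 <= ceval st e2
  | BNot b1 => ~~ beval st b1
  | BAnd b1 b2 => beval st b1 && beval st b2
  end.

Definition set_reg (R : realType) (st : store R) (x v : nat) : store R :=
  Store (fun y => if y == x then v else reg st y) (cell st).

Definition set_cell (R : realType) (st : store R) (x i j : nat) (z : R[i]) :
    store R :=
  Store (reg st) (fun y k l =>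
    if [&& y == x, k == i & l == j] then z else cell st y k l).

(* [exec c st T st']: run from [st], the program [c] halts in [st'] after [T]
   steps. *)
Inductive exec (R : realType) : cmd -> store R -> nat -> store R -> Prop :=
| ExSkip st : exec Skip st 1 st
| ExISet st x e : exec (ISet x e) st 1 (set_reg st x (ieval st e))
| ExCSet st x i j e :
    exec (CSet x i j e) st 1
      (set_cell st x (ieval st i) (ieval st j) (ceval st e))
| ExSeq c1 c2 st1 st2 st3 T1 T2 :
    exec c1 st1 T1 st2 -> exec c2 st2 T2 st3 ->
    exec (Seq c1 c2) st1 (T1 + T2) st3
| ExIfT b c1 c2 st st' T :
    beval st b -> exec c1 st T st' -> exec (If b c1 c2) st T.+1 st'
| ExIfF b c1 c2 st st' T :
    ~~ beval st b -> exec c2 st T st' -> exec (If b c1 c2) st T.+1 st'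
| ExWhileF b c st : ~~ beval st b -> exec (While b c) st 1 st
| ExWhileT b c st1 st2 st3 T1 T2 :
    beval st1 b -> exec c st1 T1 st2 -> exec (While b c) st2 T2 st3 ->
    exec (While b c) st1 (T1 + T2).+1 st3.

Lemma exec_deterministic (R : realType) (c : cmd) (st st1 st2 : store R)
    (T1 T2 : nat) :
  exec c st T1 st1 -> exec c st T2 st2 -> T1 = T2 /\ st1 = st2.
Proof.
move=> ex1; elim: ex1 T2 st2 => {c st T1 st1}.
- by move=> st T2 st2 ex2; inversion ex2.
- by move=> st x e T2 st2 ex2; inversion ex2.
- by move=> st x i j e T2 st2 ex2; inversion ex2.
- move=> c1 c2 sa sb sc Ta Tb _ IH1 _ IH2 T2 st2 ex2; inversion ex2; subst.
  have [-> eb] := IH1 _ _ ltac:(eassumption); subst.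
  by have [-> ->] := IH2 _ _ ltac:(eassumption).
- move=> b c1 c2 sa sb Ta hb _ IH T2 st2 ex2; inversion ex2 as [| | | | | ? ? ? ? ? ? hn | |]; subst.
    by have [-> ->] := IH _ _ ltac:(eassumption).
  by rewrite hb in hn.
- move=> b c1 c2 sa sb Ta hb _ IH T2 st2 ex2; inversion ex2 as [| | | | ? ? ? ? ? ? hn | | |]; subst.
    by rewrite hn in hb.
  by have [-> ->] := IH _ _ ltac:(eassumption).
- move=> b c sa hb T2 st2 ex2; inversion ex2 as [| | | | | | | ? ? ? ? ? ? ? hn]; subst=> //.
  by rewrite hn in hb.
- move=> b c sa sb sc Ta Tb hb _ IH1 _ IH2 T2 st2 ex2; inversion ex2 as [| | | | | | ? ? ? hn |]; subst.
    by rewrite hb in hn.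
  have [-> eb] := IH1 _ _ ltac:(eassumption); subst.
  by have [-> ->] := IH2 _ _ ltac:(eassumption).
Qed.

(* A representation of many-qubit vectors: [dec n w] is the n-qubit vector
   encoded by the finite list of parameters [w] (e.g. bond dimensions and
   entries of the tensors of a matrix product state), if any. *)
Definition representation (R : realType) :=
  forall n : nat, seq R[i] -> option (ket R (bits 'I_n)).

Definition represents (R : realType) (dec : representation R) (n : nat)
    (w : seq R[i]) (psi : ket R (bits 'I_n)) : Prop :=
  dec n w = Some psi /\ sqnorm psi = 1.

(* Registers 0, 1, 2 hold n, the target and [size w]; array 0 holds [w]. *)
Definition state_input (R : realType) (n t : nat) (w : seq R[i]) : store R :=
  Store (fun x => nth 0%N [:: n; t; size w] x)
        (fun x i j => if (x == 0%N) && (j == 0%N) then w`_i else 0).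

(* In addition, register 3 holds [r] and array 1 holds the 2r x 2 matrix
   obtained by stacking the Kraus operators. *)
Definition problem_input (R : realType) (n t : nat) (w : seq R[i]) (r : nat)
    (K : 'I_r -> 'M[R[i]]_2) : store R :=
  Store (fun x => nth 0%N [:: n; t; size w; r] x)
        (fun x i j =>
           if (x == 0%N) && (j == 0%N) then w`_i else
           if (x == 1%N) && (j < 2)%N then
             if insub i./2 is Some k then K k (inord (odd i)) (inord j) else 0
           else 0).

(* Array 0 holds s in cell (0, 0) and u0, u1 in rows 1 and 2.  Only the
   existence of v0 and v1 is required. *)
Definition schmidt_output (R : realType) (n : nat) (t : 'I_n)
    (psi : ket R (bits 'I_n)) (st : store R) : Prop :=
  exists (s : R) (u0 u1 : ket R 'I_2) (v0 v1 : ket R (bits (others t))),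
    [/\ schmidt_decomposition (target_cut t psi) s u0 u1 v0 v1,
        cell st 0 0 0 = s%:C,
        forall a : 'I_2, cell st 0 1 a = u0 a &
        forall a : 'I_2, cell st 0 2 a = u1 a].

(* Register 0 holds r' and array 0 holds the r' x r' matrix U. *)
Definition output_matrix (R : realType) (st : store R) : 'M[R[i]]_(reg st 0) :=
  \matrix_(i, j) cell st 0 i j.

(* The polynomial bounds below are of the form c * N ^ d.  At least two qubits
   are needed for v0 and v1 to be orthonormal. *)
Definition schmidt_efficient (R : realType) (dec : representation R) : Prop :=
  exists (S : cmd) (c d : nat),
    forall (n : nat) (t : 'I_n) (w : seq R[i]) (psi : ket R (bits 'I_n)),
      (1 < n)%N -> represents dec w psi ->
      exists (T : nat) (st : store R),
        [/\ exec S (state_input n t w) T st,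
            (T <= c * (n + size w) ^ d)%N &
            schmidt_output t psi st].

(* Main.v *)
(* If A is the 2 x 2 matrix of Schmidt amplitudes of the state, the outcome K'_j
   has weight p_j = ||K'_j A||^2 and entropy f(|q_j| / p_j), where q_j = 2 det(K'_j A)
   and f is increasing and convex in the concurrence |q_j| / p_j.  Convexity bounds
   the average entropy below by f of the average concurrence, so an unraveling whose
   outcomes all have the smallest possible average concurrence C is optimal.  As det
   is a quadratic form, mixing by W turns the symmetric matrix tau of its polar form
   on the K_i A into W^T tau W.  If lam_0 >= lam_1 >= lam_2 >= lam_3 are the Takagi
   values of tau, which has rank at most four, then C = max(0, lam_0 - lam_1 - lam_2
   - lam_3), as in Wootters' formula for the entanglement of formation.

   The value C is attained at every outcome by exact arithmetic in finitely many
   steps: the amplitude rows are triangularized by Givens rotations; the squares of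
   the Takagi values are roots of a quartic, solved by radicals; con-eigenvectors
   follow from a Krylov iteration over these roots; at last, phases and rotations of
   pairs of columns equalize the concurrences of the four nonzero outcomes. *)

Require Import Defs.
From HB Require Import structures.
From mathcomp Require Import all_boot all_order all_algebra.
From mathcomp Require Import complex.
From mathcomp Require Import all_classical all_reals all_analysis.
From mathcomp Require Import ring lra zify.

Set Implicit Arguments.
Unset Strict Implicit.
Unset Printing Implicit Defensive.

Import Order.TTheory GRing.Theory Num.Theory.
Import numFieldNormedType.Exports.
Local Open Scope complex_scope.
Local Open Scope ring_scope.
Local Open Scope sesquilinear_scope.


(** * Binary entropy as a function of the concurrence *)

Section Entropy.
Variable R : realType.
Implicit Types s t u x y : R.

(** Every column operation acts on one array that stacks an identity block over the amplitude rows.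
    Unitary mixing of columns preserves the Gram matrix of the rows, and this invariant carries the
    correctness proof: the top block stays unitary, the amplitude rows are mixed by exactly this
    block, and the spectrum needed for the con-eigenvectors, a function of the Gram matrix of the
    amplitude rows, is computed only once. A 2 x 2 outcome has four amplitudes, so four columns
    carry all of them and the characteristic polynomial has degree four, still solvable by radicals;
    the size r + 4 supplies these columns for every r. The obstacle is exactness in degenerate
    cases: repeated or zero eigenvalues must be handled without knowledge of multiplicities. Hence a
    Krylov shift that would annihilate the vector is skipped, and the balancing of columns leaves a
    vanishing defect alone. Competing unitaries may have any size; the lower bound therefore
    compares coefficient families truncated to the r actual operators, and convexity is used only
    through a single support line. *)

Definition cosh2 t : R := expR t + expR (- t).
Definition sinh2 t : R := expR t - expR (- t).

Lemma cosh2_gt0 t : 0 < cosh2 t.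
Proof. by rewrite addr_gt0 ?expR_gt0. Qed.

Lemma is_derive_expRN t : is_derive t 1 (fun u => expR (- u)) (- expR (- t)).
Proof.
have -> : (fun u => expR (- u)) = expR \o -%R by [].
by apply: is_derive_eq; rewrite mulrN1.
Qed.

Lemma is_derive_cosh2 t : is_derive t 1 cosh2 (sinh2 t).
Proof.
have h := is_derive_expRN t.
by apply: is_derive_eq.
Qed.

Lemma is_derive_sinh2 t : is_derive t 1 sinh2 (cosh2 t).
Proof.
have h := is_derive_expRN t.
apply: is_derive_eq; by rewrite opprK.
Qed.

Lemma MVT_everywhere (f df : R -> R) a b : a <= b ->
  (forall x, is_derive x 1 f (df x)) ->
  exists2 c, a <= c <= b & f b - f a = df c * (b - a).
Proof.
move=> ab fdf.
have cf : ({within `[a, b], continuous f})%classic.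
  apply: continuous_subspaceT => x.
  apply: differentiable_continuous; apply/derivable1_diffP.
  by have /@ex_derive := fdf x.
have [c cab e] := MVT_segment ab (fun x _ => fdf x) cf.
by exists c => //; rewrite in_itv /= in cab.
Qed.

Lemma sinh2_homo s t : s <= t -> sinh2 s <= sinh2 t.
Proof. by move=> st; rewrite lerB ?ler_expR ?lerN2. Qed.

Lemma sinh2_ge0 t : 0 <= t -> 0 <= sinh2 t.
Proof. by move/sinh2_homo; rewrite {1}/sinh2 oppr0 subrr. Qed.

Lemma sinh2_gt0 t : 0 < t -> 0 < sinh2 t.
Proof. by move=> t0; rewrite subr_gt0 ltr_expR; lra. Qed.

Lemma cosh2_homo s t : 0 <= s -> s <= t -> cosh2 s <= cosh2 t.
Proof.
move=> s0 st; rewrite -subr_ge0.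
have [c /andP[sc _] ->] := MVT_everywhere st is_derive_cosh2.
by apply: mulr_ge0; [apply/sinh2_ge0/(le_trans s0) | rewrite subr_ge0].
Qed.

Lemma sinh2_le_mulcosh2 t : 0 <= t -> sinh2 t <= t * cosh2 t.
Proof.
move=> t0.
have [c /andP[c0 ct] e] := MVT_everywhere t0 is_derive_sinh2.
have s0 : sinh2 0 = 0 by rewrite /sinh2 oppr0 subrr.
move: e; rewrite s0 !subr0 => ->.
by rewrite [cosh2 c * t]mulrC ler_wpM2l// cosh2_homo.
Qed.

(** Monotonicity of sinh t / t, cross-multiplied so that s = 0 is included. It places the sign
    change of the derivative of [gap] at the chosen point. *)
Lemma sinh2_slope s t : 0 <= s -> s <= t -> t * sinh2 s <= s * sinh2 t.
Proof.
move=> s0 st; rewrite -subr_ge0.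
have dd u : is_derive u 1 (fun v => s * sinh2 v - v * sinh2 s)
    (s * cosh2 u - sinh2 s).
  have h := is_derive_sinh2 u.
  apply: is_derive_eq.
  by rewrite /GRing.scale /=; ring.
have [c /andP[sc ct]] := MVT_everywhere st dd.
rewrite subrr subr0 => ->.
rewrite mulr_ge0 ?subr_ge0// (le_trans (sinh2_le_mulcosh2 s0))//.
by rewrite ler_wpM2l// cosh2_homo.
Qed.

Definition binent x y : R := - (x * ln x + y * ln y).

(* With [k] the slope of the support line at [T], the derivative of this
   function is [(k * sinh t - t) / cosh t ^+ 2]. *)
Definition gap (k t : R) : R :=
  ln (cosh2 t) - t * sinh2 t / cosh2 t - 2 * k / cosh2 t.

Lemma cosh2_sinh2 t : cosh2 t ^+ 2 - sinh2 t ^+ 2 = 4.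
Proof.
rewrite /cosh2 /sinh2.
have e : expR t * expR (- t) = 1 by rewrite -expRD subrr expR0.
by ring: e.
Qed.

Lemma is_derive_gap k t :
  is_derive t 1 (gap k) (2 * (k * sinh2 t - 2 * t) / cosh2 t ^+ 2).
Proof.
have hc := is_derive_cosh2 t; have hs := is_derive_sinh2 t.
have c0 := cosh2_gt0 t.
have hl : is_derive t 1 (@ln R \o cosh2) ((cosh2 t)^-1 * sinh2 t).
  have h := is_derive1_ln c0.
  by apply: is_derive_eq; rewrite mulrC.
have hi : is_derive t 1 (fun u => (cosh2 u)^-1) (- sinh2 t / cosh2 t ^+ 2).
  have cn : cosh2 t != 0 by rewrite gt_eqF.
  have [dc ec] := hc.
  apply: DeriveDef; first exact: derivableV.
  by rewrite deriveV// ec /GRing.scale /=; field.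
have -> : gap k = (@ln R \o cosh2) - (fun u => u * sinh2 u * (cosh2 u)^-1)
      - (fun u => 2 * k * (cosh2 u)^-1).
  by apply/funext => u.
apply: is_derive_eq.
rewrite /GRing.scale /= .
have cn : cosh2 t != 0 by rewrite gt_eqF.
have e := cosh2_sinh2 t.
have -> : (2 * (k * sinh2 t - 2 * t)) = 2 * k * sinh2 t - t * (cosh2 t ^+ 2 - sinh2 t ^+ 2).
  by rewrite e; ring.
by field.
Qed.

(** The two hypotheses on [k] fix the sign of the derivative of [gap k] on either side of T, which
    makes T a global minimum on the half-line. *)
Lemma gap_min k t T : 0 <= t -> 0 <= T ->
  (forall u, 0 <= u -> u <= T -> k * sinh2 u <= 2 * u) ->
  (forall u, T <= u -> 2 * u <= k * sinh2 u) -> gap k T <= gap k t.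
Proof.
move=> t0 T0 lo hi; rewrite -subr_ge0.
have [tT|Tt] := lerP t T.
  have [c /andP[tc cT]] := MVT_everywhere tT (is_derive_gap k).
  move=> e; have {e} -> : gap k t - gap k T =
      - ((2 * (k * sinh2 c - 2 * c) / cosh2 c ^+ 2) * (T - t)).
    by move: e; lra.
  rewrite oppr_ge0 mulr_le0_ge0 ?subr_ge0// mulr_le0_ge0 ?invr_ge0 ?sqr_ge0//.
  by rewrite mulr_ge0_le0// subr_le0 lo// (le_trans t0).
have [c /andP[tc cT] ->] := MVT_everywhere (ltW Tt) (is_derive_gap k).
rewrite mulr_ge0 ?subr_ge0 ?(ltW Tt)// mulr_ge0 ?invr_ge0 ?sqr_ge0//.
by rewrite mulr_ge0// subr_ge0 hi.
Qed.

End Entropy.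

(** * Support lines of the entropy as a function of the concurrence *)

Section Support.
Variable R : realType.
Implicit Types x y t T k C : R.

Lemma ln_cosh2 t : ln (cosh2 t) <= t + expR (- t) ^+ 2.
Proof.
have -> : cosh2 t = expR t * (1 + expR (- t) ^+ 2).
  have e : expR t * expR (- t) = 1 by rewrite -expRD subrr expR0.
  by rewrite /cosh2; ring: e.
have h := sqr_ge0 (expR (- t)).
rewrite lnM ?posrE ?expR_gt0 ?ltr_wpDr// expRK lerD2l.
by apply: le_ln1Dx; rewrite (lt_le_trans _ h)// ltrN10.
Qed.

Lemma sinh2_ge_double t : 0 <= t -> 2 * t <= sinh2 t.
Proof.
move=> t0; have [c /andP[c0 ct]] := MVT_everywhere t0 (@is_derive_sinh2 R).
have e0 : sinh2 0 = 0 :> R by rewrite /sinh2 oppr0 subrr.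
rewrite e0 !subr0 => ->; apply: ler_wpM2r => //.
have := cosh2_homo (lexx 0) c0.
by rewrite {1}/cosh2 oppr0 expR0.
Qed.

(** The slope is T / sinh T, with its limit 1 at T = 0. The last clause concerns the intercept of
    the support line at concurrence zero: it covers product states, for which the parameter t would
    be infinite. *)
Lemma support_slope T : 0 <= T -> exists k : R,
  [/\ 0 <= k, forall u : R, 0 <= u -> u <= T -> k * sinh2 u <= 2 * u,
    forall u, T <= u -> 2 * u <= k * sinh2 u & gap k T <= 0].
Proof.
rewrite le_eqVlt => /predU1P[<-|T0].
  exists 1; split => //.
  - move=> u u0 u0'; have -> : u = 0 by apply/eqP; rewrite eq_le u0 u0'.
    by rewrite /sinh2 oppr0 subrr !mulr0.
  - by move=> u u0; rewrite mul1r sinh2_ge_double.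
  - have e0 : cosh2 0 = 2 :> R by rewrite /cosh2 oppr0 expR0.
    rewrite /gap e0 !mul0r mulr1 divff// subr0 subr_le0.
    have -> : 2 = 1 + 1 :> R by ring.
    exact: le_ln1Dx.
have s0 := sinh2_gt0 T0; have c0 := cosh2_gt0 T.
exists (2 * T / sinh2 T); split => //.
- by rewrite divr_ge0// ?ltW// mulr_gt0.
- move=> u u0 uT; rewrite mulrAC ler_pdivrMr//.
  by rewrite -!mulrA ler_pM2l// sinh2_slope.
- move=> u Tu; rewrite mulrAC ler_pdivlMr//.
  by rewrite -!mulrA ler_pM2l// sinh2_slope// ltW.
- have e4 := cosh2_sinh2 T.
  have -> : gap (2 * T / sinh2 T) T = ln (cosh2 T) - T * cosh2 T / sinh2 T.
    rewrite /gap; have sn : sinh2 T != 0 by rewrite gt_eqF.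
    have cn : cosh2 T != 0 by rewrite gt_eqF.
    have -> : 2 * (2 * T / sinh2 T) = (cosh2 T ^+ 2 - sinh2 T ^+ 2) * T / sinh2 T.
      by rewrite e4; field.
    by field; rewrite sn cn.
  (* With ln (2 cosh T) bounded by T + exp (- 2 T), what remains is 1 - exp (- 2 T) <= 2 T. *)
  rewrite subr_le0 (le_trans (ln_cosh2 T))// ler_pdivlMr//.
  have e : expR T * expR (- T) = 1 by rewrite -expRD subrr expR0.
  have d1 : expR (- T) * sinh2 T <= 2 * T.
    have -> : expR (- T) * sinh2 T = 1 - expR (- (2 * T)).
      by rewrite /sinh2 mulrBr -!expRD addNr expR0; congr (_ - expR _); ring.
    have := expR_ge1Dx (- (2 * T)); lra.
  rewrite mulrDl -lerBrDl.
  have -> : T * cosh2 T - T * sinh2 T = (2 * T) * expR (- T).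
    by rewrite /cosh2 /sinh2; ring.
  have -> : expR (- T) ^+ 2 * sinh2 T = expR (- T) * sinh2 T * expR (- T) by ring.
  by rewrite ler_pM2r ?expR_gt0.
Qed.

(** For t half the logarithm of x / y, the eigenvalues are exp (t) / (2 cosh t) and exp (- t) / (2
    cosh t). The concurrence becomes 1 / cosh t, and [gap] is the entropy minus a line through the
    origin. *)
Lemma binent_gap x y : 0 < y -> y <= x -> x + y = 1 ->
  exists t : R, [/\ 0 <= t, 2 * Num.sqrt (x * y) = 2 / cosh2 t &
    forall k, binent x y - k * (2 * Num.sqrt (x * y)) = gap k t].
Proof.
move=> y0 yx xy1; have x0 := lt_le_trans y0 yx.
set t := (ln x - ln y) / 2; exists t.
have t0 : 0 <= t by rewrite divr_ge0// subr_ge0 ler_ln ?posrE.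
have e : expR t * expR (- t) = 1 by rewrite -expRD subrr expR0.
have c0 := cosh2_gt0 t; have cn : cosh2 t != 0 by rewrite gt_eqF.
have e2 : y * expR t = x * expR (- t).
  by rewrite -{1}(@lnK _ y)// -{1}(@lnK _ x)// -!expRD /t; congr expR; field.
have Ex : x = expR t / cosh2 t.
  apply: (mulIf cn); rewrite divfK// /cosh2 mulrDr -e2 -mulrDl.
  by rewrite xy1 mul1r.
have Ey : y = expR (- t) / cosh2 t.
  apply: (mulIf cn); rewrite divfK// /cosh2 mulrDr e2 -mulrDl.
  by rewrite addrC in xy1; rewrite addrC xy1 mul1r.
have es : Num.sqrt (x * y) = (cosh2 t)^-1.
  rewrite Ex Ey mulrACA e mul1r -expr2 sqrtr_sqr ger0_norm//.
  by rewrite invr_ge0 ltW.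
split => //; first by rewrite es.
move=> k'; rewrite es /gap /binent.
have -> : ln x = t - ln (cosh2 t).
  by rewrite Ex ln_div ?posrE ?expR_gt0// expRK.
have -> : ln y = - t - ln (cosh2 t).
  by rewrite Ey ln_div ?posrE ?expR_gt0// expRK.
have -> : t * sinh2 t / cosh2 t = t * (x - y).
  by rewrite Ex Ey /sinh2 -mulrA -mulrBl.
have -> : y = 1 - x by move: xy1; lra.
by field.
Qed.

Lemma binentC x y : binent x y = binent y x.
Proof. by rewrite /binent addrC. Qed.

(** The witness is arcosh (1 / C), written as a logarithm. *)
Lemma cosh2_surj C : 0 < C -> C <= 1 -> exists2 T : R, 0 <= T & 2 / cosh2 T = C.
Proof.
move=> C0 C1; set w := Num.sqrt (1 - C ^+ 2).
have w2 : w ^+ 2 = 1 - C ^+ 2 by rewrite sqr_sqrtr// subr_ge0 expr_le1// ltW.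
have w0 : 0 <= w by apply: sqrtr_ge0.
have a0 : 0 < (1 + w) / C by rewrite divr_gt0// ltr_wpDr.
exists (ln ((1 + w) / C)).
  by rewrite ln_ge0// ler_pdivlMr// mul1r; lra.
have wn : 1 + w != 0 by rewrite gt_eqF// ltr_wpDr.
have Cn : C != 0 by rewrite gt_eqF.
rewrite /cosh2 expRN lnK ?posrE//.
have Cw : C ^+ 2 = (1 + w) * (1 - w) by move: w2; lra.
have -> : ((1 + w) / C)^-1 = (1 - w) / C.
  apply: (mulIf wn); rewrite invf_div divfK//.
  by apply: (mulIf Cn); rewrite -expr2 Cw; field.
rewrite -mulrDl; have -> : 1 + w + (1 - w) = 2 by ring.
by rewrite invf_div mulrC divfK.
Qed.

(** [h] is the entropy at concurrence [C] and [m] the slope of a support line there. That [m] is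
    nonnegative later turns a lower bound on the average concurrence into one on the average
    entropy. At [C] = 0 the zero line serves. *)
Lemma binent_support C : 0 <= C -> C <= 1 -> exists m h : R,
  0 <= m /\ forall x y, 0 <= x -> 0 <= y -> x + y = 1 ->
    h + m * (2 * Num.sqrt (x * y) - C) <= binent x y /\
    (2 * Num.sqrt (x * y) = C -> binent x y = h).
Proof.
have binent01 : binent 0 1 = 0 :> R by rewrite /binent ln1 mulr0 mul0r addr0 oppr0.
have sym (m h : R) : (forall x y, 0 <= y -> y <= x -> x + y = 1 ->
    h + m * (2 * Num.sqrt (x * y) - C) <= binent x y /\
    (2 * Num.sqrt (x * y) = C -> binent x y = h)) ->
  forall x y, 0 <= x -> 0 <= y -> x + y = 1 ->
    h + m * (2 * Num.sqrt (x * y) - C) <= binent x y /\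
    (2 * Num.sqrt (x * y) = C -> binent x y = h).
  move=> H x y x0 y0 xy1; have [yx|xy] := lerP y x; first exact: H.
  by rewrite [x * y]mulrC binentC; apply: H; rewrite ?(ltW xy)// addrC.
rewrite le_eqVlt => /predU1P[C0 _|C0 C1].
  exists 0, 0; split => //; apply: (sym 0 0) => x y y0 yx xy1.
  have x1 : x <= 1 by lra.
  have y1 : y <= 1 by lra.
  rewrite mul0r addr0; split.
    have hx : x * ln x <= 0 by rewrite mulr_ge0_le0 ?ln_le0// (le_trans y0).
    have hy : y * ln y <= 0 by rewrite mulr_ge0_le0 ?ln_le0.
    rewrite /binent; lra.
  rewrite -C0 => /eqP; rewrite mulf_eq0 pnatr_eq0 /= sqrtr_eq0 => xy0.
  have [ye|yn] := eqVneq y 0.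
    have -> : x = 1 by lra.
    by rewrite ye binentC binent01.
  have yp : 0 < y by rewrite lt_def yn.
  by move: xy0; rewrite leNgt mulr_gt0// (lt_le_trans yp).
have [T T0 CT] := cosh2_surj C0 C1.
have [k [k0 lo hi g0]] := support_slope T0.
exists k, (gap k T + k * C); split => //; apply: (sym k) => x y y0 yx xy1.
have -> : gap k T + k * C + k * (2 * Num.sqrt (x * y) - C) =
    gap k T + k * (2 * Num.sqrt (x * y)) by ring.
(* For y = 0 the hyperbolic parameter does not exist; the sign of [gap k T] settles this case. *)
move: y0; rewrite le_eqVlt => /predU1P[y0|y0].
  rewrite -y0 mulr0 sqrtr0 !mulr0 addr0.
  have -> : x = 1 by lra.
  by rewrite binentC binent01; split => // Ce; rewrite -Ce ltxx in C0.
have [t [t0 te G]] := binent_gap y0 yx xy1.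
split; first by have := gap_min t0 T0 lo hi; rewrite -(G k); lra.
move=> e; have := G k; rewrite e.
suff -> : t = T by lra.
have ec : cosh2 t = cosh2 T.
  move: te; rewrite e -CT => /esym/(mulfI _) h; apply: invr_inj.
  by apply: h; rewrite pnatr_eq0.
have inj (u v : R) : 0 <= u -> u <= v -> cosh2 u = cosh2 v -> sinh2 u = sinh2 v.
  move=> u0 uv cc; have := cosh2_sinh2 u; have := cosh2_sinh2 v; rewrite cc => <-.
  move=> /addrI/oppr_inj/eqP; rewrite eqrXn2// ?sinh2_ge0//; last exact: le_trans uv.
  by move/eqP.
have sc (u : R) : expR u = (cosh2 u + sinh2 u) / 2 by rewrite /cosh2 /sinh2; field.
apply: expR_inj; rewrite !sc ec.
have [tT|Tt] := lerP t T; first by rewrite (inj _ _ t0 tT).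
by rewrite (inj T t)// ltW.
Qed.

End Support.

Lemma ord_lift01 : lift ord0 ord0 = 1 :> 'I_2.
Proof. exact: val_inj. Qed.

(** * Entanglement of a two-qubit factor *)

Section Density.
Variable R : realType.
Local Notation C := R[i].
Implicit Types A K : 'M[C]_2.

Definition gram2 A : 'M[C]_2 := A *m A^t*.
Definition weight A : C := \tr (gram2 A).
Definition qform A : C := 2 * \det A.

Lemma realC (x : R) : x%:C \is Num.real.
Proof. by apply/complex_realP; exists x. Qed.

Lemma hermsymm_gram2 A : gram2 A \is hermsymmx.
Proof.
apply/is_hermitianmxP; rewrite expr0 scale1r /gram2.
by rewrite trmx_mul map_mxM /= trmxCK.
Qed.

Lemma hermsymmZ (x : R) A : A \is hermsymmx -> x%:C *: A \is hermsymmx.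
Proof.
move=> /is_hermitianmxP h; apply/is_hermitianmxP; rewrite expr0 scale1r in h *.
apply/matrixP => i j; have /matrixP/(_ i j) := h; rewrite !mxE => ->.
rewrite rmorphM /= (@conj_Creal _ (x%:C)); last exact: realC.
by rewrite mul1r.
Qed.

(** Trace and determinant determine the two eigenvalues up to order, and both entropy and
    concurrence are symmetric in them. *)
Lemma vn_entropy_binent (rho : 'M[C]_2) : rho \is hermsymmx ->
  exists x y : R, [/\ x%:C + y%:C = \tr rho, x%:C * y%:C = \det rho &
    vn_entropy rho = binent x y].
Proof.
move=> hrho; have /orthomx_spectralP e := hermitian_normalmx hrho.
have rD := hermitian_spectral_diag_real hrho.
set P := spectralmx rho in e; set D := spectral_diag rho in e rD.
have uP : P \in unitmx by apply: spectral_unit.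
have D0 k : D 0 k = (complex.Re (D 0 k))%:C.
  by rewrite RRe_real//; apply: (mxOverP rD).
exists (complex.Re (D 0 0)), (complex.Re (D 0 1)); rewrite -!D0.
have trE (E : 'M[C]_2) : \tr (invmx P *m E *m P) = \tr E.
  by rewrite mxtrace_mulC mulmxA mulmxV// mul1mx.
have tr2 (d : 'rV[C]_2) : \tr (diag_mx d) = d 0 0 + d 0 1.
  by rewrite mxtrace_diag big_ord_recl big_ord1 ord_lift01.
split.
- by rewrite e trE tr2.
- rewrite {1}e !det_mulmx mulrAC -det_mulmx mulVmx// det1 mul1r det_diag.
  by rewrite big_ord_recl big_ord1 ord_lift01.
- rewrite /vn_entropy /logmx -/P -/D {1}e -!mulmxA (mulmxA P) mulmxV// mul1mx.
  rewrite !mulmxA -(mulmxA (invmx P)) mulmx_diag trE tr2 !mxE.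
  rewrite /binent D0 [D 0 1]D0 -!rmorphM -rmorphD /=.
  by [].
Qed.

Lemma weightE A : weight A = \sum_a \sum_k `|A a k| ^+ 2.
Proof.
apply: eq_bigr => a _; rewrite !mxE; apply: eq_bigr => k _.
by rewrite !mxE normCK.
Qed.

Lemma weight_ge0 A : 0 <= weight A.
Proof. by rewrite weightE sumr_ge0// => a _; rewrite sumr_ge0// => k _; rewrite exprn_ge0. Qed.

Lemma Re_weight A : (complex.Re (weight A))%:C = weight A.
Proof. by rewrite RRe_real// ger0_real// weight_ge0. Qed.

Lemma Re_weight_ge0 A : 0 <= complex.Re (weight A).
Proof. by rewrite -lecR Re_weight weight_ge0. Qed.

Lemma weight_eq0 A : weight A = 0 -> A = 0.
Proof.
rewrite weightE => /eqP; rewrite psumr_eq0; last first.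
  by move=> a _; rewrite sumr_ge0// => k _; rewrite exprn_ge0.
move=> /allP h; apply/matrixP => a k; rewrite mxE.
have := h a; rewrite mem_index_enum => /(_ isT) /=.
rewrite psumr_eq0; last by move=> l _; rewrite exprn_ge0.
move=> /allP/(_ k); rewrite mem_index_enum => /(_ isT) /=.
by rewrite expf_eq0 /= normr_eq0 => /eqP.
Qed.

Lemma det_gram2 A : \det (gram2 A) = `|\det A| ^+ 2.
Proof. by rewrite det_mulmx det_map_mx det_tr normCK. Qed.

Definition entropy_term A : R :=
  complex.Re (weight A) * vn_entropy ((complex.Re (weight A))^-1%:C *: gram2 A).

Lemma Re_norm (z : C) : (complex.Re `|z|)%:C = `|z|.
Proof. by rewrite RRe_real// normr_real. Qed.

(* The Schmidt coefficients of the normalized state are square roots of the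
   eigenvalues [x], [y], so [2 * sqrt (x * y)] is its concurrence. *)
Lemma entropy_term_binent A : weight A != 0 -> exists x y : R,
  [/\ 0 <= x, 0 <= y, x + y = 1,
      complex.Re (weight A) * (2 * Num.sqrt (x * y)) = complex.Re `|qform A| &
      entropy_term A = complex.Re (weight A) * binent x y].
Proof.
move=> A0; set p := complex.Re (weight A).
have pE : p%:C = weight A by apply: Re_weight.
have p0 : p != 0 by apply: contraNneq A0 => p0; rewrite -pE p0.
have pp : 0 < p by rewrite lt_def p0 Re_weight_ge0.
have [x [y [sxy pxy e]]] := vn_entropy_binent (hermsymmZ p^-1 (hermsymm_gram2 A)).
have xy1 : x + y = 1.
  apply: complexI; rewrite rmorphD /= sxy linearZ /= -/(weight A) -pE.
  by rewrite fmorphV /= mulVf// fmorph_eq0.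
have xyE : (x * y)%:C = (p^-1)%:C ^+ 2 * `|\det A| ^+ 2.
  by rewrite rmorphM /= pxy detZ det_gram2.
have dA : `|\det A| = (complex.Re `|\det A|)%:C by rewrite Re_norm.
have d0 : 0 <= complex.Re `|\det A| by rewrite -ler0c -dA normr_ge0.
have xyE' : x * y = (p^-1 * complex.Re `|\det A|) ^+ 2.
  by apply: complexI; rewrite xyE dA exprMn rmorphM !rmorphXn.
have sE : Num.sqrt (x * y) = p^-1 * complex.Re `|\det A|.
  by rewrite xyE' sqrtr_sqr ger0_norm// mulr_ge0// invr_ge0 ltW.
have xy0 : 0 <= x * y by rewrite xyE' sqr_ge0.
exists x, y; split => //.
- by nra.
- by nra.
- rewrite sE mulrCA mulVKf//; apply: complexI.
  by rewrite Re_norm /qform normrM rmorphM /= Re_norm normr_nat rmorph_nat.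
- by rewrite /entropy_term -/p e.
Qed.

(** The concurrence is at most one: 2 sqrt (x y) <= x + y. *)
Lemma qform_le_weight A : `|qform A| <= weight A.
Proof.
have [/weight_eq0 ->|A0] := eqVneq (weight A) 0.
  by rewrite /qform det0 mulr0 normr0 weight_ge0.
have [x [y [x0 y0 xy1 e _]]] := entropy_term_binent A0.
rewrite -Re_norm -Re_weight lecR -e ler_piMr ?Re_weight_ge0//.
rewrite sqrtrM//; set a := Num.sqrt x; set b := Num.sqrt y.
have ax : a ^+ 2 = x := sqr_sqrtr x0.
have bx : b ^+ 2 = y := sqr_sqrtr y0.
by have := sqr_ge0 (a - b); lra.
Qed.

Section Factor.
Variables (B : finType) (v : 'I_2 -> ket R B).
Hypothesis ov : forall k l, dotk (v k) (v l) = (k == l)%:R.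

Definition factors (phi : ket R ('I_2 * B)%type) A :=
  forall a b, phi (a, b) = \sum_k A a k * v k b.

Lemma reduced_density_factors phi A :
  factors phi A -> reduced_density phi = gram2 A.
Proof.
move=> h; apply/matrixP => a a'; rewrite !mxE.
under eq_bigr => b _.
  rewrite !h rmorph_sum /= big_distrlr /=.
  under eq_bigr => k _ do under eq_bigr => l _ do rewrite rmorphM /= mulrACA.
  over.
rewrite exchange_big /=; apply: eq_bigr => k _.
rewrite exchange_big /= (bigD1 k) //= [X in _ + X]big1 => [|l lk].
  rewrite addr0 -mulr_sumr !mxE.
  under eq_bigr => b _ do rewrite mulrC.
  by rewrite [X in _ * X]ov eqxx mulr1.
rewrite -mulr_sumr; under eq_bigr => b _ do rewrite mulrC.
by rewrite [X in _ * X]ov (negbTE lk) mulr0.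
Qed.

Lemma sqnorm_factors phi A : factors phi A -> sqnorm phi = complex.Re (weight A).
Proof.
move=> h; rewrite /sqnorm /weight -(reduced_density_factors h).
congr complex.Re; rewrite (eq_bigr (fun z => `|phi (z.1, z.2)| ^+ 2)); last by case.
rewrite -(pair_bigA _ (fun a b => `|phi (a, b)| ^+ 2)) /=.
by apply: eq_bigr => a _; rewrite mxE; apply: eq_bigr => b _; rewrite normCK.
Qed.

Lemma local_apply_factors K phi A :
  factors phi A -> factors (local_apply K phi) (K *m A).
Proof.
move=> h a b; rewrite ffunE /=.
under eq_bigr => c _ do rewrite h mulr_sumr.
rewrite exchange_big /=; apply: eq_bigr => k _.
by rewrite mxE mulr_suml; apply: eq_bigr => c _; rewrite mulrA.
Qed.

Lemma scale_factors (z : C) phi A :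
  factors phi A -> factors [ffun x => z * phi x] (z *: A).
Proof.
move=> h a b; rewrite ffunE h mulr_sumr.
by apply: eq_bigr => k _; rewrite mxE mulrA.
Qed.

Lemma average_entanglement_factors r r' phi A (Ks : 'I_r -> 'M[C]_2)
    (U : 'M[C]_r') : factors phi A ->
  average_entanglement phi Ks U =
  \sum_(j < r') entropy_term (mixed_kraus Ks U j *m A).
Proof.
move=> h; apply: eq_bigr => j _ /=.
have hj := local_apply_factors (mixed_kraus Ks U j) h.
set A' := _ *m A in hj *; rewrite (sqnorm_factors hj) /entropy_term.
congr (_ * _); rewrite /entanglement.
rewrite (reduced_density_factors (scale_factors _ hj)).
congr vn_entropy; rewrite /gram2; set p := complex.Re _.
have -> : (((Num.sqrt p)^-1)%:C *: A')^t* = ((Num.sqrt p)^-1)%:C *: A'^t*.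
  apply/matrixP => a k; rewrite !mxE rmorphM /=.
  by rewrite (@conj_Creal _ (((Num.sqrt p)^-1)%:C)) //; exact: realC.
rewrite -scalemxAl -scalemxAr scalerA; congr (_ *: _).
(* This also holds for an outcome of probability zero, where both inverses are 0 by convention. *)
by rewrite -rmorphM /= -invfM -expr2 sqr_sqrtr// Re_weight_ge0.
Qed.

End Factor.

End Density.

Lemma sum_sqnorm_unitary (C : numClosedFieldType) m (W : 'M[C]_m) (x : 'I_m -> C) :
  W \is unitarymx ->
  \sum_j `|\sum_i W i j * x i| ^+ 2 = \sum_i `|x i| ^+ 2.
Proof.
move=> /unitarymxP WW; set X := \row_i x i.
have e (Y : 'rV[C]_m) : (Y *m Y^t*) 0 0 = \sum_j `|Y 0 j| ^+ 2.
  by rewrite mxE; apply: eq_bigr => j _; rewrite !mxE normCK.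
have := e X; have := e (X *m W).
rewrite trmx_mul map_mxM /= mulmxA -(mulmxA X) WW mulmx1 => ->.
under eq_bigr => j _.
  rewrite mxE; under eq_bigr => i _ do rewrite mxE mulrC.
  over.
by move=> ->; apply: eq_bigr => j _; rewrite mxE.
Qed.

(** * A sufficient condition for optimality *)

Section Optimality.
Variable R : realType.
Local Notation C := R[i].

(** The padding of [pad], indexed by [nat] so that one family serves unitaries of every size. *)
Definition kraus_at r (K : 'I_r -> 'M[C]_2) (i : nat) : 'M[C]_2 :=
  if insub i is Some i0 then K i0 else 0.

Lemma kraus_at_ord r (K : 'I_r -> 'M[C]_2) (i : 'I_r) : kraus_at K i = K i.
Proof. by rewrite /kraus_at valK. Qed.

Lemma kraus_at_out r (K : 'I_r -> 'M[C]_2) i : (r <= i)%N -> kraus_at K i = 0.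
Proof. by move=> ri; rewrite /kraus_at insubF// ltnNge ri. Qed.

Lemma sum_kraus_at (V : nmodType) r m (K : 'I_r -> 'M[C]_2) (f : nat -> 'M[C]_2 -> V) :
  (r <= m)%N -> (forall i, f i 0 = 0) ->
  \sum_(i < m) f i (kraus_at K i) = \sum_(i < r) f i (K i).
Proof.
move=> rm f0; rewrite -(subnKC rm) big_split_ord /= [X in _ + X]big1 ?addr0.
  by apply: eq_bigr => i _; rewrite kraus_at_ord.
by move=> i _; rewrite kraus_at_out ?f0//= leq_addr.
Qed.

Lemma mixed_kraus_mulmx r m (K : 'I_r -> 'M[C]_2) (W : 'M[C]_m) j (A : 'M[C]_2) a k :
  (mixed_kraus K W j *m A) a k = \sum_i W i j * (kraus_at K i *m A) a k.
Proof.
rewrite /mixed_kraus mulmx_suml summxE; apply: eq_bigr => i _.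
by rewrite -scalemxAl mxE.
Qed.

Lemma sum_weight_unitary r m (K : 'I_r -> 'M[C]_2) (W : 'M[C]_m) (A : 'M[C]_2) :
  (r <= m)%N -> W \is unitarymx ->
  \sum_j weight (mixed_kraus K W j *m A) = \sum_i weight (K i *m A).
Proof.
move=> rm uW; transitivity (\sum_(i < m) weight (kraus_at K i *m A)); last first.
  rewrite (@sum_kraus_at _ _ _ K (fun _ X => weight (X *m A)))// => i.
  by rewrite mul0mx /weight /gram2 mul0mx mxtrace0.
under eq_bigr do rewrite weightE; under [RHS]eq_bigr do rewrite weightE.
rewrite exchange_big [RHS]exchange_big; apply: eq_bigr => a _ /=.
rewrite exchange_big [RHS]exchange_big; apply: eq_bigr => k _ /=.
rewrite -[RHS](sum_sqnorm_unitary _ uW); apply: eq_bigr => j _.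
by rewrite mixed_kraus_mulmx.
Qed.

Lemma entropy_term0 (A : 'M[C]_2) : weight A = 0 -> entropy_term A = 0.
Proof. by rewrite /entropy_term => ->; rewrite mul0r. Qed.

(** One support line, taken at [c], bounds every outcome of every competitor from below. The
    outcomes of [U] lie on it, and the average of the line depends only on the total weight, which
    is one, and on the average concurrence. *)
Lemma optimal_unraveling_equal_concurrence (B : finType) (v : 'I_2 -> ket R B)
    (phi : ket R ('I_2 * B)%type) (A : 'M[C]_2) r r' (K : 'I_r -> 'M[C]_2)
    (U : 'M[C]_r') (c : C) :
  (forall k l, dotk (v k) (v l) = (k == l)%:R) -> factors v phi A ->
  (r <= r')%N -> U \is unitarymx -> \sum_i weight (K i *m A) = 1 -> 0 <= c ->
  (forall j, `|qform (mixed_kraus K U j *m A)| =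
             c * weight (mixed_kraus K U j *m A)) ->
  (forall m (W : 'M[C]_m), (r <= m)%N -> W \is unitarymx ->
     c <= \sum_j `|qform (mixed_kraus K W j *m A)|) ->
  optimal_unraveling phi K U.
Proof.
move=> ov hphi rr uU tot c0 eqU lbW; split => // m W rm uW.
rewrite !(average_entanglement_factors ov _ _ hphi).
set c' := complex.Re c; have cE : c'%:C = c by rewrite RRe_real// ger0_real.
have c'0 : 0 <= c' by rewrite -ler0c cE.
(* Summed over the outcomes, the concurrences of [U] give [c], while each is at most its weight and
   the weights add up to one. *)
have c'1 : c' <= 1.
  rewrite -lecR cE rmorph1 -[c]mulr1 -tot -(sum_weight_unitary K A rr uU) mulr_sumr.
  rewrite ler_sum// => j _.
  by rewrite -eqU qform_le_weight.
have [l [h [l0 supp]]] := binent_support c'0 c'1.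
(* The support line multiplied by the weight; both sides vanish for an outcome of weight zero. *)
have low (X : 'M[C]_2) :
    (h - l * c') * complex.Re (weight X) + l * complex.Re `|qform X| <= entropy_term X.
  have [X0|X0] := eqVneq (weight X) 0.
    have := qform_le_weight X; rewrite X0 normr_le0 => /eqP ->.
    by rewrite normr0 /= !mulr0 addr0 entropy_term0.
  have [x [y [x0 y0 xy1 <- ->]]] := entropy_term_binent X0.
  have [h1 _] := supp x y x0 y0 xy1.
  have := ler_wpM2l (Re_weight_ge0 X) h1; lra.
have eqt j : entropy_term (mixed_kraus K U j *m A) =
    h * complex.Re (weight (mixed_kraus K U j *m A)).
  set X := _ *m A; have [X0|X0] := eqVneq (weight X) 0.
    by rewrite entropy_term0// X0 mulr0.
  have [x [y [x0 y0 xy1 e ->]]] := entropy_term_binent X0.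
  have [_ h2] := supp x y x0 y0 xy1.
  suff -> : binent x y = h by rewrite mulrC.
  apply: h2.
  have p0 : complex.Re (weight X) != 0.
    by apply: contraNneq X0 => p0; rewrite -Re_weight p0.
  apply: (mulfI p0); rewrite e; apply: complexI.
  by rewrite Re_norm rmorphM /= Re_weight cE eqU mulrC.
have tW n (Z : 'M[C]_n) : (r <= n)%N -> Z \is unitarymx ->
    \sum_j complex.Re (weight (mixed_kraus K Z j *m A)) = 1.
  move=> rn uZ; apply: complexI; rewrite rmorph_sum /= -[RHS]tot.
  rewrite -(sum_weight_unitary K A rn uZ); apply: eq_bigr => j _.
  exact: Re_weight.
under eq_bigr do rewrite eqt.
rewrite -mulr_sumr tW// mulr1.
apply: le_trans (ler_sum _ (fun j _ => low _)).
rewrite big_split /= -!mulr_sumr tW// mulr1.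
have : c' <= \sum_j complex.Re `|qform (mixed_kraus K W j *m A)|.
  rewrite -lecR cE rmorph_sum /=; apply: le_trans (lbW _ _ rm uW) _.
  by apply: ler_sum => j _; rewrite Re_norm.
move/(ler_wpM2l l0); lra.
Qed.

(** The factor has the scaled Schmidt vectors of the target as columns. Trace preservation gives the
    total weight s^2 + (1 - s^2). *)
Lemma schmidt_factors (B : finType) (phi : ket R ('I_2 * B)%type) s u0 u1 v0 v1 :
  schmidt_decomposition phi s u0 u1 v0 v1 ->
  let A : 'M[C]_2 := \matrix_(a, k) (if k == 0 then s%:C * u0 a
                        else (Num.sqrt (1 - s ^+ 2))%:C * u1 a) in
  let v (k : 'I_2) := if k == 0 then v0 else v1 in
  [/\ forall k l, dotk (v k) (v l) = (k == l)%:R, factors v phi A &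
      forall r (K : 'I_r -> 'M[C]_2), is_channel K ->
        \sum_i weight (K i *m A) = 1].
Proof.
move=> [/andP[s0 s1] [u00 u11 u01] [v00 v11 v01] e] A v.
have dotC (I : finType) (f g : ket R I) : dotk f g = (dotk g f)^*.
  rewrite /dotk rmorph_sum /=; apply: eq_bigr => x _.
  by rewrite rmorphM /= conjCK mulrC.
have c2 (k : 'I_2) : k = 0 \/ k = 1.
  by case: k => [[|[|?]] ?] //; [left|right]; apply: val_inj.
split.
- move=> k l; rewrite /v.
  case: (c2 k) => ->; case: (c2 l) => -> //=.
  by rewrite dotC v01 conjC0.
- by move=> a b; rewrite e big_ord_recl big_ord1 ord_lift01 !mxE.
- move=> r K chK.
  have -> : \sum_i weight (K i *m A) = \tr (A^t* *m (\sum_i (K i)^t* *m K i) *m A).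
    rewrite mulmx_sumr mulmx_suml linear_sum; apply: eq_bigr => i _ /=.
    by rewrite /weight /gram2 trmx_mul map_mxM /= mxtrace_mulC !mulmxA.
  rewrite chK mulmx1 /mxtrace big_ord_recl big_ord1 ord_lift01 !mxE.
  have f0 : \sum_j (A^t*) 0 j * A j 0 = s%:C ^+ 2.
    rewrite -[RHS]mulr1 -u00 /dotk mulr_sumr; apply: eq_bigr => j _.
    by rewrite !mxE /= rmorphM /= (@conj_Creal _ (s%:C)); [ring | exact: realC].
  have f1 : \sum_j (A^t*) 1 j * A j 1 = (Num.sqrt (1 - s ^+ 2))%:C ^+ 2.
    rewrite -[RHS]mulr1 -u11 /dotk mulr_sumr; apply: eq_bigr => j _.
    rewrite !mxE /= rmorphM /= (@conj_Creal _ ((Num.sqrt _)%:C)); [ring | exact: realC].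
  rewrite f0 f1 -!rmorphXn /= sqr_sqrtr ?subr_ge0 ?expr_le1//.
  by rewrite -rmorphD /= addrC subrK.
Qed.

End Optimality.

(** * Lower bound on the average concurrence *)

Section Concurrence.
Variable C : numClosedFieldType.
Implicit Types x y w : nat -> C.

(* Polarization of [2 * \det], a 2 x 2 matrix being listed row by row. *)
Definition tau x y : C := x 0 * y 3 + x 3 * y 0 - x 1 * y 2 - x 2 * y 1.

Lemma tauC x y : tau x y = tau y x.
Proof. by rewrite /tau; ring. Qed.

Lemma tau_suml (I : finType) (a : I -> C) (y : I -> nat -> C) w :
  tau (fun l => \sum_k a k * y k l) w = \sum_k a k * tau (y k) w.
Proof.
rewrite /tau !mulr_suml -big_split /= -!sumrB; apply: eq_bigr => k _; ring.
Qed.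

Lemma tau_diag (I : finType) (a : I -> C) (y : I -> nat -> C) (lam : I -> C) :
  (forall j k, tau (y j) (y k) = if j == k then lam j else 0) ->
  tau (fun l => \sum_k a k * y k l) (fun l => \sum_k a k * y k l) =
  \sum_k lam k * a k ^+ 2.
Proof.
move=> hd; rewrite tau_suml; apply: eq_bigr => j _.
rewrite tauC tau_suml (bigD1 j) //= big1 => [|k kj].
  by rewrite hd eqxx addr0; ring.
by rewrite hd (negbTE kj) mulr0.
Qed.

Lemma unitarymx_row n (U : 'M[C]_n) i i' : U \is unitarymx ->
  \sum_k U i k * (U i' k)^* = (i == i')%:R.
Proof.
move=> /unitarymxP/matrixP/(_ i i'); rewrite !mxE => <-.
by apply: eq_bigr => k _; rewrite !mxE.
Qed.

Lemma unitarymx_col n (U : 'M[C]_n) k : U \is unitarymx ->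
  \sum_i `|U i k| ^+ 2 = 1.
Proof.
rewrite -trmxC_unitary => /unitarymxP/matrixP/(_ k k); rewrite !mxE eqxx => e.
transitivity (true%:R : C) => //; rewrite -e.
by apply: eq_bigr => i _; rewrite !mxE conjCK mulrC normCK.
Qed.

(* Wootters' bound.  The coefficients [G] of the [z j] in the diagonalizing
   family [y] have rows of norm at most 1, and exactly 1 where [lam] is nonzero. *)
Lemma takagi_lower_bound n m r (x : nat -> nat -> C) (U : 'M[C]_n) (W : 'M[C]_m)
    (lam : 'I_n -> C) (k0 : 'I_n) :
  (r <= n)%N -> (r <= m)%N -> U \is unitarymx -> W \is unitarymx ->
  (forall i l, (r <= i)%N -> x i l = 0) -> (forall k, 0 <= lam k) ->
  let y (k : 'I_n) l := \sum_(i < n) U i k * x i l in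
  (forall j k, tau (y j) (y k) = if j == k then lam j else 0) ->
  lam k0 - \sum_(k | k != k0) lam k <=
  \sum_j `|tau (fun l => \sum_(i < m) W i j * x i l)
               (fun l => \sum_(i < m) W i j * x i l)|.
Proof.
move=> rn rm uU uW x0 lam0 y hd.
have xE (i : 'I_n) l : x i l = \sum_k (U i k)^* * y k l.
  rewrite /y; under [RHS]eq_bigr do rewrite mulr_sumr.
  rewrite exchange_big /=.
  have h (i' : 'I_n) : \sum_k (U i k)^* * (U i' k * x i' l) = (i' == i)%:R * x i' l.
    under eq_bigr do rewrite mulrA (mulrC _ (U _ _)).
    by rewrite -mulr_suml unitarymx_row.
  under eq_bigr do rewrite h.
  rewrite (bigD1 i) //= eqxx mul1r big1 ?addr0// => i' ii'.
  by rewrite (negbTE ii') mul0r.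
(* A padded row expresses the zero vector in the family [y]; pairing it with [y k] by [tau] isolates
   the conjugate of [U i k] times [lam k]. *)
have U0 (i : 'I_n) k : (r <= i)%N -> lam k != 0 -> U i k = 0.
  move=> ri lk; apply: (can_inj (@conjCK C)); rewrite conjC0; apply: (mulIf lk); rewrite mul0r.
  have : tau (fun l => \sum_j (U i j)^* * y j l) (y k) = 0.
    have -> : (fun l => \sum_j (U i j)^* * y j l) = fun=> 0.
      by apply/funext => l; rewrite -xE x0.
    by rewrite /tau !mul0r !subr0 addr0.
  rewrite tau_suml (bigD1 k) //= hd eqxx big1 ?addr0// => j jk.
  by rewrite hd (negbTE jk) mulr0.
(* The conjugate of [U] truncated to its first r rows, so that it can be composed with [W], whose
   size differs. *)
pose V (k : 'I_n) (i : nat) : C :=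
  if (i < r)%N then oapp (fun i' => (U i' k)^* ) 0 (insub i) else 0.
pose G k j := \sum_(i < m) W i j * V k i.
have zE j : (fun l => \sum_(i < m) W i j * x i l) = fun l => \sum_k G k j * y k l.
  apply/funext => l; rewrite /G; under [RHS]eq_bigr do rewrite mulr_suml.
  rewrite exchange_big /=; apply: eq_bigr => i _.
  under eq_bigr do rewrite -mulrA.
  rewrite -mulr_sumr /V; have [ir|ri] := ltnP i r; last first.
    by rewrite x0// big1 // => k _; rewrite mul0r.
  rewrite (insubT (fun j => j < n)%N (leq_trans ir rn)) /=.
  by rewrite -(xE (Ordinal (leq_trans ir rn))).
have Vn k : \sum_(i < m) `|V k i| ^+ 2 = \sum_(i < n | (i < r)%N) `|U i k| ^+ 2.
  transitivity (\sum_(i < r) `|V k i| ^+ 2).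
    rewrite (big_ord_widen _ (fun i => `|V k i| ^+ 2) rm) big_mkcond [RHS]big_mkcond.
    by apply: eq_bigr => i _; rewrite /V; case: ltnP; rewrite // normr0 expr0n.
  rewrite (big_ord_widen _ (fun i => `|V k i| ^+ 2) rn).
  by apply: eq_bigr => i ir; rewrite /V ir valK /= norm_conjC.
have Gle k : \sum_j `|G k j| ^+ 2 <= 1.
  rewrite sum_sqnorm_unitary// Vn -(unitarymx_col k uU) big_mkcond ler_sum// => i _.
  by case: ifP => // _; rewrite exprn_ge0.
have G1 k : lam k != 0 -> \sum_j `|G k j| ^+ 2 = 1.
  move=> lk; rewrite sum_sqnorm_unitary// Vn -(unitarymx_col k uU) big_mkcond.
  apply: eq_bigr => i _; case: ltnP => // ri.
  by rewrite U0// normr0 expr0n.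
(* The reverse triangle inequality, with the term of [k0] set against all the others. *)
have termle j : lam k0 * `|G k0 j| ^+ 2 - \sum_(k | k != k0) lam k * `|G k j| ^+ 2
    <= `|\sum_k lam k * G k j ^+ 2|.
  rewrite [X in _ <= `|X|](bigD1 k0)//=; apply: le_trans _ (lerB_normD _ _).
  rewrite normrM (ger0_norm (lam0 k0)) normrX lerD2l lerN2.
  apply: le_trans (ler_norm_sum _ _ _) _; apply: ler_sum => k _.
  by rewrite normrM ger0_norm// normrX.
rewrite [X in _ <= X](eq_bigr (fun j => `|\sum_k lam k * G k j ^+ 2|)); last first.
  by move=> j _; rewrite (zE j) (tau_diag _ hd).
apply: le_trans _ (ler_sum _ (fun j _ => termle j)).
rewrite sumrB exchange_big /= -mulr_sumr.
have -> : lam k0 * \sum_j `|G k0 j| ^+ 2 = lam k0.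
  by have [->|lk] := eqVneq (lam k0) 0; [rewrite mul0r|rewrite G1// mulr1].
rewrite lerD2l lerN2; apply: ler_sum => k _.
by rewrite -mulr_sumr ler_piMr.
Qed.

End Concurrence.

(** * Characteristic polynomials of degree four *)

Section Quartic.

Lemma det_ord2 (S : comPzRingType) (f : nat -> nat -> S) :
  \det (\matrix_(i < 2, j < 2) f i j) = f 0%N 0%N * f 1%N 1%N - f 0%N 1%N * f 1%N 0%N.
Proof.
rewrite (expand_det_row _ ord0) !big_ord_recl big_ord0 /cofactor !det_mx11 !mxE /=.
by rewrite /bump /=; ring.
Qed.

(** Entries are given by a function on [nat] so that each minor has the same shape, with columns
    shifted by [bump], and the expansion can be iterated. *)
Lemma det_ordS (S : comPzRingType) n (f : nat -> nat -> S) :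
  \det (\matrix_(i < n.+1, j < n.+1) f i j) =
  \sum_(k < n.+1) (-1) ^+ k * f 0%N k *
     \det (\matrix_(i < n, j < n) f i.+1 (bump k j)).
Proof.
rewrite (expand_det_row _ ord0); apply: eq_bigr => k _.
rewrite mxE /cofactor add0n mulrCA mulrA; congr (_ * \det _).
by apply/matrixP => i j; rewrite !mxE.
Qed.

Lemma det_ord3 (S : comPzRingType) (f : nat -> nat -> S) :
  \det (\matrix_(i < 3, j < 3) f i j) =
  f 0%N 0%N * (f 1%N 1%N * f 2%N 2%N - f 1%N 2%N * f 2%N 1%N)
  - f 0%N 1%N * (f 1%N 0%N * f 2%N 2%N - f 1%N 2%N * f 2%N 0%N)
  + f 0%N 2%N * (f 1%N 0%N * f 2%N 1%N - f 1%N 1%N * f 2%N 0%N).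
Proof.
rewrite det_ordS !big_ord_recl big_ord0 /=.
rewrite !(det_ord2 (fun i j => f i.+1 (bump _ j))) /bump /=.
by ring.
Qed.

Definition minor3 (S : pzRingType) (f : nat -> nat -> S) (a b c : nat) : S :=
  f a a * (f b b * f c c - f b c * f c b)
  - f a b * (f b a * f c c - f b c * f c a)
  + f a c * (f b a * f c b - f b b * f c a).

Definition minor2 (S : pzRingType) (f : nat -> nat -> S) (a b : nat) : S :=
  f a a * f b b - f a b * f b a.

(** The minor on rows 1, 2, 3 and columns a, b, c, for the expansion along row 0; [minor3] is the
    principal minor. *)
Definition minor3' (S : pzRingType) (f : nat -> nat -> S) (a b c : nat) : S :=
  f 1%N a * (f 2%N b * f 3%N c - f 2%N c * f 3%N b)
  - f 1%N b * (f 2%N a * f 3%N c - f 2%N c * f 3%N a)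
  + f 1%N c * (f 2%N a * f 3%N b - f 2%N b * f 3%N a).

(** Sums of principal minors, that is, the elementary symmetric functions of the eigenvalues. They
    are spelled out as arithmetic terms because the program evaluates the same terms. *)
Definition esym1 (S : pzRingType) (f : nat -> nat -> S) : S :=
  f 0%N 0%N + f 1%N 1%N + f 2%N 2%N + f 3%N 3%N.
Definition esym2 (S : pzRingType) (f : nat -> nat -> S) : S :=
  minor2 f 0 1 + minor2 f 0 2 + minor2 f 0 3 + minor2 f 1 2 + minor2 f 1 3 + minor2 f 2 3.
Definition esym3 (S : pzRingType) (f : nat -> nat -> S) : S :=
  minor3 f 0 1 2 + minor3 f 0 1 3 + minor3 f 0 2 3 + minor3 f 1 2 3.
Definition esym4 (S : pzRingType) (f : nat -> nat -> S) : S :=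
  f 0%N 0%N * minor3' f 1 2 3 - f 0%N 1%N * minor3' f 0 2 3
  + f 0%N 2%N * minor3' f 0 1 3 - f 0%N 3%N * minor3' f 0 1 2.

Lemma det_char_ord4 (T : comNzRingType) (x : T) (g : nat -> nat -> T) :
  \det (\matrix_(i < 4, j < 4) (x *+ (i == j :> nat) - g i j)) =
  x ^+ 4 - esym1 g * x ^+ 3 + esym2 g * x ^+ 2 - esym3 g * x + esym4 g.
Proof.
rewrite (@det_ordS _ 3 (fun i j => x *+ (i == j) - g i j)) !big_ord_recl big_ord0 /=.
rewrite !(det_ord3 (fun i j => x *+ (i.+1 == (bump _ j)) - g i.+1 (bump _ j))).
rewrite /bump /= /esym1 /esym2 /esym3 /esym4 /minor2 /minor3 /minor3' ?mulr1n ?mulr0n.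
move: (g 0%N 0%N) (g 0%N 1%N) (g 0%N 2%N) (g 0%N 3%N)
      (g 1%N 0%N) (g 1%N 1%N) (g 1%N 2%N) (g 1%N 3%N)
      (g 2%N 0%N) (g 2%N 1%N) (g 2%N 2%N) (g 2%N 3%N)
      (g 3%N 0%N) (g 3%N 1%N) (g 3%N 2%N) (g 3%N 3%N) => *.
by ring.
Qed.

Lemma esym_rmorph (S T : comNzRingType) (phi : {rmorphism S -> T}) (f : nat -> nat -> S) :
  let g i j := phi (f i j) in
  [/\ esym1 g = phi (esym1 f), esym2 g = phi (esym2 f), esym3 g = phi (esym3 f)
    & esym4 g = phi (esym4 f)].
Proof.
by move=> g; split;
   rewrite /esym1 /esym2 /esym3 /esym4 /minor2 /minor3 /minor3' /g;
   rewrite ?(rmorphD, rmorphM, rmorphN).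
Qed.

(** Vieta's formulas, with the roots grouped in the two pairs that Ferrari's method produces. *)
Lemma char_poly_ord4 (S : comNzRingType) (f : nat -> nat -> S) (x1 x2 x3 x4 : S) :
  esym1 f = x1 + x2 + x3 + x4 ->
  esym2 f = x1 * x2 + x3 * x4 + (x1 + x2) * (x3 + x4) ->
  esym3 f = x1 * x2 * (x3 + x4) + x3 * x4 * (x1 + x2) ->
  esym4 f = x1 * x2 * (x3 * x4) ->
  char_poly (\matrix_(i < 4, j < 4) f i j) =
  ('X - x1%:P) * ('X - x2%:P) * ('X - x3%:P) * ('X - x4%:P).
Proof.
move=> h1 h2 h3 h4; rewrite /char_poly.
have -> : char_poly_mx (\matrix_(i < 4, j < 4) f i j) =
    \matrix_(i < 4, j < 4) ('X *+ (i == j :> nat) - (f i j)%:P).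
  by apply/matrixP => i j; rewrite !mxE.
rewrite (det_char_ord4 'X (fun i j => (f i j)%:P)).
have [-> -> -> ->] := esym_rmorph (polyC : {rmorphism S -> {poly S}}) f.
rewrite h1 h2 h3 h4 /= !(polyCD, polyCM).
by move: (x1%:P) (x2%:P) (x3%:P) (x4%:P) 'X => *; ring.
Qed.

End Quartic.

(** * The formulas of Cardano and Ferrari *)

Section QuarticRoots.
Variable C : numClosedFieldType.
Implicit Types a b c d u : C.

(** Cardano's formula through the depressed cubic y^3 + p y + q. When u = 0 the quotient by u is 0
    by convention, and the last hypothesis says that the depressed cubic is y^3, so the value is
    still a root. *)
Lemma cubic_root a b c p q u e : 
  p = b - a ^+ 2 / 3 -> q = 2 * a ^+ 3 / 27 - a * b / 3 + c ->
  e ^+ 2 = q ^+ 2 / 4 + p ^+ 3 / 27 -> u ^+ 3 = - q / 2 + e ->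
  (u = 0 -> p = 0 /\ q = 0) ->
  let k := u - p / (3 * u) - a / 3 in
  k ^+ 3 + a * k ^+ 2 + b * k + c = 0.
Proof.
move=> pE qE eE uE u0 k.
have -> : k ^+ 3 + a * k ^+ 2 + b * k + c =
    (k + a / 3) ^+ 3 + p * (k + a / 3) + q by rewrite pE qE; field.
rewrite /k subrK.
have [uz|un] := eqVneq u 0.
  have [-> ->] := u0 uz; rewrite uz !mul0r subrr; ring.
have h : u ^+ 6 + q * u ^+ 3 - p ^+ 3 / 27 = 0.
  have -> : u ^+ 6 = (u ^+ 3) ^+ 2 by rewrite -exprM.
  rewrite uE; have -> : p ^+ 3 / 27 = e ^+ 2 - q ^+ 2 / 4 by rewrite eE; ring.
  by field.
have -> : (u - p / (3 * u)) ^+ 3 + p * (u - p / (3 * u)) + q =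
   (u ^+ 6 + q * u ^+ 3 - p ^+ 3 / 27) / u ^+ 3 by field.
by rewrite h mul0r.
Qed.

(** Ferrari: y^4 + P y^2 + Q y + T splits as (y^2 + u y + v)(y^2 - u y + w) with v + w = P + k and w
    - v = [dl]. For u = 0 the resolvent forces Q = 0, the quartic is biquadratic, and [dl] comes
    from a square root instead of the quotient Q / u. *)
Lemma quartic_roots a b c d P Q T k u dl s1 s2 :
  P = b - 3 * a ^+ 2 / 8 -> Q = c - a * b / 2 + a ^+ 3 / 8 ->
  T = d - a * c / 4 + a ^+ 2 * b / 16 - 3 * a ^+ 4 / 256 ->
  k ^+ 3 + 2 * P * k ^+ 2 + (P ^+ 2 - 4 * T) * k - Q ^+ 2 = 0 ->
  u ^+ 2 = k -> (u != 0 -> dl = Q / u) -> (u = 0 -> dl ^+ 2 = P ^+ 2 - 4 * T) ->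
  s1 ^+ 2 = k - 2 * (P + k - dl) -> s2 ^+ 2 = k - 2 * (P + k + dl) ->
  let x1 := (- u + s1) / 2 - a / 4 in let x2 := (- u - s1) / 2 - a / 4 in
  let x3 := (u + s2) / 2 - a / 4 in let x4 := (u - s2) / 2 - a / 4 in
  [/\ - a = x1 + x2 + x3 + x4, b = x1 * x2 + x3 * x4 + (x1 + x2) * (x3 + x4),
    - c = x1 * x2 * (x3 + x4) + x3 * x4 * (x1 + x2) & d = x1 * x2 * (x3 * x4)].
Proof.
move=> PE QE TE kE ku dE d0 s1E s2E.
have ud : u * dl = Q.
  have [uz|un] := eqVneq u 0; last by rewrite dE// mulrC divfK.
  have k0 : k = 0 by rewrite -ku uz expr0n.
  have : Q ^+ 2 = - (k ^+ 3 + 2 * P * k ^+ 2 + (P ^+ 2 - 4 * T) * k - Q ^+ 2).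
    by rewrite k0; ring.
  by rewrite kE oppr0 uz mul0r => /eqP; rewrite sqrf_eq0 => /eqP.
have d2 : (P + k) ^+ 2 - dl ^+ 2 = 4 * T.
  have [uz|un] := eqVneq u 0.
    by rewrite d0// -ku uz expr0n /= addr0; ring.
  have kn : k != 0 by rewrite -ku expf_neq0.
  apply: (mulIf kn); rewrite dE// mulrBl expr_div_n ku divfK//.
  have : (P + k) ^+ 2 * k - Q ^+ 2 - 4 * T * k = 0 by rewrite -kE; ring.
  by move/eqP; rewrite subr_eq0 => /eqP.
set v := (P + k - dl) / 2; set w := (P + k + dl) / 2 => x1 x2 x3 x4.
have e1 : v + w - u ^+ 2 = P by rewrite /v /w ku; field.
have e2 : u * (w - v) = Q by rewrite -ud /v /w; field.
have e3 : v * w = T.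
  have -> : T = ((P + k) ^+ 2 - dl ^+ 2) / 4 by rewrite d2; field.
  by rewrite /v /w; field.
set t := a / 4.
have aE : a = 4 * t by rewrite /t; field.
have bE : b = P + 6 * t ^+ 2 by rewrite PE /t; field.
have cE : c = Q + 2 * t * P + 4 * t ^+ 3 by rewrite QE PE /t; field.
have dE' : d = T + t * Q + t ^+ 2 * P + t ^+ 4 by rewrite TE QE PE /t; field.
have x12 : x1 + x2 = - u - 2 * t by rewrite /x1 /x2 -/t; field.
have x34 : x3 + x4 = u - 2 * t by rewrite /x3 /x4 -/t; field.
have m12 : x1 * x2 = t ^+ 2 + u * t + v.
  have -> : v = (u ^+ 2 - s1 ^+ 2) / 4 by rewrite s1E ku /v; field.
  by rewrite /x1 /x2 -/t; field.
have m34 : x3 * x4 = t ^+ 2 - u * t + w.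
  have -> : w = (u ^+ 2 - s2 ^+ 2) / 4 by rewrite s2E ku /w; field.
  by rewrite /x3 /x4 -/t; field.
rewrite -addrA x34 x12 m12 m34; split.
- by rewrite aE; ring.
- by rewrite bE -e1; ring.
- by rewrite cE -e1 -e2; ring.
- by rewrite dE' -e1 -e2 -e3; ring.
Qed.

End QuarticRoots.

(** * Unitary column operations *)

Section ColumnOperations.
Variable C : numClosedFieldType.
Implicit Types (M : nat -> nat -> C) (f : (nat -> C) -> C).

Definition mixcol M j k (a b c d : C) : nat -> nat -> C := fun i l =>
  if l == j then a * M i j + b * M i k
  else if l == k then c * M i j + d * M i k else M i l.

Definition unitary2 (a b c d : C) : Prop :=
  [/\ a * a^* + c * c^* = 1, b * b^* + d * d^* = 1 & a * b^* + c * d^* = 0].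

Definition colfun f :=
  forall a b u v, f (fun i => a * u i + b * v i) = a * f u + b * f v.

(** What is retained of a unitary mixing of the columns in the window, the unitary itself being
    forgotten. By the third clause, linear relations shared by all old columns of the window
    persist; it is how zeros and [tau]-orthogonality survive later operations. *)
Definition colstep lo hi M M' : Prop :=
  [/\ forall i i', \sum_(lo <= l < hi) M' i l * (M' i' l)^* =
                   \sum_(lo <= l < hi) M i l * (M i' l)^*,
      forall i l, ~~ (lo <= l < hi)%N -> M' i l = M i l &
      forall f, colfun f ->
        (forall l, (lo <= l < hi)%N -> f (M^~ l) = 0) ->
        (forall l, (lo <= l < hi)%N -> f (M'^~ l) = 0)].

Lemma colstep_refl lo hi M : colstep lo hi M M.
Proof. by split. Qed.

Lemma colstep_trans lo hi M1 M2 M3 :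
  colstep lo hi M1 M2 -> colstep lo hi M2 M3 -> colstep lo hi M1 M3.
Proof.
move=> [g1 o1 f1] [g2 o2 f2]; split.
- by move=> i i'; rewrite g2 g1.
- by move=> i l hl; rewrite o2// o1.
- by move=> f cf h; apply: f2 => //; apply: f1.
Qed.

Lemma sum_nat_two (lo hi j k : nat) (F : nat -> C) : j != k ->
  (lo <= j < hi)%N -> (lo <= k < hi)%N ->
  \sum_(lo <= l < hi) F l =
  F j + F k + \sum_(lo <= l < hi | (l != j) && (l != k)) F l.
Proof.
move=> jk hj hk; rewrite (bigD1_seq j) ?mem_index_iota ?iota_uniq//=.
rewrite -addrA; congr (_ + _); rewrite -big_filter.
rewrite (bigD1_seq k) ?filter_uniq ?iota_uniq//=; last first.
  by rewrite mem_filter mem_index_iota eq_sym jk.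
by rewrite big_filter_cond.
Qed.

Lemma mixcol_j M j k a b c d i : mixcol M j k a b c d i j = a * M i j + b * M i k.
Proof. by rewrite /mixcol eqxx. Qed.

Lemma mixcol_k M j k a b c d i : j != k ->
  mixcol M j k a b c d i k = c * M i j + d * M i k.
Proof. by rewrite /mixcol eqxx eq_sym => /negbTE ->. Qed.

Lemma mixcol_out M j k a b c d i l : l != j -> l != k ->
  mixcol M j k a b c d i l = M i l.
Proof. by rewrite /mixcol => /negbTE -> /negbTE ->. Qed.

Lemma mixcol_sum2 (a b c d x y x' y' : C) : unitary2 a b c d ->
  (a * x + b * y) * (a * x' + b * y')^* + (c * x + d * y) * (c * x' + d * y')^* =
  x * x'^* + y * y'^*.
Proof.
move=> [h1 h2 h3].
have h4 : b * a^* + d * c^* = 0.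
  by rewrite -[RHS]conjC0 -h3 rmorphD !rmorphM /= !conjCK; ring.
rewrite !rmorphD !rmorphM /=.
transitivity ((a * a^* + c * c^*) * (x * x'^*) + (b * b^* + d * d^*) * (y * y'^*)
   + (a * b^* + c * d^*) * (x * y'^*) + (b * a^* + d * c^*) * (y * x'^*)); first by ring.
by rewrite h1 h2 h3 h4; ring.
Qed.

Lemma colstep_mixcol lo hi M j k a b c d : j != k ->
  (lo <= j < hi)%N -> (lo <= k < hi)%N -> unitary2 a b c d ->
  colstep lo hi M (mixcol M j k a b c d).
Proof.
move=> jk hj hk u; split.
- move=> i i'; rewrite !(sum_nat_two _ jk hj hk) !mixcol_j !mixcol_k//.
  rewrite mixcol_sum2//; congr (_ + _); apply: eq_bigr => l /andP[lj lk].
  by rewrite !mixcol_out.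
- move=> i l hl; rewrite mixcol_out//; apply: contraNneq hl => ->//.
- move=> f cf h l hl; rewrite /mixcol.
  have [lj|lj] := eqVneq l j; first by rewrite cf !h// !mulr0 addr0.
  have [lk|lk] := eqVneq l k; first by rewrite cf !h// !mulr0 addr0.
  exact: h.
Qed.

Lemma colstep_widen lo hi lo' hi' M M' : (lo' <= lo)%N -> (lo <= hi)%N -> (hi <= hi')%N ->
  colstep lo hi M M' -> forall i i',
  \sum_(lo' <= l < hi') M' i l * (M' i' l)^* = \sum_(lo' <= l < hi') M i l * (M i' l)^*.
Proof.
move=> h1 h2 h3 [g o _] i i'.
have sp F : \sum_(lo' <= l < hi') F l = \sum_(lo' <= l < lo) F l
    + \sum_(lo <= l < hi) F l + \sum_(hi <= l < hi') F l :> C.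
  by rewrite -big_cat_nat//= -big_cat_nat//= (leq_trans h1).
rewrite !sp g; congr (_ + _ + _); apply: eq_big_nat => l /andP[hl1 hl2].
  by rewrite !o// negb_and -ltnNge hl2.
by rewrite !o// negb_and -!ltnNge ltnS hl1 orbT.
Qed.

(** A nonzero y keeps the normalizer positive; for this reason the clearing loop skips entries that
    are already zero. *)
Lemma givens_unitary (x y n : C) : y != 0 -> n = sqrtC (x * x^* + y * y^*) ->
  n != 0 /\ unitary2 (x^* / n) (y^* / n) (- y / n) (x / n).
Proof.
move=> y0 nE.
have s0 : 0 < x * x^* + y * y^*.
  by rewrite -!normCK ltr_wpDl ?exprn_ge0// exprn_gt0// normr_gt0.
have n0 : 0 < n by rewrite nE sqrtC_gt0.
have nn : n != 0 by rewrite gt_eqF.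
have n2 : n * n = x * x^* + y * y^* by rewrite -expr2 nE sqrtCK.
have nr : (n^-1)^* = n^-1 by rewrite conj_Creal// rpredV gtr0_real.
split => //; split; rewrite !rmorphM ?rmorphN /= ?conjCK nr.
- transitivity ((x * x^* + y * y^*) / (n * n)); first by field.
  by rewrite -n2 divff// mulf_neq0.
- transitivity ((x * x^* + y * y^*) / (n * n)); first by field.
  by rewrite -n2 divff// mulf_neq0.
- by ring.
Qed.

End ColumnOperations.

Local Notation "M ^conj" := (map_mx Num.conj M) (at level 30, format "M ^conj").

(** * Con-eigenvectors of symmetric matrices *)

Section Krylov.
Variables (C : numClosedFieldType) (n : nat).
Implicit Types (H t : 'M[C]_n) (z : 'cV[C]_n) (mu : C).

Definition shift_apply H z mu : 'cV[C]_n := H *m z - mu *: z.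
(** Skipping a shift that annihilates the vector keeps the iterate nonzero, so multiplicities of
    eigenvalues need not be known. *)
Definition kstep H z mu : 'cV[C]_n :=
  if shift_apply H z mu == 0 then z else shift_apply H z mu.

(** Once an eigenvector is reached, the remaining steps only rescale it. *)
Lemma kstep_eigen H z mu ms : H *m z = mu *: z ->
  exists2 c, c != 0 & foldl (kstep H) z ms = c *: z.
Proof.
elim: ms z => [|m ms IH] y Hy /=.
  by exists 1; rewrite ?oner_eq0 ?scale1r.
have wE : shift_apply H y m = (mu - m) *: y by rewrite /shift_apply Hy scalerBl.
have [w0|w0] := eqVneq (shift_apply H y m) 0.
  have -> : kstep H y m = y by rewrite /kstep w0 eqxx.
  exact: IH.
have -> : kstep H y m = (mu - m) *: y by rewrite /kstep (negbTE w0).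
have m0 : mu - m != 0 by apply: contraNneq w0 => m0; rewrite wE m0 scale0r.
have [|c c0 ->] := IH ((mu - m) *: y).
  by rewrite -scalemxAr Hy !scalerA mulrC.
by exists (c * (mu - m)); rewrite ?mulf_neq0// scalerA.
Qed.

(* The last nonzero vector of the iteration is killed by one of the factors. *)
Lemma kstep_foldl H z ms : z != 0 -> foldl (shift_apply H) z ms = 0 ->
  foldl (kstep H) z ms != 0 /\
  exists mu, H *m foldl (kstep H) z ms = mu *: foldl (kstep H) z ms.
Proof.
elim: ms z => [|m ms IH] z z0 /=; first by move=> e; rewrite e eqxx in z0.
move=> h; have [w0|w0] := eqVneq (shift_apply H z m) 0; last first.
  have -> : kstep H z m = shift_apply H z m by rewrite /kstep (negbTE w0).
  exact: IH.
have -> : kstep H z m = z by rewrite /kstep w0 eqxx.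
have Hz : H *m z = m *: z by apply/eqP; rewrite -subr_eq0; apply/eqP.
have [c c0 ->] := kstep_eigen ms Hz; split; first by rewrite scaler_eq0 negb_or c0.
by exists m; rewrite -scalemxAr Hz !scalerA mulrC.
Qed.

(** Applied to the subspace of vectors supported on the columns that are not yet decoupled. *)
Lemma kstep_closed (P : 'cV[C]_n -> Prop) H z ms :
  (forall y, P y -> P (H *m y)) -> (forall a x y, P x -> P y -> P (x + a *: y)) ->
  P z -> P (foldl (kstep H) z ms).
Proof.
move=> PH PL; elim: ms z => //= m ms IH z Pz; apply: IH.
rewrite /kstep; case: eqP => // _.
by rewrite /shift_apply -scaleNr; apply: PL => //; apply: PH.
Qed.

Definition sqnorm_cV z : C := \sum_i `|z i 0| ^+ 2.

Lemma sqnorm_cVE z : sqnorm_cV z = (z^t* *m z) 0 0.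
Proof. by rewrite mxE; apply: eq_bigr => i _; rewrite !mxE mulrC normCK. Qed.

Lemma sqnorm_cV_gt0 z : z != 0 -> 0 < sqnorm_cV z.
Proof.
move=> z0; rewrite lt_def sumr_ge0 ?andbT; last by move=> *; rewrite exprn_ge0.
apply: contraNneq z0 => /eqP; rewrite psumr_eq0; last by move=> *; rewrite exprn_ge0.
move=> /allP h; apply/eqP/matrixP => i j; rewrite ord1 mxE.
have := h i; rewrite mem_index_enum => /(_ isT) /=.
by rewrite expf_eq0 /= normr_eq0 => /eqP.
Qed.

Definition antilin t z : 'cV[C]_n := (t *m z) ^conj.

Lemma antilin2 t z : antilin t (antilin t z) = (t ^conj *m t) *m z.
Proof.
rewrite /antilin map_mxM /= -mulmxA; congr (_ *m _).
by apply/matrixP => i j; rewrite !mxE conjCK.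
Qed.

Lemma antilinDZ t y a z : antilin t (y + a *: z) = antilin t y + a^* *: antilin t z.
Proof.
apply/matrixP => i j; rewrite /antilin mulmxDr -scalemxAr !mxE rmorphD; congr (_ + _).
by rewrite rmorphM.
Qed.

(** Write S for the antilinear map and suppose S (S z) = mu z. Then w = S z + sqrt mu z satisfies S
    w = sqrt mu w; if w = 0, already S z = - sqrt mu z. The quotient of squared norms recovers mu,
    since the Krylov iteration does not report which eigenvalue it ended on. *)
Definition coneig_step t z : 'cV[C]_n :=
  let w := antilin t z + sqrtC (sqnorm_cV (antilin t z) / sqnorm_cV z) *: z in
  if w == 0 then z else w.

(** Symmetry of [t] makes its conjugate its adjoint, so the squared norm of t z is mu times that of
    z; hence mu is nonnegative and its root is real. *)
Lemma coneig_stepP t z mu : t^T = t -> z != 0 -> (t ^conj *m t) *m z = mu *: z ->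
  coneig_step t z != 0 /\ exists nu, t *m coneig_step t z = nu *: (coneig_step t z) ^conj.
Proof.
move=> st z0 Hz; have n0 := sqnorm_cV_gt0 z0.
have nE : sqnorm_cV (antilin t z) = mu * sqnorm_cV z.
  have -> : mu * sqnorm_cV z = (z^t* *m (mu *: z)) 0 0.
    by rewrite sqnorm_cVE -scalemxAr [RHS]mxE.
  have -> : sqnorm_cV (antilin t z) = sqnorm_cV (t *m z).
    by apply: eq_bigr => i _; rewrite mxE norm_conjC.
  rewrite sqnorm_cVE -Hz trmx_mul map_mxM /= -!mulmxA; congr ((_ *m (_ *m _)) _ _).
  by rewrite st.
have muE : mu = sqnorm_cV (antilin t z) / sqnorm_cV z by rewrite nE mulfK// gt_eqF.
have mu0 : 0 <= mu.
  rewrite muE; apply: divr_ge0; last exact: ltW.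
  by apply: sumr_ge0 => i _; rewrite exprn_ge0.
rewrite /coneig_step -muE; set la := sqrtC mu.
have la2 : la * la = mu by rewrite -expr2 sqrtCK.
have lar : la^* = la by rewrite conj_Creal// ger0_real// sqrtC_ge0.
have anti y nu : antilin t y = nu *: y -> t *m y = nu^* *: y ^conj.
  move=> /(congr1 (map_mx Num.conj)).
  have -> : (antilin t y) ^conj = t *m y.
    by apply/matrixP => i j; rewrite !mxE conjCK.
  move=> ->; apply/matrixP => i j; rewrite !mxE.
  exact: rmorphM.
have [w0|w0] := eqVneq (antilin t z + la *: z) 0; split => //.
  exists (- la)^*; apply: anti; rewrite scaleNr.
  by apply/eqP; rewrite -addr_eq0; apply/eqP.
exists la^*; apply: anti.
by rewrite antilinDZ antilin2 Hz lar scalerDr scalerA la2 addrC.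
Qed.

End Krylov.

(** * Annihilating shifts from the Cayley-Hamilton theorem *)

Section Annihilation.
Variable C : numClosedFieldType.

Lemma foldl_shift_intertwine n m (Y : 'M[C]_(n, m)) (H : 'M[C]_n) (N : 'M[C]_m) y ms :
  H *m Y = Y *m N ->
  foldl (shift_apply H) (Y *m y) ms = Y *m foldl (shift_apply N) y ms.
Proof.
move=> HY; elim: ms y => //= mu ms IH y; rewrite -IH; congr foldl.
by rewrite /shift_apply mulmxBr -scalemxAr mulmxA HY mulmxA.
Qed.

Lemma foldl_shift_char_poly n (N : 'M[C]_n.+1) (m1 m2 m3 m4 : C) y :
  char_poly N = ('X - m1%:P) * ('X - m2%:P) * ('X - m3%:P) * ('X - m4%:P) ->
  foldl (shift_apply N) y [:: m1; m2; m3; m4] = 0.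
Proof.
move=> chN.
have sE (z : 'cV[C]_n.+1) mu : shift_apply N z mu = horner_mx N ('X - mu%:P) *m z.
  by rewrite rmorphB /= horner_mx_X horner_mx_C mulmxBl mul_scalar_mx.
have := Cayley_Hamilton N; rewrite chN => h.
rewrite /= !sE !mulmxA -[X in X *m y]/(_ * _ * _ * _) -!rmorphM /=.
have -> : ('X - m4%:P) * ('X - m3%:P) * ('X - m2%:P) * ('X - m1%:P) =
  ('X - m1%:P) * ('X - m2%:P) * ('X - m3%:P) * ('X - m4%:P) by ring.
by rewrite h mul0mx.
Qed.

(* [t = X^T J X] and [conj t * t = X^* B X], where [B (X X^* )] depends only on
   the Gram matrix of the rows of [X]. *)
Lemma foldl_shift_gram n (X J : 'M[C]_n.+1) (m1 m2 m3 m4 : C) z :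
  J ^t* = J -> J^T = J ->
  let t := X^T *m J *m X in let G := X *m X^t* in
  char_poly (J *m G ^conj *m J *m G) =
    ('X - m1%:P) * ('X - m2%:P) * ('X - m3%:P) * ('X - m4%:P) ->
  foldl (shift_apply (t ^conj *m t)) z [:: 0; m1; m2; m3; m4] = 0.
Proof.
move=> Js Jt t G chN; set N := J *m _ *m J *m G in chN.
set B := J *m G ^conj *m J.
have Jc : J ^conj = J by rewrite -{2}Js Jt.
have HE : t ^conj *m t = X^t* *m B *m X.
  have XK : (X^t*) ^conj = X^T by apply/matrixP => i j; rewrite !mxE conjCK.
  by rewrite /t /B /G !map_mxM /= Jc XK !mulmxA.
(* The extra shift 0 applies the operator once and brings the vector into the range of the adjoint
   of [X], where the operator acts as [N]. *)
have -> : foldl (shift_apply (t ^conj *m t)) z [:: 0; m1; m2; m3; m4] =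
   foldl (shift_apply (t ^conj *m t)) (X^t* *m (B *m X *m z)) [:: m1; m2; m3; m4].
  have s0 (H : 'M[C]_n.+1) : shift_apply H z 0 = H *m z.
    by rewrite /shift_apply scale0r subr0.
  by rewrite /= s0 HE !mulmxA.
rewrite (foldl_shift_intertwine (N := N)); first by rewrite foldl_shift_char_poly ?mulmx0.
by rewrite HE /N -/B /G !mulmxA.
Qed.

End Annihilation.

(** * Weakest preconditions with time bounds *)

Section ProgramLogic.
Variable R : realType.
Implicit Types (st : store R) (c : cmd) (P Q : pred nat).

Definition wp c st (post : nat -> store R -> Prop) : Prop :=
  exists T st', exec c st T st' /\ post T st'.

Lemma wp_conseq c st (post post' : nat -> store R -> Prop) :
  wp c st post -> (forall T st', post T st' -> post' T st') -> wp c st post'.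
Proof. by move=> [T [st' [ex h]]] imp; exists T, st'; split=> //; apply: imp. Qed.

Lemma wp_skip st (post : nat -> store R -> Prop) : post 1%N st -> wp Skip st post.
Proof. by move=> h; exists 1%N, st; split => //; constructor. Qed.

Lemma wp_iset st x e (post : nat -> store R -> Prop) :
  post 1%N (set_reg st x (ieval st e)) -> wp (ISet x e) st post.
Proof. by move=> h; eexists _, _; split; [constructor | exact: h]. Qed.

(** The stored value is abstracted to a variable with an equation, so that symbolic stores stay
    small along a run of assignments. *)
Lemma wp_cset st x i j e (post : nat -> store R -> Prop) :
  (forall v, v = ceval st e ->
     post 1%N (set_cell st x (ieval st i) (ieval st j) v)) ->
  wp (CSet x i j e) st post.
Proof. by move=> h; eexists _, _; split; [constructor | exact: h]. Qed.

Lemma wp_seq c1 c2 st (post : nat -> store R -> Prop) :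
  wp c1 st (fun T1 st1 => wp c2 st1 (fun T2 st2 => post (T1 + T2)%N st2)) ->
  wp (Seq c1 c2) st post.
Proof.
move=> [T1 [st1 [ex1 [T2 [st2 [ex2 h]]]]]].
by exists (T1 + T2)%N, st2; split => //; apply: ExSeq ex1 ex2.
Qed.

Lemma wp_if b c1 c2 st (post : nat -> store R -> Prop) :
  (beval st b -> wp c1 st (fun T st' => post T.+1 st')) ->
  (~~ beval st b -> wp c2 st (fun T st' => post T.+1 st')) ->
  wp (If b c1 c2) st post.
Proof.
move=> h1 h2; case: (boolP (beval st b)) => hb.
  by have [T [st' [ex h]]] := h1 hb; exists T.+1, st'; split=> //; apply: ExIfT.
by have [T [st' [ex h]]] := h2 hb; exists T.+1, st'; split=> //; apply: ExIfF.
Qed.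

Definition For (x : nat) (e0 e1 : iexp) (c : cmd) : cmd :=
  Seq (ISet x e0)
      (While (BNot (BIle e1 (IReg x))) (Seq c (ISet x (IAdd (IReg x) (INat 1))))).

(** A round costs its body plus the test and the increment; the final 2 pays for the initial
    assignment and the failing test. The upper limit is re-evaluated in every round, so the
    invariant must preserve its value. *)
Lemma wp_for x e0 e1 c st (lo hi B : nat) (I : nat -> store R -> Prop) :
  (lo <= hi)%N -> ieval st e0 = lo -> I lo (set_reg st x lo) ->
  (forall k st1, I k st1 -> reg st1 x = k /\ ieval st1 e1 = hi) ->
  (forall k st1, (lo <= k < hi)%N -> I k st1 ->
     wp c st1 (fun T st2 => [/\ (T <= B)%N, reg st2 x = k &
                             I k.+1 (set_reg st2 x k.+1)])) ->
  wp (For x e0 e1 c) st (fun T st' => (T <= (hi - lo) * B.+2 + 2)%N /\ I hi st').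
Proof.
move=> lohi elo I0 Ireg Istep; apply: wp_seq; apply: wp_iset; rewrite elo.
suff H n : forall k st1, (k + n = hi)%N -> (lo <= k)%N -> I k st1 ->
    wp (While (BNot (BIle e1 (IReg x))) (Seq c (ISet x (IAdd (IReg x) (INat 1)))))
       st1 (fun T st' => (T <= n * B.+2 + 1)%N /\ I hi st').
  apply: wp_conseq (H (hi - lo)%N lo _ _ _ _) _ => //; first by rewrite subnKC.
  by move=> T st' [hT hI]; split => //; lia.
elim: n => [|n IH] k st1 kn lok Ik; have [rk eh] := Ireg _ _ Ik.
  exists 1%N, st1; split; last by split => //; rewrite -kn addn0.
  by apply: ExWhileF => /=; rewrite rk eh -kn addn0 leqnn.
have [|T1 [st2 [ex1 [hT1 r2 I2]]]] := Istep k st1 _ Ik.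
  by rewrite lok -kn addnS ltnS leq_addr.
have [||T2 [st3 [ex2 [hT2 I3]]]] := IH k.+1 (set_reg st2 x k.+1) _ _ I2.
- by rewrite addSn -addnS.
- exact: leqW.
exists ((T1 + 1) + T2).+1, st3; split; last by split => //; lia.
apply: ExWhileT ex2; first by rewrite /= rk eh -kn -ltnNge addnS ltnS leq_addr.
apply: ExSeq ex1 _.
have -> : set_reg st2 x k.+1 = set_reg st2 x (ieval st2 (IAdd (IReg x) (INat 1))).
  by rewrite /= r2 addn1.
by constructor.
Qed.

(** * Footprints of programs and the frame property *)

Fixpoint iuses P (e : iexp) : bool :=
  match e with
  | INat _ => true
  | IReg x => P x
  | IAdd e1 e2 | ISub e1 e2 => iuses P e1 && iuses P e2
  end.

Fixpoint cuses P Q (e : cexp) : bool :=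
  match e with
  | CNat _ | CImag => true
  | CCell x i j => [&& Q x, iuses P i & iuses P j]
  | CAdd e1 e2 | CMul e1 e2 => cuses P Q e1 && cuses P Q e2
  | COpp e1 | CInv e1 | CConj e1 | CRoot _ e1 => cuses P Q e1
  end.

Fixpoint buses P Q (b : bexp) : bool :=
  match b with
  | BIle e1 e2 => iuses P e1 && iuses P e2
  | BCle e1 e2 => cuses P Q e1 && cuses P Q e2
  | BNot b1 => buses P Q b1
  | BAnd b1 b2 => buses P Q b1 && buses P Q b2
  end.

Fixpoint uses P Q (c : cmd) : bool :=
  match c with
  | Skip => true
  | ISet x e => P x && iuses P e
  | CSet x i j e => [&& Q x, iuses P i, iuses P j & cuses P Q e]
  | Seq c1 c2 => uses P Q c1 && uses P Q c2
  | If b c1 c2 => [&& buses P Q b, uses P Q c1 & uses P Q c2]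
  | While b c1 => buses P Q b && uses P Q c1
  end.

Definition agree P Q st st' : Prop :=
  (forall x, P x -> reg st' x = reg st x) /\
  (forall x i j, Q x -> cell st' x i j = cell st x i j).

Lemma agree_refl P Q st : agree P Q st st.
Proof. by []. Qed.

Lemma agree_trans P Q st1 st2 st3 :
  agree P Q st1 st2 -> agree P Q st2 st3 -> agree P Q st1 st3.
Proof.
by move=> [r1 c1] [r2 c2]; split=> [x hx|x i j hx];
  [rewrite r2 ?r1|rewrite c2 ?c1].
Qed.

Lemma agree_sub P Q P' Q' st st' :
  (forall x, P' x -> P x) -> (forall x, Q' x -> Q x) ->
  agree P Q st st' -> agree P' Q' st st'.
Proof.
by move=> hP hQ [r c]; split => [x hx|x i j hx]; [apply/r/hP|apply/c/hQ].
Qed.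

Lemma ieval_agree P Q st st' e :
  agree P Q st st' -> iuses P e -> ieval st' e = ieval st e.
Proof.
move=> [hr _]; elim: e => //= e1 IH1 e2 IH2;
by move=> /andP[h1 h2]; rewrite IH1 ?IH2.
Qed.

Lemma ceval_agree P Q st st' e :
  agree P Q st st' -> cuses P Q e -> ceval st' e = ceval st e.
Proof.
move=> ag; elim: e => //=.
- by move=> x i j /and3P[hx hi hj]; rewrite !(ieval_agree ag)// (proj2 ag).
- by move=> e1 IH1 e2 IH2 /andP[h1 h2]; rewrite IH1 ?IH2.
- by move=> e1 IH1 h1; rewrite IH1.
- by move=> e1 IH1 e2 IH2 /andP[h1 h2]; rewrite IH1 ?IH2.
- by move=> e1 IH1 h1; rewrite IH1.
- by move=> e1 IH1 h1; rewrite IH1.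
- by move=> k e1 IH1 h1; rewrite IH1.
Qed.

Lemma beval_agree P Q st st' b :
  agree P Q st st' -> buses P Q b -> beval st' b = beval st b.
Proof.
move=> ag; elim: b => //=.
- by move=> e1 e2 /andP[h1 h2]; rewrite !(ieval_agree ag).
- by move=> e1 e2 /andP[h1 h2]; rewrite !(ceval_agree ag).
- by move=> b IH h; rewrite IH.
- by move=> b1 IH1 b2 IH2 /andP[h1 h2]; rewrite IH1 ?IH2.
Qed.

Lemma set_reg_agree P Q st st' x v :
  agree P Q st st' -> agree P Q (set_reg st x v) (set_reg st' x v).
Proof. by move=> [r c]; split=> //= y hy; case: eqP => // _; apply: r. Qed.

Lemma set_cell_agree P Q st st' x i j v :
  agree P Q st st' -> agree P Q (set_cell st x i j v) (set_cell st' x i j v).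
Proof. by move=> [r c]; split=> //= y k l hy; case: ifP => // _; apply: c. Qed.

(** Simulation and framing at once: a run carries over, with the same number of steps, to any store
    that agrees on the footprint, and nothing outside the footprint changes. *)
Lemma exec_agree P Q c st1 T st1' st2 :
  exec c st1 T st1' -> uses P Q c -> agree P Q st1 st2 ->
  exists st2', [/\ exec c st2 T st2', agree P Q st1' st2' &
    agree (predC P) (predC Q) st2 st2'].
Proof.
move=> ex; elim: ex st2 => {c st1 T st1'}.
- by move=> st st2 _ ag; exists st2; split => //; constructor.
- move=> st x e st2 /= /andP[hx he] ag.
  exists (set_reg st2 x (ieval st2 e)); split; first by constructor.
    by rewrite (ieval_agree ag he); apply: set_reg_agree.
  by split => //= y; case: eqP => // ->; rewrite hx.
- move=> st x i j e st2 /= /and4P[hx hi hj he] ag.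
  exists (set_cell st2 x (ieval st2 i) (ieval st2 j) (ceval st2 e)).
  split; first by constructor.
    rewrite !(ieval_agree ag)// (ceval_agree ag he).
    exact: set_cell_agree.
  by split => //= y k l; case: eqP => //= ->; rewrite hx.
- move=> c1 c2 sa sb sc T1 T2 _ IH1 _ IH2 st2 /= /andP[h1 h2] ag.
  have [sb' [ex1 ag1 fr1]] := IH1 _ h1 ag.
  have [sc' [ex2 ag2 fr2]] := IH2 _ h2 ag1.
  by exists sc'; split => //; [apply: ExSeq ex1 ex2 | apply: agree_trans fr1 fr2].
- move=> b c1 c2 sa sb T hb _ IH st2 /= /and3P[h0 h1 h2] ag.
  have [sb' [ex1 ag1 fr1]] := IH _ h1 ag; exists sb'; split => //.
  by apply: ExIfT => //; rewrite (beval_agree ag).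
- move=> b c1 c2 sa sb T hb _ IH st2 /= /and3P[h0 h1 h2] ag.
  have [sb' [ex1 ag1 fr1]] := IH _ h2 ag; exists sb'; split => //.
  by apply: ExIfF => //; rewrite (beval_agree ag).
- move=> b c sa hb st2 /= /andP[h0 h1] ag; exists st2; split => //.
  by apply: ExWhileF; rewrite (beval_agree ag).
- move=> b c sa sb sc T1 T2 hb _ IH1 _ IH2 st2 /= /andP[h0 h1] ag.
  have [sb' [ex1 ag1 fr1]] := IH1 _ h1 ag.
  have [|sc' [ex2 ag2 fr2]] := IH2 sb' _ ag1; first by rewrite /= h0.
  exists sc'; split => //; last exact: agree_trans fr1 fr2.
  by apply: ExWhileT ex1 ex2; rewrite (beval_agree ag).
Qed.

Fixpoint imax (e : iexp) : nat :=
  match e with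
  | INat _ => 0
  | IReg x => x.+1
  | IAdd e1 e2 | ISub e1 e2 => maxn (imax e1) (imax e2)
  end.

Fixpoint cmax (e : cexp) : nat :=
  match e with
  | CNat _ | CImag => 0
  | CCell x i j => maxn x.+1 (maxn (imax i) (imax j))
  | CAdd e1 e2 | CMul e1 e2 => maxn (cmax e1) (cmax e2)
  | COpp e1 | CInv e1 | CConj e1 | CRoot _ e1 => cmax e1
  end.

Fixpoint bmax (b : bexp) : nat :=
  match b with
  | BIle e1 e2 => maxn (imax e1) (imax e2)
  | BCle e1 e2 => maxn (cmax e1) (cmax e2)
  | BNot b1 => bmax b1
  | BAnd b1 b2 => maxn (bmax b1) (bmax b2)
  end.

(** A strict bound on the names of registers and arrays. Positions inside an array depend on the
    input and are not bounded; arrays are framed as wholes. *)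
Fixpoint addr_max (c : cmd) : nat :=
  match c with
  | Skip => 0
  | ISet x e => maxn x.+1 (imax e)
  | CSet x i j e => maxn x.+1 (maxn (imax i) (maxn (imax j) (cmax e)))
  | Seq c1 c2 => maxn (addr_max c1) (addr_max c2)
  | If b c1 c2 => maxn (bmax b) (maxn (addr_max c1) (addr_max c2))
  | While b c1 => maxn (bmax b) (addr_max c1)
  end.

Lemma uses_addr_max m c : (addr_max c <= m)%N ->
  uses (fun x => x < m)%N (fun x => x < m)%N c.
Proof.
have hi e : (imax e <= m)%N -> iuses (fun x => x < m)%N e.
  by elim: e => //= e1 IH1 e2 IH2; rewrite geq_max => /andP[/IH1-> /IH2->].
have hc e : (cmax e <= m)%N -> cuses (fun x => x < m)%N (fun x => x < m)%N e.
  elim: e => //=.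
  - by move=> x i j; rewrite !geq_max => /and3P[-> /hi-> /hi->].
  - by move=> e1 IH1 e2 IH2; rewrite geq_max => /andP[/IH1-> /IH2->].
  - by move=> e1 IH1 e2 IH2; rewrite geq_max => /andP[/IH1-> /IH2->].
have hb b : (bmax b <= m)%N -> buses (fun x => x < m)%N (fun x => x < m)%N b.
  elim: b => //=.
  - by move=> e1 e2; rewrite geq_max => /andP[/hi-> /hi->].
  - by move=> e1 e2; rewrite geq_max => /andP[/hc-> /hc->].
  - by move=> b1 IH1 b2 IH2; rewrite geq_max => /andP[/IH1-> /IH2->].
elim: c => //=.
- by move=> x e; rewrite geq_max => /andP[-> /hi->].
- by move=> x i j e; rewrite !geq_max => /and4P[-> /hi-> /hi-> /hc->].
- by move=> c1 IH1 c2 IH2; rewrite geq_max => /andP[/IH1-> /IH2->].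
- by move=> b c1 IH1 c2 IH2; rewrite !geq_max => /and3P[/hb-> /IH1-> /IH2->].
- by move=> b c1 IH1; rewrite !geq_max => /andP[/hb-> /IH1->].
Qed.

End ProgramLogic.

(* Programs for unitary column operations *)
Declare Scope cexp_scope.
Delimit Scope cexp_scope with CE.
Bind Scope cexp_scope with cexp.
Notation "x + y" := (CAdd x y) : cexp_scope.
Notation "- x" := (COpp x) : cexp_scope.
Notation "x - y" := (CAdd x (COpp y)) : cexp_scope.
Notation "x * y" := (CMul x y) : cexp_scope.
Notation "x / y" := (CMul x (CInv y)) : cexp_scope.
Notation "c1 ;; c2" := (Seq c1 c2) (at level 61, right associativity).

Definition cell0 (x i j : nat) : cexp := CCell x (INat i) (INat j).
(** Equality with zero, by antisymmetry of the partial order on [R[i]]. *)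
Definition ceq0 (e : cexp) : bexp := BAnd (BCle e (CNat 0)) (BCle (CNat 0) e).

(* Registers 2 and 3 hold the two columns of array 0 to be mixed, the first row
   of array 1 the four coefficients, and register 0 the number of columns. *)
Definition Rotate : cmd :=
  For 5 (INat 0) (IAdd (IReg 0) (INat 5))
    (CSet 2 (INat 0) (INat 0)
       (cell0 1 0 0 * CCell 0 (IReg 5) (IReg 2) + cell0 1 0 1 * CCell 0 (IReg 5) (IReg 3)) ;;
     CSet 0 (IReg 5) (IReg 3)
       (cell0 1 0 2 * CCell 0 (IReg 5) (IReg 2) + cell0 1 0 3 * CCell 0 (IReg 5) (IReg 3)) ;;
     CSet 0 (IReg 5) (IReg 2) (cell0 2 0 0)).

(* The entries of column [IReg 3] of row [IReg 4] are cleared against the pivot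
   column [IReg 2], for columns below [IReg 6]. *)
Definition ClearRow : cmd :=
  For 3 (IAdd (IReg 2) (INat 1)) (IReg 6)
    (If (ceq0 (CCell 0 (IReg 4) (IReg 3))) Skip
       (CSet 1 (INat 1) (INat 0)
          (CRoot 2 (CCell 0 (IReg 4) (IReg 2) * CConj (CCell 0 (IReg 4) (IReg 2)) +
                    CCell 0 (IReg 4) (IReg 3) * CConj (CCell 0 (IReg 4) (IReg 3)))) ;;
        CSet 1 (INat 0) (INat 0) (CConj (CCell 0 (IReg 4) (IReg 2)) / cell0 1 1 0) ;;
        CSet 1 (INat 0) (INat 1) (CConj (CCell 0 (IReg 4) (IReg 3)) / cell0 1 1 0) ;;
        CSet 1 (INat 0) (INat 2) (- CCell 0 (IReg 4) (IReg 3) / cell0 1 1 0) ;;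
        CSet 1 (INat 0) (INat 3) (CCell 0 (IReg 4) (IReg 2) / cell0 1 1 0) ;;
        Rotate)).

Definition Mix (j k : nat) (a b c d : cexp) : cmd :=
  ISet 2 (INat j) ;; ISet 3 (INat k) ;;
  CSet 1 (INat 0) (INat 0) a ;; CSet 1 (INat 0) (INat 1) b ;;
  CSet 1 (INat 0) (INat 2) c ;; CSet 1 (INat 0) (INat 3) d ;; Rotate.

Section Columns.
Variable R : realType.
Local Notation C := R[i].
Implicit Types (st : store R) (M : nat -> nat -> C).

(* Array 0 stacks the r' x r' unitary, initially the identity, over the four rows
   of amplitudes of the operators K'_j A, with A a Schmidt factor of the state,
   and over a scratch row for the vector to be deflated. *)
Definition holds r' M st : Prop :=
  reg st 0%N = r' /\
  forall i l, (i < r' + 5)%N -> (l < r')%N -> cell st 0%N i l = M i l.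

(** The lists name what may have changed; the stores agree everywhere else. *)
Definition frame (rs xs : seq nat) st st' : Prop :=
  agree [pred x | x \notin rs] [pred x | x \notin xs] st st'.

Lemma frame_trans rs xs st1 st2 st3 :
  frame rs xs st1 st2 -> frame rs xs st2 st3 -> frame rs xs st1 st3.
Proof. exact: agree_trans. Qed.

Lemma frame_sub rs xs rs' xs' st st' :
  all (mem rs') rs -> all (mem xs') xs -> frame rs xs st st' -> frame rs' xs' st st'.
Proof.
by move=> /allP hr /allP hx; apply: agree_sub => x /=; apply: contra; [apply: hr|apply: hx].
Qed.

Lemma frame_set_reg rs xs st st' x v :
  x \in rs -> frame rs xs st st' -> frame rs xs st (set_reg st' x v).
Proof.
move=> hx [hr hc]; split => //= y hy; case: eqP => [yx|_]; last exact: hr.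
by rewrite yx hx in hy.
Qed.

Lemma frame_set_cell rs xs st st' x i j v :
  x \in xs -> frame rs xs st st' -> frame rs xs st (set_cell st' x i j v).
Proof.
move=> hx [hr hc]; split => //= y k l hy; case: eqP => [yx|_] /=; last exact: hc.
by rewrite yx hx in hy.
Qed.

Lemma holds_frame rs xs r' M st st' : frame rs xs st st' ->
  0%N \notin rs -> 0%N \notin xs -> holds r' M st -> holds r' M st'.
Proof.
move=> [hr hc] r0 x0 [h0 h]; split; first by rewrite hr.
by move=> i l hi hl; rewrite hc// h.
Qed.

Lemma beval_ceq0 st e : beval st (ceq0 e) = (ceval st e == 0).
Proof. by rewrite /= eq_le. Qed.

Definition rotate_time r' := (5 * (r' + 5) + 2)%N.

Lemma wp_rotate st r' M j k a b c d :
  holds r' M st -> reg st 2%N = j -> reg st 3%N = k ->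
  (j < r')%N -> (k < r')%N -> j != k ->
  cell st 1%N 0%N 0%N = a -> cell st 1%N 0%N 1%N = b ->
  cell st 1%N 0%N 2%N = c -> cell st 1%N 0%N 3%N = d ->
  wp Rotate st (fun T st' => [/\ (T <= rotate_time r')%N,
    holds r' (mixcol M j k a b c d) st' & frame [:: 5%N] [:: 0%N; 2%N] st st']).
Proof.
move=> [h0 hM] h2 h3 jr kr jk ha hb hc hd.
pose I i st1 := [/\ reg st1 5%N = i, frame [:: 5%N] [:: 0%N; 2%N] st st1,
  forall i' l, (i' < r' + 5)%N -> (l < r')%N ->
    cell st1 0%N i' l = if (i' < i)%N then mixcol M j k a b c d i' l else M i' l &
  True].
have step := @wp_for R 5 (INat 0) (IAdd (IReg 0) (INat 5)) _ st 0 (r' + 5) 3 I.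
apply: wp_conseq (step _ _ _ _ _ _) _ => //.
- by split => //; apply: frame_set_reg => //; apply: agree_refl.
- by move=> i st1 [r5 [fr _] _ _] /=; rewrite r5 fr//= h0.
- move=> i st1 /andP[_ hi] [r5 fr hc1 _].
  have [fr1 fr2] := fr.
  apply: wp_seq; apply: wp_cset => v0 /= E0.
  apply: wp_seq; apply: wp_cset => v1 /= E1.
  apply: wp_cset => v2 /= E2.
  move: E0 E1 E2; rewrite /= !r5 !(fr1 2%N)// !(fr1 3%N)// h2 h3 !(fr2 1%N)//= ha hb hc hd.
  rewrite !hc1// ltnn => E0 E1 E2.
  split => //.
  split => //.
  + by apply: frame_set_reg => //; do 3!apply: frame_set_cell => //.
  + move=> i' l hi' hl /=; rewrite ltnS leq_eqVlt.
    have [-> /=|ii] := eqVneq i' i.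
      rewrite /mixcol; have [_|lj] := eqVneq l j; first by rewrite E2 E0.
      have [_|lk] := eqVneq l k; first by rewrite E1.
      by rewrite hc1// ltnn.
    by rewrite /= hc1.
- move=> T st' [hT [r5 fr hc1 _]]; split => //.
  + by rewrite /rotate_time; lia.
  + split; first by rewrite (proj1 fr).
    by move=> i l hi hl; rewrite hc1// hi.
Qed.

(** The coefficients are computed one after the other while registers 2, 3 and array 1 are being
    overwritten. The side condition makes all four take their values in the initial store. *)
Lemma wp_mix st r' M j k (ea eb ec ed : cexp) :
  holds r' M st -> (j < r')%N -> (k < r')%N -> j != k ->
  all (cuses [pred x | x \notin [:: 2%N; 3%N]] [pred x | x \notin [:: 1%N]])
    [:: ea; eb; ec; ed] ->
  wp (Mix j k ea eb ec ed) st (fun T st' => [/\ (T <= rotate_time r' + 6)%N,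
    holds r' (mixcol M j k (ceval st ea) (ceval st eb) (ceval st ec) (ceval st ed)) st' &
    frame [:: 2%N; 3%N; 5%N] [:: 0%N; 1%N; 2%N] st st']).
Proof.
move=> hM jr kr jk /and5P[ua ub uc ud _].
have ce st' e : frame [:: 2%N; 3%N] [:: 1%N] st st' ->
    cuses [pred x | x \notin [:: 2%N; 3%N]] [pred x | x \notin [:: 1%N]] e ->
    ceval st' e = ceval st e by move=> fr; apply: ceval_agree.
have f0 : frame [:: 2%N; 3%N] [:: 1%N] st st by apply: agree_refl.
apply: wp_seq; apply: wp_iset; have f1 := frame_set_reg (x := 2) j (isT : 2%N \in [:: 2%N; 3%N]) f0.
apply: wp_seq; apply: wp_iset; have f2 := frame_set_reg (x := 3) k (isT : 3%N \in [:: 2%N; 3%N]) f1.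
apply: wp_seq; apply: wp_cset => va; rewrite (ce _ _ f2)// => Ea.
have f3 := frame_set_cell (x := 1) 0 0 va (isT : 1%N \in [:: 1%N]) f2.
apply: wp_seq; apply: wp_cset => vb; rewrite (ce _ _ f3)// => Eb.
have f4 := frame_set_cell (x := 1) 0 1 vb (isT : 1%N \in [:: 1%N]) f3.
apply: wp_seq; apply: wp_cset => vc; rewrite (ce _ _ f4)// => Ec.
have f5 := frame_set_cell (x := 1) 0 2 vc (isT : 1%N \in [:: 1%N]) f4.
apply: wp_seq; apply: wp_cset => vd; rewrite (ce _ _ f5)// => Ed.
have f6 := frame_set_cell (x := 1) 0 3 vd (isT : 1%N \in [:: 1%N]) f5.
have h6 := holds_frame f6 isT isT hM.
apply: wp_conseq (wp_rotate h6 (erefl j) (erefl k) jr kr jk (erefl va) (erefl vb)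
  (erefl vc) (erefl vd)) _.
move=> T st' [hT hM' fr]; split.
- by lia.
- by rewrite -Ea -Eb -Ec -Ed.
- by apply: (frame_trans (frame_sub _ _ f6) (frame_sub _ _ fr)).
Qed.

Definition clear_time r' := (r' * (rotate_time r' + 9) + 2)%N.

Lemma wp_clear_row st r' M k rho b :
  holds r' M st -> reg st 2%N = k -> reg st 4%N = rho -> reg st 6%N = b ->
  (k < b)%N -> (b <= r')%N -> (rho < r' + 5)%N ->
  wp ClearRow st (fun T st' => (T <= clear_time r')%N /\
    exists M', [/\ holds r' M' st', colstep k b M M',
      forall l, (k < l < b)%N -> M' rho l = 0 &
      frame [:: 3%N; 5%N] [:: 0%N; 1%N; 2%N] st st']).
Proof.
move=> hM r2 r4 r6 kb br rr.
pose I j st1 := reg st1 3%N = j /\ frame [:: 3%N; 5%N] [:: 0%N; 1%N; 2%N] st st1 /\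
  exists M', [/\ holds r' M' st1, colstep k b M M' &
    forall l, (k < l < j)%N -> M' rho l = 0].
have step := @wp_for R 3 (IAdd (IReg 2) (INat 1)) (IReg 6) _ st k.+1 b
  (rotate_time r' + 7)%N I.
apply: wp_conseq (step _ _ _ _ _ _) _ => //.
- by rewrite /= r2 addn1.
- split => //; split; first by apply: frame_set_reg => //; apply: agree_refl.
  exists M; split; [by split; case: hM | exact: colstep_refl |].
  by move=> l; rewrite ltnS; case: ltnP => //= h1 h2; move: (leq_trans h1 h2); rewrite ltnn.
- by move=> j st1 [r3 [[fr _] _]]; rewrite r3 /= fr.
- move=> j st1 /andP[kj jb] [r3 [fr [M1 [hM1 cM1 z1]]]].
  have [fr1 fr2] := fr.
  have kr : (k < r')%N by apply: leq_trans br.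
  have jr : (j < r')%N by apply: leq_trans br.
  have kj' : k != j by rewrite neq_ltn kj.
  have cE l : (l < r')%N -> cell st1 0%N (reg st1 4%N) l = M1 rho l.
    by move=> hl; rewrite fr1// r4 (proj2 hM1).
  have s2 : reg st1 2%N = k by rewrite fr1.
  apply: wp_if; rewrite beval_ceq0 /= r3 cE// => y0.
    apply: wp_skip; split => //; first by rewrite /rotate_time; lia.
    split => //; split; first exact: frame_set_reg.
    exists M1; split => // l /andP[kl]; rewrite ltnS leq_eqVlt => /predU1P[->|lj].
      exact/eqP.
    by apply: z1; rewrite kl.
  apply: wp_seq; apply: wp_cset => n /=; rewrite r3 s2 !cE// => nE.
  apply: wp_seq; apply: wp_cset => a /=; rewrite s2 cE// => aE.
  apply: wp_seq; apply: wp_cset => b' /=; rewrite r3 cE// => bE.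
  apply: wp_seq; apply: wp_cset => c /=; rewrite r3 cE// => cE'.
  apply: wp_seq; apply: wp_cset => d /=; rewrite s2 cE// => dE.
  set st2 := set_cell _ _ _ _ d.
  have f2 : frame [::] [:: 1%N] st1 st2.
    by do 5!apply: frame_set_cell => //; apply: agree_refl.
  have hM2 := holds_frame f2 isT isT hM1.
  have [n0 un] := givens_unitary y0 nE.
  apply: wp_conseq (wp_rotate hM2 (s2 : reg st2 2%N = k) (r3 : reg st2 3%N = j) kr jr kj'
    (erefl a) (erefl b') (erefl c) (erefl d)) _.
  move=> T st3 [hT hM3 fr3]; split; first by lia.
    by rewrite (proj1 fr3).
  split => //; split.
    apply: frame_set_reg => //; apply: frame_trans fr _.
    by apply: (frame_trans (frame_sub _ _ f2) (frame_sub _ _ fr3)).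
  exists (mixcol M1 k j a b' c d); split => //.
    apply: colstep_trans cM1 _; apply: colstep_mixcol => //.
    - by rewrite leqnn.
    - by rewrite jb ltnW.
    - by rewrite aE bE cE' dE.
  move=> l /andP[kl]; rewrite ltnS leq_eqVlt => /predU1P[->|lj].
    by rewrite mixcol_k// cE' dE; field.
  rewrite mixcol_out ?z1 ?kl ?lj//; first by rewrite gtn_eqF.
  by rewrite ltn_eqF.
- move=> T st' [hT [_ [fr [M' [h1 h2 h3]]]]]; split; last by exists M'.
  rewrite /clear_time; apply: leq_trans hT _; rewrite leq_add2r leq_mul//; last by lia.
  by apply: leq_trans br; apply: leq_subr.
Qed.

End Columns.

(* Arrays used below: 3 Gram matrix, later Takagi matrix; 4 deflation vector;
   5 and 7 temporary vectors; 6 eigenvalues; 8 and 9 scalars; 10 flipped Gram matrix. *)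
Definition FillRow (x i : nat) (E : nat -> cexp) : cmd :=
  CSet x (INat i) (INat 0) (E 0) ;; CSet x (INat i) (INat 1) (E 1) ;;
  CSet x (INat i) (INat 2) (E 2) ;; CSet x (INat i) (INat 3) (E 3).

Definition FillMatrix (x : nat) (E : nat -> nat -> cexp) : cmd :=
  FillRow x 0 (E 0) ;; FillRow x 1 (E 1) ;; FillRow x 2 (E 2) ;; FillRow x 3 (E 3).

Definition clear_x_row (l : nat) : cmd :=
  ISet 2 (INat l) ;; ISet 4 (IAdd (IReg 0) (INat l)) ;; ISet 6 (IReg 0) ;; ClearRow.

Definition Triangularize : cmd :=
  clear_x_row 0 ;; clear_x_row 1 ;; clear_x_row 2 ;; clear_x_row 3.

Section Fill.
Variable R : realType.
Local Notation C := R[i].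
Implicit Types (st : store R) (M : nat -> nat -> C).

Definition vec st (x i : nat) : 'cV[C]_4 := \col_(j < 4) cell st x i j.
Definition mat st (x : nat) : 'M[C]_4 := \matrix_(i < 4, j < 4) cell st x i j.

Lemma forall_ord4 (P : nat -> Prop) : P 0%N -> P 1%N -> P 2%N -> P 3%N ->
  forall j, (j < 4)%N -> P j.
Proof. by move=> ? ? ? ? [|[|[|[|j]]]]. Qed.

Definition avoids (xs : seq nat) (e : cexp) : bool :=
  cuses predT [pred x | x \notin xs] e.

Lemma wp_fill_row st x i (E : nat -> cexp) :
  all (fun j => avoids [:: x] (E j)) (iota 0 4) ->
  wp (FillRow x i E) st (fun T st' => [/\ T = 4%N,
    forall j, (j < 4)%N -> cell st' x i j = ceval st (E j),
    frame [::] [:: x] st st' &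
    forall i' j, i' != i -> cell st' x i' j = cell st x i' j]).
Proof.
move=> /and5P[u0 u1 u2 u3 _].
have xx : x \in [:: x] by rewrite inE.
have ce st' e : frame [::] [:: x] st st' -> avoids [:: x] e -> ceval st' e = ceval st e.
  by move=> [h1 h2]; apply: ceval_agree; split => // y; apply: h1.
have f0 : frame [::] [:: x] st st by apply: agree_refl.
apply: wp_seq; apply: wp_cset => v0 E0.
have f1 := frame_set_cell i 0 v0 xx f0.
apply: wp_seq; apply: wp_cset => v1; rewrite (ce _ _ f1)// => E1.
have f2 := frame_set_cell i 1 v1 xx f1.
apply: wp_seq; apply: wp_cset => v2; rewrite (ce _ _ f2)// => E2.
have f3 := frame_set_cell i 2 v2 xx f2.
apply: wp_cset => v3; rewrite (ce _ _ f3)// => E3.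
have f4 := frame_set_cell i 3 v3 xx f3.
split => //.
- by apply: forall_ord4 => /=; rewrite !eqxx //= ?E0 ?E1 ?E2 ?E3.
- by move=> i' j ii /=; rewrite (negbTE ii) !andbF.
Qed.

Lemma wp_fill_vec st x i (E : nat -> cexp) :
  all (fun j => avoids [:: x] (E j)) (iota 0 4) ->
  wp (FillRow x i E) st (fun T st' => [/\ T = 4%N,
    vec st' x i = \col_j ceval st (E j) & frame [::] [:: x] st st']).
Proof.
move=> h; apply: wp_conseq (wp_fill_row st i h) _ => T st' [-> h1 h2 _].
by split => //; apply/matrixP => j k; rewrite !mxE h1.
Qed.

Lemma wp_fill_mat st x (E : nat -> nat -> cexp) :
  all (fun i => all (fun j => avoids [:: x] (E i j)) (iota 0 4)) (iota 0 4) ->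
  wp (FillMatrix x E) st (fun T st' => [/\ T = 16%N,
    mat st' x = \matrix_(i, j) ceval st (E i j) & frame [::] [:: x] st st']).
Proof.
move=> /and5P[u0 u1 u2 u3 _].
have ce st' e : frame [::] [:: x] st st' -> avoids [:: x] e -> ceval st' e = ceval st e.
  by move=> [h1 h2]; apply: ceval_agree; split => // y; apply: h1.
apply: wp_seq; apply: wp_conseq (wp_fill_row st 0 u0) _ => _ st0 [-> c0 f0 _].
apply: wp_seq; apply: wp_conseq (wp_fill_row st0 1 u1) _ => _ st1 [-> c1 f1 o1].
have f01 := frame_trans f0 f1.
apply: wp_seq; apply: wp_conseq (wp_fill_row st1 2 u2) _ => _ st2 [-> c2 f2 o2].
have f02 := frame_trans f01 f2.
apply: wp_conseq (wp_fill_row st2 3 u3) _ => _ st3 [-> c3 f3 o3].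
split => //; last exact: frame_trans f02 f3.
have av (E' : nat -> cexp) j : all (fun j => avoids [:: x] (E' j)) (iota 0 4) -> (j < 4)%N ->
    avoids [:: x] (E' j) by move=> /allP h hj; apply: h; rewrite mem_iota.
apply/matrixP => i j; rewrite !mxE; case: i => -[|[|[|[|//]]]] hi /=.
- by rewrite o3// o2// o1// c0.
- by rewrite o3// o2// c1// (ce _ _ f0)// av.
- by rewrite o3// c2// (ce _ _ f01)// av.
- by rewrite c3// (ce _ _ f02)// av.
Qed.

Definition row_gram r' M i i' : C := \sum_(0 <= l < r') M i l * (M i' l)^*.
(** Only the first four outcomes have nonzero weight. *)
Definition lower_rows r' M := forall l j, (l < 4)%N -> (4 <= j < r')%N -> M (r' + l)%N j = 0.

Lemma wp_clear_x_row st r' M a : holds r' M st -> (a < 4)%N -> (4 <= r')%N ->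
  (forall l j, (l < a)%N -> (l < j < r')%N -> M (r' + l)%N j = 0) ->
  wp (clear_x_row a) st (fun T st' => (T <= clear_time r' + 3)%N /\
    exists M', [/\ holds r' M' st', row_gram r' M' =2 row_gram r' M,
      forall l j, (l < a.+1)%N -> (l < j < r')%N -> M' (r' + l)%N j = 0 &
      frame [:: 2%N; 3%N; 4%N; 5%N; 6%N] [:: 0%N; 1%N; 2%N] st st']).
Proof.
move=> hM a4 r4 hz; set rs := [:: 2%N; 3%N; 4%N; 5%N; 6%N]; set xs := [:: 0%N; 1%N; 2%N].
have ar : (a < r')%N by apply: leq_trans r4.
have f0 : frame [:: 2%N; 4%N; 6%N] [::] st st by apply: agree_refl.
have r0 : reg st 0%N = r' := proj1 hM.
apply: wp_seq; apply: wp_iset; have f1 := frame_set_reg (x := 2) a (isT : 2%N \in [:: 2%N; 4%N; 6%N]) f0.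
apply: wp_seq; apply: wp_iset; rewrite /= r0.
have f2 := frame_set_reg (x := 4) (r' + a) (isT : 4%N \in [:: 2%N; 4%N; 6%N]) f1.
apply: wp_seq; apply: wp_iset; rewrite /= r0.
have f3 := frame_set_reg (x := 6) r' (isT : 6%N \in [:: 2%N; 4%N; 6%N]) f2.
have h3 := holds_frame f3 isT isT hM.
have rr : (r' + a < r' + 5)%N by rewrite ltn_add2l ltnW.
apply: wp_conseq (wp_clear_row h3 (erefl a) (erefl (r' + a)%N) (erefl r') ar (leqnn r') rr) _.
move=> T st' [hT [M' [hM' cs z fr]]]; split; first by lia.
exists M'; split => //.
- by move=> i i'; apply: (colstep_widen _ _ _ cs) => //; apply: ltnW.
- move=> l j; rewrite ltnS leq_eqVlt => /predU1P[->|la] /andP[lj jr].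
    by apply: z; rewrite lj.
  have [_ o f] := cs.
  have [ja|aj] := ltnP j a.
    by rewrite o ?hz ?la ?lj//; rewrite negb_and -ltnNge ja.
  (* Row l already vanishes on the whole window, so the functional that reads off this row stays
     zero on the mixed columns. *)
  apply: (f (fun u => u (r' + l)%N)) => //; last by rewrite aj.
  move=> j' /andP[aj' jr']; apply: hz => //; rewrite jr' andbT.
  exact: leq_trans la aj'.
- by apply: (frame_trans (frame_sub _ _ f3) (frame_sub _ _ fr)).
Qed.

Lemma wp_triangularize st r' M : holds r' M st -> (4 <= r')%N ->
  wp Triangularize st (fun T st' => (T <= 4 * (clear_time r' + 3))%N /\
    exists M', [/\ holds r' M' st', row_gram r' M' =2 row_gram r' M,
      lower_rows r' M' &
      frame [:: 2%N; 3%N; 4%N; 5%N; 6%N] [:: 0%N; 1%N; 2%N] st st']).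
Proof.
move=> hM r4.
apply: wp_seq; apply: wp_conseq (wp_clear_x_row (a := 0) hM _ r4 _) _ => //.
move=> T0 st0 [hT0 [M0 [h0 g0 z0 f0]]].
apply: wp_seq; apply: wp_conseq (wp_clear_x_row (a := 1) h0 _ r4 _) _ => //.
move=> T1 st1 [hT1 [M1 [h1 g1 z1 f1]]].
apply: wp_seq; apply: wp_conseq (wp_clear_x_row (a := 2) h1 _ r4 _) _ => //.
move=> T2 st2 [hT2 [M2 [h2 g2 z2 f2]]].
apply: wp_conseq (wp_clear_x_row (a := 3) h2 _ r4 _) _ => //.
move=> T3 st3 [hT3 [M3 [h3 g3 z3 f3]]].
split; first by lia.
exists M3; split => //.
- by move=> i i'; rewrite g3 g2 g1 g0.
- move=> l j l4 /andP[j4 jr]; apply: z3 => //; rewrite jr andbT.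
  exact: leq_trans l4 j4.
- exact: frame_trans (frame_trans (frame_trans f0 f1) f2) f3.
Qed.

End Fill.

(** * Computation of the spectrum from the Gram matrix *)

Definition xcell (l j : nat) : cexp := CCell 0 (IAdd (IReg 0) (INat l)) (INat j).

(** Four columns suffice, the amplitudes beyond them being zero after triangularization. *)
Definition gramE (l m : nat) : cexp :=
  (xcell l 0 * CConj (xcell m 0) + xcell l 1 * CConj (xcell m 1) +
   xcell l 2 * CConj (xcell m 2) + xcell l 3 * CConj (xcell m 3))%CE.

(** A summand of entry (l, m) of J conj(G) J G, with G in array 3 and J the antidiagonal matrix of
    signs +, -, -, +. Conjugation by J reverses both indices and contributes one sign for each index
    equal to 1 or 2. *)
Definition flip_term (l q m : nat) : cexp :=
  let e := (CConj (cell0 3 (3 - l) (3 - q)) * cell0 3 q m)%CE in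
  if (l \in [:: 1; 2]) (+) (q \in [:: 1; 2]) then (- e)%CE else e.

Definition flipE (l m : nat) : cexp :=
  (flip_term l 0 m + flip_term l 1 m + flip_term l 2 m + flip_term l 3 m)%CE.

Definition minor2E (f : nat -> nat -> cexp) (a b : nat) : cexp :=
  (f a a * f b b - f a b * f b a)%CE.
Definition minor3E (f : nat -> nat -> cexp) (a b c : nat) : cexp :=
  (f a a * (f b b * f c c - f b c * f c b)
   - f a b * (f b a * f c c - f b c * f c a)
   + f a c * (f b a * f c b - f b b * f c a))%CE.
Definition minor3E' (f : nat -> nat -> cexp) (a b c : nat) : cexp :=
  (f 1 a * (f 2 b * f 3 c - f 2 c * f 3 b)
   - f 1 b * (f 2 a * f 3 c - f 2 c * f 3 a)
   + f 1 c * (f 2 a * f 3 b - f 2 b * f 3 a))%CE.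
Definition esym1E (f : nat -> nat -> cexp) : cexp := (f 0 0 + f 1 1 + f 2 2 + f 3 3)%CE.
Definition esym2E (f : nat -> nat -> cexp) : cexp :=
  (minor2E f 0 1 + minor2E f 0 2 + minor2E f 0 3 + minor2E f 1 2 + minor2E f 1 3
   + minor2E f 2 3)%CE.
Definition esym3E (f : nat -> nat -> cexp) : cexp :=
  (minor3E f 0 1 2 + minor3E f 0 1 3 + minor3E f 0 2 3 + minor3E f 1 2 3)%CE.
Definition esym4E (f : nat -> nat -> cexp) : cexp :=
  (f 0 0 * minor3E' f 1 2 3 - f 0 1 * minor3E' f 0 2 3
   + f 0 2 * minor3E' f 0 1 3 - f 0 3 * minor3E' f 0 1 2)%CE.

Definition sc (i : nat) : cexp := cell0 9 0 i.
Definition SetSc (i : nat) (e : cexp) : cmd := CSet 9 (INat 0) (INat i) e.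
Definition cnat (n : nat) : cexp := CNat n.
Definition sqE (e : cexp) : cexp := (e * e)%CE.

(** Cardano applied to the resolvent k^3 + 2 P k^2 + (P^2 - 4 T) k - Q^2, with P, Q, T in scalars 4,
    5, 6. If the first cube root is zero, the other sign of the square root is tried; both cube
    roots vanish only when p = q = 0. *)
Definition CubicRoot : cmd :=
  SetSc 7 (sqE (sc 4) - cnat 4 * sc 6 - sqE (cnat 2 * sc 4) / cnat 3)%CE ;;
  SetSc 8 (cnat 2 * (cnat 2 * sc 4 * sqE (cnat 2 * sc 4)) / cnat 27
           - (cnat 2 * sc 4) * (sqE (sc 4) - cnat 4 * sc 6) / cnat 3 - sqE (sc 5))%CE ;;
  SetSc 9 (CRoot 2 (sqE (sc 8) / cnat 4 + sc 7 * sqE (sc 7) / cnat 27))%CE ;;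
  SetSc 10 (CRoot 3 (- sc 8 / cnat 2 + sc 9))%CE ;;
  If (ceq0 (sc 10)) (SetSc 10 (CRoot 3 (- sc 8 / cnat 2 - sc 9))%CE) Skip ;;
  SetSc 11 (sc 10 - sc 7 / (cnat 3 * sc 10) - (cnat 2 * sc 4) / cnat 3)%CE.

(* Ferrari: the quartic with coefficients in scalars 0 to 3; scalars 4 to 6 are
   the depressed coefficients and scalar 11 a root of the resolvent cubic. *)
Definition QuarticRoots : cmd :=
  SetSc 4 (sc 1 - cnat 3 * sqE (sc 0) / cnat 8)%CE ;;
  SetSc 5 (sc 2 - sc 0 * sc 1 / cnat 2 + sc 0 * sqE (sc 0) / cnat 8)%CE ;;
  SetSc 6 (sc 3 - sc 0 * sc 2 / cnat 4 + sqE (sc 0) * sc 1 / cnat 16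
           - cnat 3 * sqE (sqE (sc 0)) / cnat 256)%CE ;;
  CubicRoot ;;
  SetSc 12 (CRoot 2 (sc 11)) ;;
  If (ceq0 (sc 12)) (SetSc 13 (CRoot 2 (sqE (sc 4) - cnat 4 * sc 6))%CE)
     (SetSc 13 (sc 5 / sc 12)%CE) ;;
  SetSc 14 (CRoot 2 (sc 11 - cnat 2 * (sc 4 + sc 11 - sc 13)))%CE ;;
  SetSc 15 (CRoot 2 (sc 11 - cnat 2 * (sc 4 + sc 11 + sc 13)))%CE ;;
  CSet 6 (INat 0) (INat 0) (cnat 0) ;;
  CSet 6 (INat 0) (INat 1) ((- sc 12 + sc 14) / cnat 2 - sc 0 / cnat 4)%CE ;;
  CSet 6 (INat 0) (INat 2) ((- sc 12 - sc 14) / cnat 2 - sc 0 / cnat 4)%CE ;;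
  CSet 6 (INat 0) (INat 3) ((sc 12 + sc 15) / cnat 2 - sc 0 / cnat 4)%CE ;;
  CSet 6 (INat 0) (INat 4) ((sc 12 - sc 15) / cnat 2 - sc 0 / cnat 4)%CE.

Definition Spectrum : cmd :=
  FillMatrix 3 gramE ;; FillMatrix 10 flipE ;;
  SetSc 0 (- esym1E (cell0 10))%CE ;; SetSc 1 (esym2E (cell0 10)) ;;
  SetSc 2 (- esym3E (cell0 10))%CE ;; SetSc 3 (esym4E (cell0 10)) ;;
  QuarticRoots.

Section SpectrumCorrect.
Variable R : realType.
Local Notation C := R[i].
Implicit Types (st : store R) (M : nat -> nat -> C).

Lemma wp_cubic_root st :
  let P := cell st 9%N 0%N 4%N in let Q := cell st 9%N 0%N 5%N in
  let T := cell st 9%N 0%N 6%N in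
  wp CubicRoot st (fun t st' => [/\ (t <= 8)%N,
    let k := cell st' 9%N 0%N 11%N in
    k ^+ 3 + 2 * P * k ^+ 2 + (P ^+ 2 - 4 * T) * k - Q ^+ 2 = 0,
    (forall i, (i < 7)%N -> cell st' 9%N 0%N i = cell st 9%N 0%N i) &
    frame [::] [:: 9%N] st st']).
Proof.
move=> P Q T.
have fr0 : frame [::] [:: 9%N] st st by apply: agree_refl.
apply: wp_seq; apply: wp_cset => p /= pE.
apply: wp_seq; apply: wp_cset => q /= qE.
apply: wp_seq; apply: wp_cset => e /= eE.
apply: wp_seq; apply: wp_cset => u /= uE.
have e2 : e ^+ 2 = q ^+ 2 / 4 + p ^+ 3 / 27 by rewrite eE sqrtCK !exprS expr0 !mulr1.
have u3 : u ^+ 3 = - q / 2 + e by rewrite uE rootCK.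
have pE' : p = (P ^+ 2 - 4 * T) - (2 * P) ^+ 2 / 3 by rewrite pE.
have qE' : q = 2 * (2 * P) ^+ 3 / 27 - (2 * P) * (P ^+ 2 - 4 * T) / 3 + - Q ^+ 2.
  by rewrite qE /P /Q /T; ring.
apply: wp_seq; apply: wp_if; rewrite beval_ceq0 /= => u0.
  apply: wp_cset => u' /= uE'; apply: wp_cset => k /= kE.
  split => //.
  - rewrite -(@cubic_root _ (2 * P) (P ^+ 2 - 4 * T) (- Q ^+ 2) p q u' (- e)) //.
    + by rewrite kE.
    + by rewrite sqrrN.
    + by rewrite uE' rootCK.
    + move=> u'0; have h1 : - q / 2 + e = 0 by rewrite -u3 (eqP u0) expr0n.
      have h2 : - q / 2 - e = 0 by rewrite -[LHS](@rootCK _ 3)// -uE' u'0 expr0n.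
      have q0 : q = 0.
        have -> : q = - (- q / 2 + e) - (- q / 2 - e) by field.
        by rewrite h1 h2 oppr0 addr0.
      split => //; have e0 : e = 0 by move: h1; rewrite q0 oppr0 mul0r add0r.
      have : p ^+ 3 / 27 = 0 by move: e2; rewrite e0 q0 !expr0n /= mul0r add0r.
      by move/eqP; rewrite mulf_eq0 invr_eq0 pnatr_eq0 orbF expf_eq0 /= => /eqP.
  - by case=> [|[|[|[|[|[|[|i]]]]]]].
  - by do 6!apply: frame_set_cell => //.
apply: wp_skip; apply: wp_cset => k /= kE.
split => //.
- rewrite -(@cubic_root _ (2 * P) (P ^+ 2 - 4 * T) (- Q ^+ 2) p q u e) //.
  + by rewrite kE.
  + by move=> uz; rewrite uz eqxx in u0.
- by case=> [|[|[|[|[|[|[|i]]]]]]].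
- by do 5!apply: frame_set_cell => //.
Qed.

Lemma wp_quartic_roots st :
  let a i := cell st 9%N 0%N i in
  wp QuarticRoots st (fun t st' => [/\ (t <= 22)%N,
    let x i := cell st' 6%N 0%N i in
    [/\ x 0%N = 0,
      - a 0%N = x 1%N + x 2%N + x 3%N + x 4%N,
      a 1%N = x 1%N * x 2%N + x 3%N * x 4%N + (x 1%N + x 2%N) * (x 3%N + x 4%N),
      - a 2%N = x 1%N * x 2%N * (x 3%N + x 4%N) + x 3%N * x 4%N * (x 1%N + x 2%N) &
      a 3%N = x 1%N * x 2%N * (x 3%N * x 4%N)] &
    frame [::] [:: 6%N; 9%N] st st']).
Proof.
move=> a.
apply: wp_seq; apply: wp_cset => P /= PE.
apply: wp_seq; apply: wp_cset => Q /= QE.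
apply: wp_seq; apply: wp_cset => T /= TE.
set st1 := set_cell _ _ _ _ T.
have f1 : frame [::] [:: 9%N] st st1.
  by do 3!apply: frame_set_cell => //; apply: agree_refl.
apply: wp_seq; apply: wp_conseq (wp_cubic_root st1) _ => t1 st2 [ht1 kE c2 f2].
have {}c2 : [/\ cell st2 9%N 0%N 0%N = a 0%N, cell st2 9%N 0%N 4%N = P,
   cell st2 9%N 0%N 5%N = Q & cell st2 9%N 0%N 6%N = T] by rewrite !c2.
move: c2 kE; rewrite /=; set k := cell st2 9%N 0%N 11%N => -[c0 c4 c5 c6] kE.
have f12 := frame_trans f1 f2.
apply: wp_seq; apply: wp_cset => u /= uE.
apply: wp_seq; apply: wp_conseq (_ : wp _ _ (fun t st' => t = 2%N /\
   exists dl, [/\ st' = set_cell (set_cell st2 9 0 12 u) 9 0 13 dl,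
     u != 0 -> dl = Q / u & u = 0 -> dl ^+ 2 = P ^+ 2 - 4 * T])) _.
  apply: wp_if; rewrite beval_ceq0 /= => u0; apply: wp_cset => dl /= dlE; split => //; exists dl; split => //.
  - by rewrite u0.
  - by move=> _; rewrite dlE sqrtCK c4 c6.
  - by move=> _; rewrite dlE c5.
  - by move=> uz; rewrite uz eqxx in u0.
move=> t3 st3 [t3E [dl [-> d1 d2]]].
apply: wp_seq; apply: wp_cset => s1 /=; rewrite c4 => s1E.
apply: wp_seq; apply: wp_cset => s2 /=; rewrite c4 => s2E.
apply: wp_seq; apply: wp_cset => x0 /= x0E.
apply: wp_seq; apply: wp_cset => x1 /=; rewrite c0 => x1E.
apply: wp_seq; apply: wp_cset => x2 /=; rewrite c0 => x2E.
apply: wp_seq; apply: wp_cset => x3 /=; rewrite c0 => x3E.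
apply: wp_cset => x4 /=; rewrite c0 => x4E.
split.
- by rewrite t3E; lia.
- have u2 : u ^+ 2 = k by rewrite uE sqrtCK.
  have s12 : s1 ^+ 2 = k - 2 * (P + k - dl) by rewrite s1E sqrtCK.
  have s22 : s2 ^+ 2 = k - 2 * (P + k + dl) by rewrite s2E sqrtCK.
  have [] := @quartic_roots _ (a 0%N) (a 1%N) (a 2%N) (a 3%N) P Q T k u dl s1 s2 _ _ _ kE u2 d1 d2 s12 s22.
  + by rewrite PE.
  + by rewrite QE; congr (_ + _ / _).
  + by rewrite TE /a; ring.
  by rewrite -x1E -x2E -x3E -x4E => *; split.
- do 9!apply: frame_set_cell => //.
  by apply: (frame_sub _ _ f12).
Qed.

Definition flipJ : 'M[C]_4 := \matrix_(i < 4, j < 4)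
  (if (i + j == 3)%N then (-1) ^+ (val i \in [:: 1%N; 2%N]) else 0).

(** Wootters' product of the spin-flipped matrix with the matrix itself: up to sign [flipJ] is the
    tensor square of the Pauli matrix sigma_y, and the sign cancels. *)
Definition flip_gram (G : 'M[C]_4) : 'M[C]_4 :=
  flipJ *m map_mx Num.conj G *m flipJ *m G.

Lemma flipJ_tr : flipJ^T = flipJ.
Proof.
apply/matrixP => i j; rewrite !mxE addnC.
case: i j => -[|[|[|[|//]]]] ? -[[|[|[|[|//]]]] ?] //=.
Qed.

Lemma flipJ_adj : flipJ^t* = flipJ.
Proof.
apply/matrixP => i j; rewrite flipJ_tr !mxE.
by case: ifP => _; rewrite ?rmorph0// rmorphXn rmorphN rmorph1.
Qed.

Lemma tau_flipJ (x y : nat -> C) :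
  tau x y = ((\col_(i < 4) x i)^T *m flipJ *m (\col_(i < 4) y i)) 0 0.
Proof.
rewrite !mxE !big_ord_recl big_ord0 !mxE !big_ord_recl !big_ord0 !mxE /= /bump /=.
by rewrite /tau; ring.
Qed.

Lemma mat_flip st (G : 'M[C]_4) : mat st 3 = G ->
  \matrix_(i < 4, j < 4) ceval st (flipE i j) = flip_gram G.
Proof.
move=> <-; apply/matrixP => i j; rewrite mxE /flip_gram.
rewrite !mxE !big_ord_recl big_ord0 !mxE !big_ord_recl !big_ord0 !mxE.
rewrite !big_ord_recl !big_ord0 !mxE /= /bump /=.
case: i => -[|[|[|[|//]]]] ? /=; rewrite /flip_term /= ?(mul0r, mulr0, addr0, add0r, mul1r); ring.
Qed.

Definition gram_mx r' M : 'M[C]_4 :=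
  \matrix_(i < 4, j < 4) row_gram r' M (r' + i)%N (r' + j)%N.

Lemma holds_xcell st r' M l j : holds r' M st -> (4 <= r')%N ->
  (l < 4)%N -> (j < 4)%N -> cell st 0%N (reg st 0%N + l)%N j = M (r' + l)%N j.
Proof.
move=> [-> h] r4 hl hj; apply: h; last exact: leq_trans r4.
by rewrite ltn_add2l ltnW.
Qed.

Lemma wp_spectrum st r' M : holds r' M st -> (4 <= r')%N -> lower_rows r' M ->
  wp Spectrum st (fun T st' => [/\ (T <= 58)%N,
    let m i := cell st' 6%N 0%N i in m 0%N = 0 /\
    char_poly (flip_gram (gram_mx r' M)) =
      ('X - (m 1%N)%:P) * ('X - (m 2%N)%:P) * ('X - (m 3%N)%:P) * ('X - (m 4%N)%:P) &
    frame [::] [:: 3%N; 6%N; 9%N; 10%N] st st']).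
Proof.
move=> hM r4 hz.
apply: wp_seq; apply: wp_conseq (@wp_fill_mat R st 3 gramE isT) _ => _ st1 [-> m3 f1].
have G3 : mat st1 3 = gram_mx r' M.
  rewrite m3; apply/matrixP => i j; rewrite !mxE /row_gram /=.
  rewrite !(holds_xcell hM r4)//.
  rewrite (@big_cat_nat _ _ _ 4)//= [X in _ = _ + X]big_nat_cond [X in _ = _ + X]big1 ?addr0.
    by rewrite !big_nat_recl//= big_geq// addr0 !addrA.
  by move=> l /andP[hl _]; rewrite hz// mul0r.
apply: wp_seq; apply: wp_conseq (@wp_fill_mat R st1 10 flipE isT) _ => _ st2 [-> m10 f2].
have N10 : mat st2 10 = flip_gram (gram_mx r' M) by rewrite m10; apply: mat_flip.
apply: wp_seq; apply: wp_cset => a0 /= a0E.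
apply: wp_seq; apply: wp_cset => a1 /= a1E.
apply: wp_seq; apply: wp_cset => a2 /= a2E.
apply: wp_seq; apply: wp_cset => a3 /= a3E.
apply: wp_conseq (wp_quartic_roots _) _ => t st3 /= [ht [x0 x1 x2 x3 x4] f3].
split.
- by lia.
- split => //; rewrite -N10 /mat; apply: char_poly_ord4.
  + by rewrite -x1 a0E opprK.
  + by rewrite -x2 a1E.
  + by rewrite -x3 a2E opprK.
  + by rewrite -x4 a3E.
- apply: (frame_trans _ (frame_sub _ _ f3)) => //.
  do 4!apply: frame_set_cell => //.
  by apply: (frame_trans (frame_sub _ _ f1) (frame_sub _ _ f2)).
Qed.

End SpectrumCorrect.

(** * Takagi factorization *)

Section Deflation.
Variable C : numClosedFieldType.
Implicit Types M : nat -> nat -> C.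

Definition ampcol r' M j : nat -> C := fun i => M (r' + i)%N j.
Definition tauM r' M j l : C := tau (ampcol r' M j) (ampcol r' M l).
Definition offdiag r' k M :=
  forall j l, (j < k)%N -> (l < 4)%N -> l != j -> tauM r' M j l = 0.

Lemma tauZl a (x y : nat -> C) : tau (fun i => a * x i) y = a * tau x y.
Proof. by rewrite /tau; ring. Qed.

(** The scratch row rho is the conjugate of a con-eigenvector z, and Xz is the combination of the
    columns with coefficients z. The con-eigenvector equation reads tau (Xz, column l) = nu rho_l,
    which is linear in the column and so survives the mixing. After clearing, Xz is a nonzero
    multiple of column k and rho vanishes beyond k, so column k is decoupled from the later ones. *)
Lemma clear_offdiag r' k M1 M2 (z : nat -> C) nu : (k < 4)%N ->
  offdiag r' k M1 -> colstep k 4 M1 M2 ->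
  (forall l, (l < 4)%N -> M1 (r' + 4)%N l = (z l)^*) ->
  (forall l, (l < k)%N -> z l = 0) ->
  (forall l, (l < 4)%N -> \sum_(j < 4) z j * tauM r' M1 j l = nu * (z l)^*) ->
  (exists2 l, (l < 4)%N & z l != 0) ->
  (forall l, (k < l < 4)%N -> M2 (r' + 4)%N l = 0) -> offdiag r' k.+1 M2.
Proof.
move=> k4 hoff [hg ho hf] hrho hsup hcon [l0 l04 zl0] hclear.
pose Xz i := \sum_(j < 4) z j * ampcol r' M1 j i.
pose n := M2 (r' + 4)%N k.
(* Inner products with the scratch row are preserved, and only its entry at k survives the
   clearing. *)
have locrho i : \sum_(k <= j < 4) M1 i j * (M1 (r' + 4)%N j)^* = M2 i k * n^*.
  rewrite -hg big_ltn// [X in _ + X]big_nat_cond big1 ?addr0// => l /andP[hl _].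
  by rewrite hclear// conjC0 mulr0.
have XzE i : Xz i = n^* * ampcol r' M2 k i.
  rewrite /ampcol mulrC -locrho /Xz -(big_mkord xpredT (fun j => z j * ampcol r' M1 j i)).
  rewrite (@big_cat_nat _ _ _ k)//= ?(ltnW k4)// big_nat_cond big1 ?add0r.
    by apply: eq_big_nat => l /andP[_ l4]; rewrite hrho// conjCK mulrC.
  by move=> l /andP[hl _]; rewrite hsup ?mul0r.
(* The clearing preserves the norm of the scratch row on the window, and z is nonzero there. *)
have n0 : n != 0.
  have kl0 : (k <= l0)%N by rewrite leqNgt; apply: contraNN zl0 => /hsup ->.
  have e := locrho (r' + 4)%N; rewrite -/n in e.
  apply: contraNneq zl0 => nz; move: e; rewrite nz mul0r => /eqP.
  rewrite big_nat_cond psumr_eq0; last by move=> l _; rewrite -normCK exprn_ge0.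
  move=> /allP/(_ l0); rewrite mem_index_iota kl0 l04 => /(_ isT) /=.
  by rewrite hrho// mulf_eq0 conjC_eq0 conjCK orbb.
have offd j l : (j < k)%N -> (l < 4)%N -> l != j -> tauM r' M2 j l = 0.
  move=> jk l4 lj.
  have e1 : ampcol r' M2 j = ampcol r' M1 j.
    by apply/funext => i; rewrite /ampcol ho// negb_and -ltnNge jk.
  have [lk|kl] := ltnP l k.
    have e2 : ampcol r' M2 l = ampcol r' M1 l.
      by apply/funext => i; rewrite /ampcol ho// negb_and -ltnNge lk.
    by rewrite /tauM e1 e2 -/(tauM r' M1 j l) hoff.
  rewrite /tauM e1; apply: (hf (fun u => tau (ampcol r' M1 j) (fun i => u (r' + i)%N))).
  - by move=> a b u v; rewrite /tau; ring.
  - move=> l' /andP[kl' l'4]; apply: hoff => //.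
    by rewrite gtn_eqF// (leq_trans jk).
  - by rewrite kl l4.
move=> j l; rewrite ltnS leq_eqVlt => /predU1P[->|jk] l4 lj; last exact: offd.
have [lk|kl] := ltnP l k.
  by rewrite /tauM tauC -/(tauM r' M2 l k) offd// eq_sym.
have kl' : (k < l)%N by rewrite ltn_neqAle eq_sym lj.
(* A linear functional of the column, scratch entry included, that is zero on all old columns of the
   window. *)
have : tau Xz (ampcol r' M2 l) - nu * M2 (r' + 4)%N l = 0.
  apply: (hf (fun u => tau Xz (fun i => u (r' + i)%N) - nu * u (r' + 4)%N)).
  - by move=> a b u v; rewrite /tau; ring.
  - move=> l' /andP[_ l'4]; apply/eqP; rewrite subr_eq0; apply/eqP.
    by rewrite (tau_suml (fun j : 'I_4 => z j)) hrho// -hcon.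
  - by rewrite ltnW.
rewrite hclear ?kl'// mulr0 subr0.
have -> : Xz = fun i => n^* * ampcol r' M2 k i by apply/funext => i.
by rewrite tauZl => /eqP; rewrite mulf_eq0 conjC_eq0 (negbTE n0) => /eqP.
Qed.

End Deflation.

Definition tauE (j k : nat) : cexp :=
  (xcell 0 j * xcell 3 k + xcell 3 j * xcell 0 k - xcell 1 j * xcell 2 k
   - xcell 2 j * xcell 1 k)%CE.

Definition sum4E (f : nat -> cexp) : cexp := (f 0 + f 1 + f 2 + f 3)%CE.

Definition antilinE (x j : nat) : cexp :=
  CConj (sum4E (fun l => cell0 3 j l * cell0 x 0 l)%CE).

Definition sqnormE (x : nat) : cexp :=
  sum4E (fun j => cell0 x 0 j * CConj (cell0 x 0 j))%CE.

Definition UpdateZ : cmd :=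
  If (BAnd (BAnd (ceq0 (cell0 7 0 0)) (ceq0 (cell0 7 0 1)))
           (BAnd (ceq0 (cell0 7 0 2)) (ceq0 (cell0 7 0 3))))
     Skip (FillRow 4 0 (fun j => cell0 7 0 j)).

(** The matrix is applied as the square of the antilinear map, through array 5, and is never
    formed. *)
Definition KrylovStep (m : nat) : cmd :=
  FillRow 5 0 (antilinE 4) ;;
  FillRow 7 0 (fun j => antilinE 5 j - cell0 6 0 m * cell0 4 0 j)%CE ;; UpdateZ.

Definition ConeigStep : cmd :=
  FillRow 5 0 (antilinE 4) ;;
  FillRow 7 0 (fun j => cell0 5 0 j + CRoot 2 (sqnormE 5 / sqnormE 4) * cell0 4 0 j)%CE ;;
  UpdateZ.

Definition SetRho (j : nat) : cmd :=
  CSet 0 (IAdd (IReg 0) (INat 4)) (INat j) (CConj (cell0 4 0 j)).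

(* The adjoint of a con-eigenvector of the Takagi matrix is put in the scratch row;
   clearing that row against column [k] decouples column [k] from the later ones. *)
Definition Deflate (k : nat) : cmd :=
  FillMatrix 3 tauE ;; FillRow 4 0 (fun j => CNat (j == k)) ;;
  KrylovStep 0 ;; KrylovStep 1 ;; KrylovStep 2 ;; KrylovStep 3 ;; KrylovStep 4 ;;
  ConeigStep ;; SetRho 0 ;; SetRho 1 ;; SetRho 2 ;; SetRho 3 ;;
  ISet 2 (INat k) ;; ISet 4 (IAdd (IReg 0) (INat 4)) ;; ISet 6 (INat 4) ;; ClearRow.

(** By symmetry of [tau], decoupling three columns decouples the fourth. *)
Definition Takagi : cmd := Deflate 0 ;; Deflate 1 ;; Deflate 2.

Section DeflateCorrect.
Variable R : realType.
Local Notation C := R[i].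
Implicit Types (st : store R) (M : nat -> nat -> C).

Lemma vec_frame rs xs st st' x i : frame rs xs st st' -> x \notin xs ->
  vec st' x i = vec st x i.
Proof. by move=> [_ hc] hx; apply/matrixP => j k; rewrite !mxE hc. Qed.

Lemma mat_frame rs xs st st' x : frame rs xs st st' -> x \notin xs ->
  mat st' x = mat st x.
Proof. by move=> [_ hc] hx; apply/matrixP => j k; rewrite !mxE hc. Qed.

Lemma sum_ord4 (F : nat -> C) : \sum_(j < 4) F j = F 0%N + F 1%N + F 2%N + F 3%N.
Proof. by rewrite !big_ord_recr big_ord0 /= add0r. Qed.

Lemma antilinE_vec st x : \col_(j < 4) ceval st (antilinE x j) =
  antilin (mat st 3) (vec st x 0).
Proof.
apply/matrixP => j k; rewrite !mxE /=; congr Num.conj.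
by rewrite -(sum_ord4 (fun l => cell st 3%N j l * cell st x 0%N l));
  apply: eq_bigr => l _; rewrite !mxE.
Qed.

Lemma sqnormE_vec st x : ceval st (sqnormE x) = sqnorm_cV (vec st x 0).
Proof.
rewrite /= -(sum_ord4 (fun l => cell st x 0%N l * (cell st x 0%N l)^*)).
by apply: eq_bigr => l _; rewrite !mxE normCK.
Qed.

Lemma wp_update_z st : wp UpdateZ st (fun T st' => [/\ (T <= 5)%N,
  vec st' 4 0 = (if vec st 7 0 == 0 then vec st 4 0 else vec st 7 0) &
  frame [::] [:: 4%N] st st']).
Proof.
have test : beval st (BAnd (BAnd (ceq0 (cell0 7 0 0)) (ceq0 (cell0 7 0 1)))
           (BAnd (ceq0 (cell0 7 0 2)) (ceq0 (cell0 7 0 3)))) = (vec st 7 0 == 0).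
  have -> : beval st (BAnd (BAnd (ceq0 (cell0 7 0 0)) (ceq0 (cell0 7 0 1)))
      (BAnd (ceq0 (cell0 7 0 2)) (ceq0 (cell0 7 0 3)))) =
    (beval st (ceq0 (cell0 7 0 0)) && beval st (ceq0 (cell0 7 0 1))) &&
    (beval st (ceq0 (cell0 7 0 2)) && beval st (ceq0 (cell0 7 0 3))) by [].
  rewrite !beval_ceq0 /=; apply/idP/eqP.
    move=> /andP[/andP[/eqP h0 /eqP h1] /andP[/eqP h2 /eqP h3]].
    by apply/matrixP => -[[|[|[|[|//]]]] hi] j; rewrite !mxE.
  move=> /matrixP h.
  have e j : (j < 4)%N -> cell st 7%N 0%N j == 0.
    by move=> hj; have := h (Ordinal hj) 0; rewrite !mxE => /= ->.
  by rewrite !e.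
apply: wp_if; rewrite test => h.
  by apply: wp_skip; rewrite h; split.
rewrite (negbTE h).
apply: wp_conseq (@wp_fill_vec R st 4 0 (fun j => cell0 7 0 j) isT) _ => T st' [-> hv fr].
split => //; rewrite hv; apply/matrixP => i j; by rewrite !mxE.
Qed.

Lemma wp_krylov_step st m (t := mat st 3) (z := vec st 4 0) :
  wp (KrylovStep m) st (fun T st' => [/\ (T <= 13)%N,
    vec st' 4 0 = kstep (map_mx Num.conj t *m t) z (cell st 6%N 0%N m) &
    frame [::] [:: 4%N; 5%N; 7%N] st st']).
Proof.
apply: wp_seq; apply: wp_conseq (@wp_fill_vec R st 5 0 (antilinE 4) isT) _.
move=> _ st1 [-> v5 f1]; rewrite antilinE_vec in v5.
apply: wp_seq; apply: wp_conseq (@wp_fill_vec R st1 7 0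
  (fun j => antilinE 5 j - cell0 6 0 m * cell0 4 0 j)%CE isT) _.
move=> _ st2 [-> v7 f2].
apply: wp_conseq (wp_update_z st2) _ => T st3 [hT v4 f3]; split.
- by lia.
- have e7 : vec st2 7 0 = shift_apply (map_mx Num.conj t *m t) z (cell st 6%N 0%N m).
    rewrite v7 /shift_apply -antilin2 -v5 /t /z -(mat_frame f1)// -antilinE_vec.
    apply/matrixP => i j; rewrite !mxE [in LHS]/=; congr (_ - _ * _).
      by rewrite (proj2 f1).
    by rewrite (proj2 f1).
  by rewrite v4 e7 (vec_frame _ f2)// (vec_frame _ f1).
- by apply: (frame_trans (frame_sub _ _ f1) (frame_trans (frame_sub _ _ f2) (frame_sub _ _ f3))).
Qed.

Lemma wp_coneig_step st (t := mat st 3) (z := vec st 4 0) :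
  wp ConeigStep st (fun T st' => [/\ (T <= 13)%N,
    vec st' 4 0 = coneig_step t z & frame [::] [:: 4%N; 5%N; 7%N] st st']).
Proof.
apply: wp_seq; apply: wp_conseq (@wp_fill_vec R st 5 0 (antilinE 4) isT) _.
move=> _ st1 [-> v5 f1]; rewrite antilinE_vec in v5.
apply: wp_seq; apply: wp_conseq (@wp_fill_vec R st1 7 0
  (fun j => cell0 5 0 j + CRoot 2 (sqnormE 5 / sqnormE 4) * cell0 4 0 j)%CE isT) _.
move=> _ st2 [-> v7 f2].
apply: wp_conseq (wp_update_z st2) _ => T st3 [hT v4 f3]; split.
- by lia.
- have e7 : vec st2 7 0 = antilin t z + sqrtC (sqnorm_cV (antilin t z) / sqnorm_cV z) *: z.
    rewrite v7 -v5 /z -(vec_frame 0 f1 (isT : 4%N \notin [:: 5%N])).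
    apply/matrixP => i j; rewrite !mxE -!sqnormE_vec.
    by [].
  by rewrite v4 e7 (vec_frame _ f2)// (vec_frame _ f1).
- by apply: (frame_trans (frame_sub _ _ f1) (frame_trans (frame_sub _ _ f2) (frame_sub _ _ f3))).
Qed.

End DeflateCorrect.

Section TakagiCorrect.
Variable R : realType.
Local Notation C := R[i].
Implicit Types (st : store R) (M : nat -> nat -> C).

Definition xmat r' M : 'M[C]_4 := \matrix_(l < 4, j < 4) M (r' + l)%N j.

Lemma tau_mx_xmat r' M : \matrix_(j < 4, l < 4) tauM r' M j l =
  (xmat r' M)^T *m flipJ R *m xmat r' M.
Proof.
apply/matrixP => j l; rewrite mxE /tauM tau_flipJ.
have c1 (i : 'I_4) : (\col_(i0 < 4) ampcol r' M i i0) = col i (xmat r' M).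
  by apply/matrixP => a b; rewrite !mxE.
rewrite !c1 tr_col -row_mul [LHS]mxE [RHS]mxE.
by apply: eq_bigr => a _; rewrite [row _ _ _ _]mxE [col _ _ _ _]mxE.
Qed.

Lemma gram_mx_xmat r' M : (4 <= r')%N -> lower_rows r' M ->
  gram_mx r' M = xmat r' M *m (xmat r' M)^t*.
Proof.
move=> r4 hz; apply/matrixP => i j; rewrite !mxE /row_gram.
rewrite (@big_cat_nat _ _ _ 4)//= [X in _ + X = _]big_nat_cond [X in _ + X = _]big1 ?addr0.
  by rewrite big_mkord; apply: eq_bigr => l _; rewrite !mxE.
by move=> l /andP[hl _]; rewrite hz// mul0r.
Qed.

Definition spectrum_of st (G : 'M[C]_4) : Prop :=
  let m i := cell st 6%N 0%N i in m 0%N = 0 /\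
  char_poly (flip_gram G) =
    ('X - (m 1%N)%:P) * ('X - (m 2%N)%:P) * ('X - (m 3%N)%:P) * ('X - (m 4%N)%:P).

Definition deflate_frame := frame (R := R) [:: 2%N; 3%N; 4%N; 5%N; 6%N]
  [:: 0%N; 1%N; 2%N; 3%N; 4%N; 5%N; 7%N].

Lemma wp_deflate st r' M k : holds r' M st -> (4 <= r')%N -> (k < 4)%N ->
  lower_rows r' M -> offdiag r' k M -> spectrum_of st (gram_mx r' M) ->
  wp (Deflate k) st (fun T st' => (T <= clear_time r' + 110)%N /\
    exists M', [/\ holds r' M' st',
      forall i i', (i < r' + 4)%N -> (i' < r' + 4)%N ->
        row_gram r' M' i i' = row_gram r' M i i',
      lower_rows r' M', offdiag r' k.+1 M' & deflate_frame st st']).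
Proof.
move=> hM r4 k4 hz hoff [m0 chN].
apply: wp_seq; apply: wp_conseq (@wp_fill_mat R st 3 tauE isT) _ => _ st1 [-> m3 f1].
set X := xmat r' M.
have tE : mat st1 3 = X^T *m flipJ R *m X.
  rewrite m3 -tau_mx_xmat; apply/matrixP => i j; rewrite !mxE /=.
  by rewrite !(holds_xcell hM r4).
set t := X^T *m flipJ R *m X in tE.
have st_ : t^T = t by rewrite /t !trmx_mul trmxK flipJ_tr mulmxA.
apply: wp_seq; apply: wp_conseq (@wp_fill_vec R st1 4 0 (fun j => CNat (j == k)) isT) _.
move=> _ st2 [-> v4 f2]; set e0 : 'cV[C]_4 := \col_j _ in v4.
apply: wp_seq; apply: wp_conseq (wp_krylov_step st2 0) _ => T3 st3 [hT3 z3 f3].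
apply: wp_seq; apply: wp_conseq (wp_krylov_step st3 1) _ => T4 st4 [hT4 z4 f4].
apply: wp_seq; apply: wp_conseq (wp_krylov_step st4 2) _ => T5 st5 [hT5 z5 f5].
apply: wp_seq; apply: wp_conseq (wp_krylov_step st5 3) _ => T6 st6 [hT6 z6 f6].
apply: wp_seq; apply: wp_conseq (wp_krylov_step st6 4) _ => T7 st7 [hT7 z7 f7].
apply: wp_seq; apply: wp_conseq (wp_coneig_step st7) _ => T8 st8 [hT8 z8 f8].
have F2 : frame [::] [:: 3%N; 4%N; 5%N; 7%N] st st2.
  by apply: (frame_trans (frame_sub _ _ f1) (frame_sub _ _ f2)).
have F3 : frame [::] [:: 3%N; 4%N; 5%N; 7%N] st st3 by apply: (frame_trans F2 (frame_sub _ _ f3)).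
have F4 : frame [::] [:: 3%N; 4%N; 5%N; 7%N] st st4 by apply: (frame_trans F3 (frame_sub _ _ f4)).
have F5 : frame [::] [:: 3%N; 4%N; 5%N; 7%N] st st5 by apply: (frame_trans F4 (frame_sub _ _ f5)).
have F6 : frame [::] [:: 3%N; 4%N; 5%N; 7%N] st st6 by apply: (frame_trans F5 (frame_sub _ _ f6)).
have F7 : frame [::] [:: 3%N; 4%N; 5%N; 7%N] st st7 by apply: (frame_trans F6 (frame_sub _ _ f7)).
have F8 : frame [::] [:: 3%N; 4%N; 5%N; 7%N] st st8 by apply: (frame_trans F7 (frame_sub _ _ f8)).
have t2 : mat st2 3 = t by rewrite (mat_frame f2).
have t3 : mat st3 3 = t by rewrite (mat_frame f3).
have t4 : mat st4 3 = t by rewrite (mat_frame f4).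
have t5 : mat st5 3 = t by rewrite (mat_frame f5).
have t6 : mat st6 3 = t by rewrite (mat_frame f6).
have t7 : mat st7 3 = t by rewrite (mat_frame f7).
set H := map_mx Num.conj t *m t.
pose mu i := cell st 6%N 0%N i.
have muE sti i : frame [::] [:: 3%N; 4%N; 5%N; 7%N] st sti ->
    cell sti 6%N 0%N i = mu i by move=> [_ h]; rewrite h.
have zE : vec st7 4 0 = foldl (kstep H) e0 [:: 0; mu 1%N; mu 2%N; mu 3%N; mu 4%N].
  rewrite z7 z6 z5 z4 z3 t2 t3 t4 t5 t6 v4.
  have mu0 : mu 0%N = 0 by exact: m0.
  rewrite (muE _ 4%N F6) (muE _ 3%N F5) (muE _ 2%N F4) (muE _ 1%N F3) (muE _ 0%N F2) mu0.
  exact: erefl.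
have e00 : e0 != 0.
  apply/eqP => /matrixP/(_ (Ordinal k4) 0); rewrite !mxE /= eqxx => /eqP.
  by rewrite oner_eq0.
(* The amplitudes beyond column 3 are zero, so the Gram matrix of the full rows is that of the 4 x 4
   block [X]. *)
have ann : foldl (shift_apply H) e0 [:: 0; mu 1%N; mu 2%N; mu 3%N; mu 4%N] = 0.
  apply: foldl_shift_gram; [exact: flipJ_adj | exact: flipJ_tr |].
  by rewrite -chN gram_mx_xmat.
have [z7n [la z7H]] := kstep_foldl e00 ann.
rewrite -zE in z7n z7H.
have [z8n [nu z8t]] := coneig_stepP st_ z7n z7H.
rewrite t7 in z8; rewrite -z8 in z8n z8t.
(* The first k columns are decoupled, so [t] preserves this subspace; starting from the basis vector
   at k, the iteration never disturbs earlier work. *)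
pose supp (y : 'cV[C]_4) := forall j : 'I_4, (j < k)%N -> y j 0 = 0.
have suppt y : supp y -> supp (antilin t y).
  move=> hy j jk; rewrite !mxE big1 ?conjC0// => l _.
  have [->|lj] := eqVneq l j; first by rewrite hy ?mulr0.
  by rewrite /t -tau_mx_xmat mxE hoff ?mul0r.
have suppL a (x y : 'cV[C]_4) : supp x -> supp y -> supp (x + a *: y).
  by move=> hx hy j jk; rewrite !mxE hx// hy// mulr0 addr0.
have supp0 : supp e0 by move=> j jk; rewrite mxE /= ltn_eqF.
have supp7 : supp (vec st7 4 0).
  rewrite zE; apply: (@kstep_closed C 4 supp H e0); [move=> y hy | exact: suppL | exact: supp0].
  by rewrite /H -antilin2; apply/suppt/suppt.
have supp8 : supp (vec st8 4 0).
  rewrite z8 /coneig_step; case: eqP => // _.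
  by apply: suppL => //; apply: suppt.
pose z l := cell st8 4%N 0%N l.
have r0 : reg st8 0%N = r' by rewrite (proj1 F8)// (proj1 hM).
(* Only the scratch row differs from [M], so the Gram matrix of the other rows is unaffected. *)
pose M1 (i l : nat) : C := if (i == (r' + 4)%N) && (l < 4)%N then (z l)^* else M i l.
have h8 : holds r' M st8 := holds_frame F8 isT isT hM.
apply: wp_seq; apply: wp_cset => _ /= ->; rewrite r0.
apply: wp_seq; apply: wp_cset => _ /= ->; rewrite r0.
apply: wp_seq; apply: wp_cset => _ /= ->; rewrite r0.
apply: wp_seq; apply: wp_cset => _ /= ->; rewrite r0.
apply: wp_seq; apply: wp_iset.
apply: wp_seq; apply: wp_iset; rewrite /= r0.
apply: wp_seq; apply: wp_iset; rewrite /=.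
set st9 := set_reg _ 6 4.
have F9 : frame [:: 2%N; 4%N; 6%N] [:: 0%N] st8 st9.
  do 3!apply: frame_set_reg => //; do 4!apply: frame_set_cell => //; exact: agree_refl.
have h9 : holds r' M1 st9.
  split; first exact: r0.
  move=> i l hi hl; rewrite /M1 /= -/(z 0%N) -/(z 1%N) -/(z 2%N) -/(z 3%N).
  case: eqP => [->|ni] /=; last exact: (proj2 h8).
  case: l hl => [|[|[|[|l]]]] hl //=.
  by rewrite (proj2 h8)// ltn_add2l.
have rr : (r' + 4 < r' + 5)%N by rewrite ltn_add2l.
apply: wp_conseq (wp_clear_row h9 (erefl k) (erefl (r' + 4)%N) (erefl 4) k4 r4 rr) _.
move=> T10 st10 [hT10 [M2 [h10 cs hcl f10]]]; split; first by lia.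
have M1row i l : (i < r' + 4)%N -> M1 i l = M i l by move=> hi; rewrite /M1 ltn_eqF.
exists M2; split => //.
- move=> i i' hi hi'; rewrite /row_gram (colstep_widen _ _ _ cs) ?(ltnW k4)//.
  by apply: eq_bigr => l _; rewrite !M1row.
- move=> l j l4 /andP[j4 jr]; have [_ o _] := cs.
  rewrite o ?M1row ?hz ?j4 ?ltn_add2l//.
  by rewrite negb_and -[(j < 4)%N]negbK -leqNgt j4 orbT.
- have tM1 j l : tauM r' M1 j l = tauM r' M j l.
    by rewrite /tauM /tau /ampcol !M1row// ltn_add2l.
  apply: (@clear_offdiag _ r' k M1 M2 z nu) => //.
  + by move=> j l jk l4 lj; rewrite tM1 hoff.
  + by move=> l l4; rewrite /M1 eqxx l4.
  + move=> l lk; have l4 : (l < 4)%N by apply: ltn_trans lk k4.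
    by have := supp8 (Ordinal l4) lk; rewrite mxE.
  + move=> l l4; have tjl (j : 'I_4) : t (Ordinal l4) j = tauM r' M1 j l.
      by rewrite tM1 /t -tau_mx_xmat mxE /tauM tauC.
    have /matrixP/(_ (Ordinal l4) 0) := z8t; rewrite [LHS]mxE => e.
    transitivity (\sum_j t (Ordinal l4) j * vec st8 4 0 j 0).
      by apply: eq_bigr => j _; rewrite tjl mxE mulrC.
    by rewrite e [LHS]mxE; congr (_ * _); rewrite !mxE.
  + have [[l hl] zl] : exists l : 'I_4, z l != 0.
      apply/existsP; apply: contraNT z8n; rewrite negb_exists => /forallP h.
      by apply/eqP/matrixP => l j; rewrite !mxE; apply/eqP; have := h l; rewrite negbK.
    by exists l.
- apply: (frame_trans (frame_sub _ _ F8) _) => //.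
  by apply: (frame_trans (frame_sub _ _ F9) (frame_sub _ _ f10)).
Qed.

End TakagiCorrect.

(** * Equalizing the concurrences *)

Section FinalMixing.
Variable C : numClosedFieldType.
Implicit Types (M : nat -> nat -> C) (lam : nat -> C).

Lemma ampcol_mixcol r' M j k (a b c d : C) x :
  ampcol r' (mixcol M j k a b c d) x =
  if x == j then fun i => a * ampcol r' M j i + b * ampcol r' M k i
  else if x == k then fun i => c * ampcol r' M j i + d * ampcol r' M k i
  else ampcol r' M x.
Proof. by apply/funext => i; rewrite /ampcol /mixcol; case: eqP => // _; case: eqP. Qed.

Lemma tauM_sym r' M x y : tauM r' M x y = tauM r' M y x.
Proof. exact: tauC. Qed.

Definition scol (k : nat) (a : C) (x : nat) : C := if x == k then a else 1.

Lemma tauM_scale r' M k o (a : C) x y : k != o ->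
  tauM r' (mixcol M k o a 0 0 1) x y = scol k a x * scol k a y * tauM r' M x y.
Proof.
move=> ko; rewrite /tauM !ampcol_mixcol /scol.
have [->|xk] := eqVneq x k; have [->|yk] := eqVneq y k.
- by rewrite /tau; ring.
- by have [->|yo] := eqVneq y o; rewrite /tau; ring.
- by have [->|xo] := eqVneq x o; rewrite /tau; ring.
- by have [->|xo] := eqVneq x o; have [->|yo] := eqVneq y o; rewrite /tau; ring.
Qed.

Definition swapn (j k x : nat) : nat := if x == j then k else if x == k then j else x.

Lemma tauM_swap r' M j k x y :
  tauM r' (mixcol M j k 0 1 1 0) x y = tauM r' M (swapn j k x) (swapn j k y).
Proof.
rewrite /tauM !ampcol_mixcol /swapn.
by have [xj|xj] := eqVneq x j; have [yj|yj] := eqVneq y j;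
   have [xk|xk] := eqVneq x k; have [yk|yk] := eqVneq y k; rewrite /tau; ring.
Qed.

Lemma tauM_jj r' M j k (a b c d : C) :
  tauM r' (mixcol M j k a b c d) j j =
  a ^+ 2 * tauM r' M j j + 2 * a * b * tauM r' M j k + b ^+ 2 * tauM r' M k k.
Proof. by rewrite /tauM !ampcol_mixcol eqxx /tau; ring. Qed.

Lemma tauM_kk r' M j k (a b c d : C) : j != k ->
  tauM r' (mixcol M j k a b c d) k k =
  c ^+ 2 * tauM r' M j j + 2 * c * d * tauM r' M j k + d ^+ 2 * tauM r' M k k.
Proof.
by move=> jk; rewrite /tauM !ampcol_mixcol eqxx eq_sym (negbTE jk) /tau; ring.
Qed.

Lemma tauM_xk r' M j k (a b c d : C) x : j != k -> x != j -> x != k ->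
  tauM r' (mixcol M j k a b c d) x k = c * tauM r' M x j + d * tauM r' M x k.
Proof.
move=> jk /negbTE xj /negbTE xk.
by rewrite /tauM !ampcol_mixcol xj xk eqxx eq_sym (negbTE jk) /tau; ring.
Qed.

Lemma tauM_xj r' M j k (a b c d : C) x : x != j -> x != k ->
  tauM r' (mixcol M j k a b c d) x j = a * tauM r' M x j + b * tauM r' M x k.
Proof.
by move=> /negbTE xj /negbTE xk; rewrite /tauM !ampcol_mixcol xj xk eqxx /tau; ring.
Qed.

Lemma tauM_out r' M j k (a b c d : C) x y : x != j -> x != k -> y != j -> y != k ->
  tauM r' (mixcol M j k a b c d) x y = tauM r' M x y.
Proof.
by move=> /negbTE xj /negbTE xk /negbTE yj /negbTE yk;
  rewrite /tauM !ampcol_mixcol xj xk yj yk.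
Qed.

Definition tau_diagonal r' M lam :=
  forall x y, (x < 4)%N -> (y < 4)%N -> tauM r' M x y = if x == y then lam x else 0.

Lemma tau_diagonal_scale r' M lam k o (a : C) : k != o -> tau_diagonal r' M lam ->
  tau_diagonal r' (mixcol M k o a 0 0 1) (fun x => scol k a x ^+ 2 * lam x).
Proof.
move=> ko hd x y x4 y4; rewrite tauM_scale// hd//.
by case: eqP => [->|_]; [rewrite expr2|rewrite mulr0].
Qed.

Lemma swapnK j k : involutive (swapn j k).
Proof.
move=> x; rewrite /swapn; case: (eqVneq x j) => [->|xj].
  by case: (eqVneq k j) => [->//|_]; rewrite eqxx.
case: (eqVneq x k) => [->|xk]; first by rewrite eqxx.
by rewrite (negbTE xj) (negbTE xk).
Qed.

Lemma tau_diagonal_swap r' M lam j k : (j < 4)%N -> (k < 4)%N -> tau_diagonal r' M lam ->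
  tau_diagonal r' (mixcol M j k 0 1 1 0) (fun x => lam (swapn j k x)).
Proof.
have s4 x : (j < 4)%N -> (k < 4)%N -> (x < 4)%N -> (swapn j k x < 4)%N.
  by move=> j4 k4 x4; rewrite /swapn; case: ifP => // _; case: ifP.
move=> j4 k4 hd x y x4 y4; rewrite tauM_swap hd ?s4//.
by rewrite (can_eq (swapnK j k)).
Qed.

Lemma unitary2_scale (a : C) : a * a^* = 1 -> unitary2 a 0 0 1.
Proof. by move=> h; split; rewrite ?h ?conjC0 ?conjC1; ring. Qed.

Lemma unitary2_swap : unitary2 (0 : C) 1 1 0.
Proof. by split; rewrite ?conjC0 ?conjC1; ring. Qed.

Lemma unitary2_real (c s : C) : c \is Num.real -> s \is Num.real ->
  c ^+ 2 + s ^+ 2 = 1 -> unitary2 c s (- s) c.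
Proof.
move=> cr sr h; have cc := conj_Creal cr; have ss := conj_Creal sr.
have ns : (- s)^* = - s by rewrite rmorphN /= ss.
by split; rewrite ?ns ?cc ?ss; [rewrite -h| rewrite -h |]; ring.
Qed.

Lemma unitary2_hadamard (h : C) : h \is Num.real -> h ^+ 2 = 1 / 2 -> unitary2 h h h (- h).
Proof.
move=> hr h2; have e : h * h + h * h = 1 by rewrite -expr2 h2; field.
have hh := conj_Creal hr; have nh : (- h)^* = - h by rewrite rmorphN /= hh.
by split; rewrite ?nh ?hh; [rewrite -e| rewrite -e |]; ring.
Qed.

Lemma sqrt_phase (z : C) : z * z^* = 1 -> sqrtC z * (sqrtC z)^* = 1.
Proof.
rewrite -!normCK => h; have : `|z| = 1.
  by apply/eqP; rewrite -(@eqrXn2 _ 2)// ?h ?expr1n.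
by rewrite -{1}(sqrtCK z) normrX.
Qed.

(** [tau] is bilinear, so a phase a on a column multiplies its diagonal value by a^2; hence the
    outer square root. *)
Lemma norm_phase (q : C) : q != 0 ->
  let a := sqrtC (q^* / sqrtC (q * q^*)) in a * a^* = 1 /\ a ^+ 2 * q = `|q|.
Proof.
move=> q0; have -> : sqrtC (q * q^*) = `|q| by rewrite -normCK exprCK.
have n0 : `|q| != 0 by rewrite normr_eq0.
move=> a; split.
  apply: sqrt_phase; rewrite -normCK normrM normfV norm_conjC normr_id divff//.
  by rewrite expr1n.
by rewrite sqrtCK mulrAC -[q^* * q]mulrC -normCK expr2 mulfK.
Qed.

(* The tangent [t] of the rotation angle is a root of [p + 2 q t + w t ^+ 2]. *)
Lemma jacobi_angle (p q w t c : C) :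
  p \is Num.real -> q \is Num.real -> w \is Num.real -> ~~ (0 <= p * w) ->
  t = (- q + sqrtC (q * q - p * w)) / w -> c = 1 / sqrtC (1 + t * t) ->
  [/\ c \is Num.real, t * c \is Num.real, c ^+ 2 + (t * c) ^+ 2 = 1 &
      c ^+ 2 * p + 2 * c * (t * c) * q + (t * c) ^+ 2 * w = 0].
Proof.
move=> pr qr wr pw tE cE.
have pwr : p * w \is Num.real by rewrite realM.
have pw0 : p * w < 0 by rewrite real_ltNge// real0.
have w0 : w != 0 by apply: contraTneq pw0 => ->; rewrite mulr0 ltxx.
have q2 : 0 <= q * q by rewrite -expr2 real_exprn_even_ge0.
have d0 : 0 <= q * q - p * w by rewrite subr_ge0 (le_trans (ltW pw0)).
set r := sqrtC (q * q - p * w) in tE.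
have rr : r \is Num.real by rewrite ger0_real// sqrtC_ge0.
have r2 : r ^+ 2 = q * q - p * w by rewrite sqrtCK.
have tr : t \is Num.real by rewrite tE realM ?realV ?realD ?realN.
have t2 : 0 < 1 + t * t by rewrite ltr_pwDl// -expr2 real_exprn_even_ge0.
have s0 : 0 < sqrtC (1 + t * t) by rewrite sqrtC_gt0.
have cr : c \is Num.real by rewrite cE mul1r realV gtr0_real.
have c2 : c ^+ 2 * (1 + t * t) = 1.
  by rewrite cE mul1r exprVn sqrtCK mulVf// gt_eqF.
split => //; first by rewrite realM.
- by rewrite -c2; ring.
- have -> : c ^+ 2 * p + 2 * c * (t * c) * q + (t * c) ^+ 2 * w =
    c ^+ 2 * (w * t ^+ 2 + 2 * q * t + p) by ring.
  suff -> : w * t ^+ 2 + 2 * q * t + p = 0 by rewrite mulr0.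
  have -> : p = (q * q - r ^+ 2) / w by rewrite r2; field.
  by rewrite tE; field.
Qed.

(* The law of cosines: a triangle with sides [a], [b], [e] in the complex plane. *)
Lemma triangle_phases (a b e x z w : C) : 0 < a -> 0 < b -> 0 < e ->
  a <= b + e -> b <= a + e -> e <= a + b ->
  x = (b * b - a * a - e * e) / (2 * a * e) ->
  z = x + 'i * sqrtC (1 - x * x) -> w = - (e + a * z) / b ->
  [/\ z * z^* = 1, w * w^* = 1 & a * z + b * w + e = 0].
Proof.
move=> a0 b0 e0 h1 h2 h3 xE zE wE.
have ar := gtr0_real a0; have br := gtr0_real b0; have er := gtr0_real e0.
have an : a != 0 by rewrite gt_eqF.
have bn : b != 0 by rewrite gt_eqF.
have en : e != 0 by rewrite gt_eqF.
have d0 : 0 < 2 * a * e by rewrite !mulr_gt0.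
have xr : x \is Num.real.
  by rewrite xE realM ?realV ?realB ?realM ?realn// gtr0_real.
have y0 : 0 <= 1 - x * x.
  (* Heron's factorization; each factor is nonnegative by a triangle inequality. *)
  have -> : 1 - x * x = ((a + b - e) * (b + e - a) * (a + e - b) * (a + b + e)) / (2 * a * e) ^+ 2.
    by rewrite xE; field; rewrite an en.
  rewrite divr_ge0 ?exprn_ge0 ?(ltW d0)// !mulr_ge0 ?subr_ge0//.
  by rewrite !addr_ge0// ltW.
set y := sqrtC (1 - x * x) in zE.
have yr : y \is Num.real by rewrite ger0_real// sqrtC_ge0.
have y2 : y ^+ 2 = 1 - x * x by rewrite sqrtCK.
have zC : z^* = x - 'i * y.
  by rewrite zE rmorphD rmorphM /= conjCi (conj_Creal xr) (conj_Creal yr) mulNr.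
have zz : z * z^* = 1.
  rewrite zC zE; have -> : (x + 'i * y) * (x - 'i * y) = x * x - 'i ^+ 2 * y ^+ 2 by ring.
  by rewrite sqrCi y2; ring.
have zs : z + z^* = 2 * x by rewrite zC zE; ring.
split => //.
  have wC : w^* = - (e + a * z^*) / b.
    by rewrite wE rmorphM rmorphN rmorphD rmorphM fmorphV /= (conj_Creal er)
      (conj_Creal ar) (conj_Creal br).
  rewrite wC wE.
  have -> : - (e + a * z) / b * (- (e + a * z^*) / b) =
    (e * e + a * e * (z + z^*) + a * a * (z * z^*)) / (b * b) by field.
  by rewrite zz zs xE; field; rewrite an bn en.
by rewrite wE; field.
Qed.


End FinalMixing.

(** * Making the Takagi values nonnegative and ordering them *)

Definition other (k : nat) : nat := if k == 0 then 1 else 0.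

(** A phase on one column is the mixing diag (a, 1) with an arbitrary partner column. *)
Definition ScaleCol (k : nat) (a : cexp) : cmd := Mix k (other k) a (cnat 0) (cnat 0) (cnat 1).

Definition FixPhase (k : nat) : cmd :=
  If (ceq0 (tauE k k)) Skip
    (ScaleCol k (CRoot 2 (CConj (tauE k k) / CRoot 2 (tauE k k * CConj (tauE k k))))%CE).

Definition SwapMax (j k : nat) : cmd :=
  If (BCle (tauE j j) (tauE k k)) (Mix j k (cnat 0) (cnat 1) (cnat 1) (cnat 0)) Skip.

(** Five exchanges bring the largest value to column 0 and the next to column 1. Columns 2 and 3
    stay unordered, since only their sum is a side of the triangle in the separable case. *)
Definition Normalize : cmd :=
  FixPhase 0 ;; FixPhase 1 ;; FixPhase 2 ;; FixPhase 3 ;;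
  SwapMax 0 1 ;; SwapMax 0 2 ;; SwapMax 0 3 ;; SwapMax 1 2 ;; SwapMax 1 3.

Section NormalizeCorrect.
Variable R : realType.
Local Notation C := R[i].
Implicit Types (st : store R) (M : nat -> nat -> C) (lam : nat -> C).

Definition mix_frame := frame (R := R) [:: 2%N; 3%N; 5%N] [:: 0%N; 1%N; 2%N].

Lemma ceval_tauE st r' M j k : holds r' M st -> (4 <= r')%N -> (j < 4)%N -> (k < 4)%N ->
  ceval st (tauE j k) = tauM r' M j k.
Proof. by move=> hM r4 j4 k4 /=; rewrite !(holds_xcell hM r4). Qed.

Definition steps (r' : nat) M st st' (P : (nat -> nat -> C) -> Prop) : Prop :=
  exists M', [/\ holds r' M' st', colstep 0 4 M M', P M' & mix_frame st st'].

Definition mix_time r' := (rotate_time r' + 6)%N.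

Lemma wp_mix_col st r' M j k (ea eb ec ed : cexp) (a b c d : C) :
  holds r' M st -> (4 <= r')%N -> (j < 4)%N -> (k < 4)%N -> j != k ->
  all (cuses [pred x | x \notin [:: 2%N; 3%N]] [pred x | x \notin [:: 1%N]])
    [:: ea; eb; ec; ed] ->
  ceval st ea = a -> ceval st eb = b -> ceval st ec = c -> ceval st ed = d ->
  unitary2 a b c d ->
  wp (Mix j k ea eb ec ed) st (fun T st' => (T <= mix_time r')%N /\
    steps r' M st st' (fun M' => M' = mixcol M j k a b c d)).
Proof.
move=> hM r4 j4 k4 jk u <- <- <- <- un.
apply: wp_conseq (wp_mix hM (leq_trans j4 r4) (leq_trans k4 r4) jk u) _.
move=> T st' [hT h' fr]; split => //.
by eexists; split; [exact: h' | exact: colstep_mixcol | by [] | by []].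
Qed.

Lemma other_neq k : k != other k.
Proof. by case: k => [|k]. Qed.

Lemma other_lt k : (other k < 4)%N.
Proof. by case: k => [|k]. Qed.

Lemma wp_scale st r' M lam k (e : cexp) (a : C) :
  holds r' M st -> (4 <= r')%N -> (k < 4)%N ->
  cuses [pred x | x \notin [:: 2%N; 3%N]] [pred x | x \notin [:: 1%N]] e ->
  ceval st e = a -> a * a^* = 1 -> tau_diagonal r' M lam ->
  wp (ScaleCol k e) st (fun T st' => (T <= mix_time r')%N /\
    steps r' M st st' (fun M' => tau_diagonal r' M' (fun x => scol k a x ^+ 2 * lam x))).
Proof.
move=> hM r4 k4 u ea aa hd.
apply: wp_conseq (wp_mix_col (a := a) (b := 0) (c := 0) (d := 1) hM r4 k4 (other_lt k)
  (other_neq k) _ ea _ _ _ (unitary2_scale aa)) _ => //=; first by rewrite u.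
move=> T st' [hT [M' [h' cs e' fr]]]; subst M'; split => //.
exists (mixcol M k (other k) a 0 0 1); split => //.
by apply: tau_diagonal_scale hd; apply: other_neq.
Qed.

Lemma wp_fix_phase st r' M lam k :
  holds r' M st -> (4 <= r')%N -> (k < 4)%N -> tau_diagonal r' M lam ->
  wp (FixPhase k) st (fun T st' => (T <= mix_time r' + 1)%N /\
    steps r' M st st' (fun M' => tau_diagonal r' M' (fun x => if x == k then `|lam k| else lam x))).
Proof.
move=> hM r4 k4 hd.
have e : ceval st (tauE k k) = lam k by rewrite (ceval_tauE hM)// hd// eqxx.
apply: wp_if; rewrite beval_ceq0 e => l0.
  apply: wp_skip; split; first by rewrite /mix_time /rotate_time; lia.
  exists M; split; [exact: hM | exact: colstep_refl | | exact: agree_refl].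
  move=> x y x4 y4; rewrite hd//; case: eqP => // _; case: eqP => // ->.
  by rewrite (eqP l0) normr0.
have [aa a2] := norm_phase l0.
apply: wp_conseq (wp_scale hM r4 k4 _ _ aa hd) _.
- by [].
- have -> : ceval st (CRoot 2 (CConj (tauE k k) / CRoot 2 (tauE k k * CConj (tauE k k)))%CE)
    = sqrtC ((ceval st (tauE k k))^* / sqrtC (ceval st (tauE k k) * (ceval st (tauE k k))^*)).
    by [].
  by rewrite e.
- move=> T st' [hT [M' [h' cs hd' fr]]]; split; first by lia.
  exists M'; split => // x y x4 y4; rewrite hd'//; case: eqP => // _.
  by rewrite /scol; case: eqP => [->|_]; [rewrite a2|rewrite expr1n mul1r].
Qed.

(** The clause on [B] records that an exchange creates no larger value; it carries the bound by
    column 0 through the exchanges that follow. *)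
Lemma wp_swap_max st r' M lam j k :
  holds r' M st -> (4 <= r')%N -> (j < 4)%N -> (k < 4)%N -> j != k ->
  tau_diagonal r' M lam -> (forall x, (x < 4)%N -> 0 <= lam x) ->
  wp (SwapMax j k) st (fun T st' => (T <= mix_time r' + 1)%N /\ exists lam',
    [/\ forall x, (x < 4)%N -> 0 <= lam' x,
        lam' k <= lam' j /\ lam j <= lam' j,
        forall x, x != j -> x != k -> lam' x = lam x,
        forall B, lam j <= B -> lam k <= B -> lam' j <= B /\ lam' k <= B &
        steps r' M st st' (fun M' => tau_diagonal r' M' lam')]).
Proof.
move=> hM r4 j4 k4 jk hd l0.
have ej : ceval st (tauE j j) = lam j by rewrite (ceval_tauE hM)// hd// eqxx.
have ek : ceval st (tauE k k) = lam k by rewrite (ceval_tauE hM)// hd// eqxx.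
have be : beval st (BCle (tauE j j) (tauE k k)) = (lam j <= lam k) by rewrite -ej -ek.
have kj : (k == j) = false by rewrite eq_sym (negbTE jk).
apply: wp_if; rewrite be => hjk.
  apply: wp_conseq (wp_mix_col (a := 0) (b := 1) (c := 1) (d := 0) hM r4 j4 k4 jk _ _ _ _ _
    (unitary2_swap _)) _ => //.
  move=> T st' [hT [M' [h' cs e' fr]]]; subst M'; split; first by lia.
  exists (fun x => lam (swapn j k x)); split.
  - by move=> x x4; apply: l0; rewrite /swapn; case: ifP => // _; case: ifP.
  - by rewrite /swapn !eqxx kj.
  - by move=> x /negbTE xj /negbTE xk; rewrite /swapn xj xk.
  - by move=> B; rewrite /swapn !eqxx kj.
  - by exists (mixcol M j k 0 1 1 0); split => //; apply: tau_diagonal_swap.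
apply: wp_skip; split; first by rewrite /mix_time /rotate_time; lia.
exists lam; split => //.
- split => //; rewrite real_leNgt ?ger0_real ?l0//.
  by apply: contra hjk; apply: ltW.
- by exists M; split; [exact: hM | exact: colstep_refl | exact: hd | exact: agree_refl].
Qed.

Lemma wp_normalize st r' M :
  holds r' M st -> (4 <= r')%N -> offdiag r' 3 M ->
  wp Normalize st (fun T st' => (T <= 9 * (mix_time r' + 1))%N /\ exists lam,
    [/\ forall x, (x < 4)%N -> 0 <= lam x,
        [/\ lam 1%N <= lam 0%N, lam 2%N <= lam 1%N & lam 3%N <= lam 1%N] &
        steps r' M st st' (fun M' => tau_diagonal r' M' lam)]).
Proof.
move=> hM r4 hoff.
have hd : tau_diagonal r' M (fun x => tauM r' M x x).
  move=> x y x4 y4; have [->//|xy] := eqVneq x y.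
  have [x3|x3] := ltnP x 3; first by rewrite hoff// eq_sym.
  rewrite tauM_sym hoff//; move: xy; rewrite neq_ltn => /orP[xy|yx].
    by have := leq_trans y4 (leq_ltn_trans x3 xy); rewrite ltnn.
  exact: leq_trans yx x4.
apply: wp_seq; apply: wp_conseq (wp_fix_phase (k := 0) hM r4 _ hd) _ => //.
move=> T0 st0 [hT0 [M0 [h0 c0 d0 f0]]].
apply: wp_seq; apply: wp_conseq (wp_fix_phase (k := 1) h0 r4 _ d0) _ => //.
move=> T1 st1 [hT1 [M1 [h1 c1 d1 f1]]].
apply: wp_seq; apply: wp_conseq (wp_fix_phase (k := 2) h1 r4 _ d1) _ => //.
move=> T2 st2 [hT2 [M2 [h2 c2 d2 f2]]].
apply: wp_seq; apply: wp_conseq (wp_fix_phase (k := 3) h2 r4 _ d2) _ => //.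
move=> T3 st3 [hT3 [M3 [h3 c3 d3 f3]]] /=.
set l3 := (fun x : nat => _) in d3.
have l3p x : (x < 4)%N -> 0 <= l3 x by case: x => [|[|[|[|x]]]]; rewrite // /l3 /= normr_ge0.
apply: wp_seq; apply: wp_conseq (wp_swap_max (j := 0) (k := 1) h3 r4 _ _ _ d3 l3p) _ => //.
move=> T4 st4 [hT4 [l4 [l4p [a4 b4] o4 _ [M4 [h4 c4 d4 f4]]]]].
apply: wp_seq; apply: wp_conseq (wp_swap_max (j := 0) (k := 2) h4 r4 _ _ _ d4 l4p) _ => //.
move=> T5 st5 [hT5 [l5 [l5p [a5 b5] o5 _ [M5 [h5 c5 d5 f5]]]]].
apply: wp_seq; apply: wp_conseq (wp_swap_max (j := 0) (k := 3) h5 r4 _ _ _ d5 l5p) _ => //.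
move=> T6 st6 [hT6 [l6 [l6p [a6 b6] o6 _ [M6 [h6 c6 d6 f6]]]]].
apply: wp_seq; apply: wp_conseq (wp_swap_max (j := 1) (k := 2) h6 r4 _ _ _ d6 l6p) _ => //.
move=> T7 st7 [hT7 [l7 [l7p [a7 b7] o7 B7 [M7 [h7 c7 d7 f7]]]]].
apply: wp_conseq (wp_swap_max (j := 1) (k := 3) h7 r4 _ _ _ d7 l7p) _ => //.
move=> T8 st8 [hT8 [l8 [l8p [a8 b8] o8 B8 [M8 [h8 c8 d8 f8]]]]].
split; first by clear -hT0 hT1 hT2 hT3 hT4 hT5 hT6 hT7 hT8; lia.
exists l8; split => //.
- have e1 : l6 1%N <= l6 0%N by rewrite o6// (le_trans _ b6)// o5// (le_trans a4).
  have e2 : l6 2%N <= l6 0%N by rewrite o6// (le_trans a5).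
  have [e3 e4] := B7 _ e1 e2.
  have e5 : l7 3%N <= l6 0%N by rewrite o7.
  have [e6 e7] := B8 _ e3 e5.
  split => //; first by rewrite (o8 0%N)// (o7 0%N).
  by rewrite (o8 2%N)// (le_trans a7).
- exists M8; split => //.
  + apply: colstep_trans c8; apply: colstep_trans c7; apply: colstep_trans c6.
    apply: colstep_trans c5; apply: colstep_trans c4; apply: colstep_trans c3.
    by apply: colstep_trans c2; apply: colstep_trans c1.
  + apply: frame_trans f8; apply: frame_trans f7; apply: frame_trans f6.
    apply: frame_trans f5; apply: frame_trans f4; apply: frame_trans f3.
    by apply: frame_trans f2; apply: frame_trans f1.
Qed.

End NormalizeCorrect.

(** * The entangled case: removing the defects by real rotations *)

Definition herE (j k : nat) : cexp :=
  (xcell 0 j * CConj (xcell 0 k) + xcell 1 j * CConj (xcell 1 k) +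
   xcell 2 j * CConj (xcell 2 k) + xcell 3 j * CConj (xcell 3 k))%CE.

Definition defectE (j k : nat) : cexp :=
  (tauE j k - cell0 8 0 0 * (herE j k + herE k j) / cnat 2)%CE.

(** Defects of strictly opposite signs give the quadratic equation for the tangent a real root, and
    the rotation clears the defect of column j. Otherwise the pair is left alone. *)
Definition Balance (j k : nat) : cmd :=
  CSet 8 (INat 0) (INat 1) (defectE j j) ;;
  CSet 8 (INat 0) (INat 2) (defectE j k) ;;
  CSet 8 (INat 0) (INat 3) (defectE k k) ;;
  If (BCle (cnat 0) (cell0 8 0 1 * cell0 8 0 3)%CE) Skip
    (CSet 8 (INat 0) (INat 4) ((- cell0 8 0 2 +
        CRoot 2 (cell0 8 0 2 * cell0 8 0 2 - cell0 8 0 1 * cell0 8 0 3)) / cell0 8 0 3)%CE ;;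
     CSet 8 (INat 0) (INat 5) (cnat 1 / CRoot 2 (cnat 1 + cell0 8 0 4 * cell0 8 0 4))%CE ;;
     Mix j k (cell0 8 0 5) (cell0 8 0 4 * cell0 8 0 5)%CE
       (- (cell0 8 0 4 * cell0 8 0 5))%CE (cell0 8 0 5)).

(* Multiplying three columns by the imaginary unit makes the sum of the diagonal
   taus equal to the common value [c], so the defects have zero sum. *)
Definition Entangled : cmd :=
  CSet 8 (INat 0) (INat 0) (tauE 0 0 - tauE 1 1 - tauE 2 2 - tauE 3 3)%CE ;;
  ScaleCol 1 CImag ;; ScaleCol 2 CImag ;; ScaleCol 3 CImag ;;
  Balance 0 1 ;; Balance 0 2 ;; Balance 0 3 ;; Balance 1 2 ;; Balance 1 3 ;; Balance 2 3.

Section EntangledCorrect.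
Variable R : realType.
Local Notation C := R[i].
Implicit Types (st : store R) (M : nat -> nat -> C) (lam : nat -> C).

Definition herM r' M j k : C := \sum_(l < 4) M (r' + l)%N j * (M (r' + l)%N k)^*.
(** On the diagonal this is [tau] minus c times the weight, the quantity to be brought to zero.
    Symmetrizing the Hermitian product takes its real part, so for real c and [tau] the defect is a
    real symmetric form, and real rotations act on it as such. *)
Definition defect r' (c : C) M j k : C :=
  tauM r' M j k - c * (herM r' M j k + herM r' M k j) / 2.
Definition real_tau r' M :=
  forall x y, (x < 4)%N -> (y < 4)%N -> tauM r' M x y \is Num.real.
Definition trace_defect r' c M : C := \sum_(x < 4) defect r' c M x x.

Lemma herM_conj r' M j k : (herM r' M j k)^* = herM r' M k j.
Proof.
rewrite /herM rmorph_sum /=; apply: eq_bigr => l _.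
by rewrite rmorphM /= conjCK mulrC.
Qed.

Lemma defect_real r' c M j k : c \is Num.real -> (j < 4)%N -> (k < 4)%N ->
  real_tau r' M -> defect r' c M j k \is Num.real.
Proof.
move=> cr j4 k4 rt; rewrite /defect realB ?rt// realM ?realV ?realn// realM//.
by rewrite CrealE rmorphD /= !herM_conj addrC.
Qed.

Lemma defect_mix r' c M j k (a b a' b' : C) : j != k ->
  a \is Num.real -> b \is Num.real -> a' \is Num.real -> b' \is Num.real ->
  let M' := mixcol M j k a b a' b' in
  defect r' c M' j j = a ^+ 2 * defect r' c M j j + 2 * a * b * defect r' c M j k
                       + b ^+ 2 * defect r' c M k k /\
  defect r' c M' k k = a' ^+ 2 * defect r' c M j j + 2 * a' * b' * defect r' c M j k
                       + b' ^+ 2 * defect r' c M k k.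
Proof.
move=> jk ar br ar' br' M'.
have [ca cb ca' cb'] : [/\ a^* = a, b^* = b, a'^* = a' & b'^* = b'].
  by rewrite !conj_Creal.
have hj : herM r' M' j j = a ^+ 2 * herM r' M j j + a * b * (herM r' M j k + herM r' M k j)
    + b ^+ 2 * herM r' M k k.
  rewrite /herM /M' !mulrDr !mulr_sumr -!big_split /=; apply: eq_bigr => l _.
  by rewrite mixcol_j rmorphD !rmorphM /= ca cb; ring.
have hk : herM r' M' k k = a' ^+ 2 * herM r' M j j + a' * b' * (herM r' M j k + herM r' M k j)
    + b' ^+ 2 * herM r' M k k.
  rewrite /herM /M' !mulrDr !mulr_sumr -!big_split /=; apply: eq_bigr => l _.
  by rewrite mixcol_k// rmorphD !rmorphM /= ca' cb'; ring.
by split; rewrite /defect ?hj ?hk ?tauM_jj ?tauM_kk//; field.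
Qed.

Lemma defect_mix_out r' c M j k (a b a' b' : C) x : x != j -> x != k ->
  defect r' c (mixcol M j k a b a' b') x x = defect r' c M x x.
Proof.
move=> xj xk; rewrite /defect tauM_out//; congr (_ - _ * (_ + _) / _);
by apply: eq_bigr => l _; rewrite !mixcol_out.
Qed.

Lemma tau_lin (a b : C) (u v w : nat -> C) :
  tau (fun i => a * u i + b * v i) w = a * tau u w + b * tau v w.
Proof. by rewrite /tau; ring. Qed.

Lemma real_tau_mix r' M j k (a b a' b' : C) : (j < 4)%N -> (k < 4)%N ->
  a \is Num.real -> b \is Num.real -> a' \is Num.real -> b' \is Num.real ->
  real_tau r' M -> real_tau r' (mixcol M j k a b a' b').
Proof.
move=> j4 k4 ar br ar' br' rt.
have lin z : (z < 4)%N -> exists u v p q, [/\ u \is Num.real, v \is Num.real,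
    (p < 4)%N, (q < 4)%N & ampcol r' (mixcol M j k a b a' b') z =
      fun i => u * ampcol r' M p i + v * ampcol r' M q i].
  move=> z4; rewrite ampcol_mixcol; case: (z == j); first by exists a, b, j, k.
  case: (z == k); first by exists a', b', j, k.
  exists 1, 0, z, z; split; rewrite ?rpred1 ?rpred0//.
  by apply/funext => i; rewrite mul1r mul0r addr0.
move=> x y /lin[u [v [p [q [ur vr p4 q4 ex]]]]] /lin[u' [v' [p' [q' [ur' vr' p4' q4' ey]]]]].
rewrite /tauM ex ey tau_lin !(tauC (ampcol r' M _)) !tau_lin.
by apply: realD; apply: realM => //; apply: realD; apply: realM => //; apply: rt.
Qed.

Lemma sum4_two (F : nat -> C) j k : (j < 4)%N -> (k < 4)%N -> j != k ->
  \sum_(x < 4) F x = F j + F k + \sum_(0 <= x < 4 | (x != j) && (x != k)) F x.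
Proof. by move=> j4 k4 jk; rewrite -(big_mkord xpredT F) (sum_nat_two _ jk). Qed.

Lemma ceval_defectE st r' M c j k : holds r' M st -> (4 <= r')%N -> (j < 4)%N -> (k < 4)%N ->
  cell st 8%N 0%N 0%N = c -> ceval st (defectE j k) = defect r' c M j k.
Proof.
move=> hM r4 j4 k4 cc.
have he x y : (x < 4)%N -> (y < 4)%N -> ceval st (herE x y) = herM r' M x y.
  move=> x4 y4; rewrite /herM (sum_ord4 (fun l => M (r' + l)%N x * (M (r' + l)%N y)^*)).
  by rewrite /= !(holds_xcell hM r4).
have -> : ceval st (defectE j k) = ceval st (tauE j k) -
  cell st 8%N 0%N 0%N * (ceval st (herE j k) + ceval st (herE k j)) / 2 by [].
by rewrite !he// (ceval_tauE hM)// cc.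
Qed.

Lemma wp_balance st r' M c j k :
  holds r' M st -> (4 <= r')%N -> (j < 4)%N -> (k < 4)%N -> j != k ->
  c \is Num.real -> cell st 8%N 0%N 0%N = c -> real_tau r' M ->
  wp (Balance j k) st (fun T st' => (T <= mix_time r' + 6)%N /\ exists M',
    [/\ holds r' M' st' /\ colstep 0 4 M M',
        cell st' 8%N 0%N 0%N = c,
        real_tau r' M' /\ trace_defect r' c M' = trace_defect r' c M,
        forall x, x != j -> x != k -> defect r' c M' x x = defect r' c M x x &
        if 0 <= defect r' c M j j * defect r' c M k k then M' = M
        else defect r' c M' j j = 0]).
Proof.
move=> hM r4 j4 k4 jk cr cc rt.
have keep v st1 i : holds r' M st1 -> holds r' M (set_cell st1 8 0 i v).
  by move=> [h0 h]; split.
apply: wp_seq; apply: wp_cset => p; rewrite (ceval_defectE hM r4 j4 j4 cc) => ->.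
have h1 := keep (defect r' c M j j) _ 1%N hM.
apply: wp_seq; apply: wp_cset => q; rewrite (ceval_defectE h1 r4 j4 k4 cc) => ->.
have h2 := keep (defect r' c M j k) _ 2%N h1.
apply: wp_seq; apply: wp_cset => w; rewrite (ceval_defectE h2 r4 k4 k4 cc) => ->.
have h3 := keep (defect r' c M k k) _ 3%N h2.
set st3 := set_cell _ _ _ 3 _ in h3 *.
have pr := defect_real cr j4 j4 rt; have qr := defect_real cr j4 k4 rt.
have wr := defect_real cr k4 k4 rt.
apply: wp_if => hb.
  have {}hb : 0 <= defect r' c M j j * defect r' c M k k by exact: hb.
  apply: wp_skip; split; first by lia.
  by exists M; rewrite hb; split => //; split => //; apply: colstep_refl.
have {}hb : ~~ (0 <= defect r' c M j j * defect r' c M k k) by exact: hb.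
apply: wp_seq; apply: wp_cset => t tE; have h4 := keep t _ 4%N h3.
apply: wp_seq; apply: wp_cset => cc' cE; have h5 := keep cc' _ 5%N h4.
have [c'r tcr c1 c0] := jacobi_angle pr qr wr hb tE cE.
have ntr : - (t * cc') \is Num.real by rewrite realN.
apply: wp_conseq (wp_mix_col (a := cc') (b := t * cc') (c := - (t * cc')) (d := cc')
  h5 r4 j4 k4 jk _ _ _ _ _ (unitary2_real c'r tcr c1)) _ => //.
move=> T st' [hT [M' [h' cs e' fr]]]; subst M'.
have [dj dk] := @defect_mix r' c M j k cc' (t * cc') (- (t * cc')) cc' jk c'r tcr ntr c'r.
split; first by rewrite /mix_time in hT *; lia.
exists (mixcol M j k cc' (t * cc') (- (t * cc')) cc'); rewrite (negbTE hb); split => //.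
- by rewrite (proj2 fr).
- split; first exact: real_tau_mix.
  rewrite /trace_defect !(sum4_two (fun x => defect r' c _ x x) j4 k4 jk) dj dk.
  congr (_ + _); last by apply: eq_bigr => x /andP[xj xk]; rewrite defect_mix_out.
  rewrite -[in RHS](mul1r (defect r' c M j j)) -[in RHS](mul1r (defect r' c M k k)) -c1.
  by ring.
- by move=> x xj xk; rewrite defect_mix_out.
- by rewrite dj -[RHS]c0; ring.
Qed.

End EntangledCorrect.

(** * The separable case: cancellation by phases and Hadamard mixings *)

Definition Hadamard (j k : nat) : cmd :=
  Mix j k (cell0 8 0 4) (cell0 8 0 4) (cell0 8 0 4) (- cell0 8 0 4)%CE.

(* The phases close the triangle of sides [lam 0], [lam 1] and [lam 2 + lam 3];
   the Hadamard mixings then give all four columns the average tau, zero. *)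
Definition Separable : cmd :=
  CSet 8 (INat 0) (INat 1)
    ((tauE 1 1 * tauE 1 1 - tauE 0 0 * tauE 0 0
      - (tauE 2 2 + tauE 3 3) * (tauE 2 2 + tauE 3 3)) /
     (cnat 2 * tauE 0 0 * (tauE 2 2 + tauE 3 3)))%CE ;;
  CSet 8 (INat 0) (INat 2)
    (cell0 8 0 1 + CImag * CRoot 2 (cnat 1 - cell0 8 0 1 * cell0 8 0 1))%CE ;;
  CSet 8 (INat 0) (INat 3)
    (- (tauE 2 2 + tauE 3 3 + tauE 0 0 * cell0 8 0 2) / tauE 1 1)%CE ;;
  CSet 8 (INat 0) (INat 4) (CRoot 2 (cnat 1 / cnat 2)%CE) ;;
  ScaleCol 0 (CRoot 2 (cell0 8 0 2)) ;; ScaleCol 1 (CRoot 2 (cell0 8 0 3)) ;;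
  Hadamard 0 1 ;; Hadamard 2 3 ;; Hadamard 0 2 ;; Hadamard 1 3.

Definition Equalize : cmd :=
  If (BCle (tauE 1 1 + tauE 2 2 + tauE 3 3)%CE (tauE 0 0)) Entangled Separable.

Section EqualizeCorrect.
Variable R : realType.
Local Notation C := R[i].
Implicit Types (st : store R) (M : nat -> nat -> C) (lam : nat -> C).

Lemma sum_herM_colstep r' M M' : colstep 0 4 M M' ->
  \sum_(x < 4) herM r' M' x x = \sum_(x < 4) herM r' M x x.
Proof.
move=> [g _ _]; rewrite /herM exchange_big [RHS]exchange_big /=.
apply: eq_bigr => l _; have := g (r' + l)%N (r' + l)%N.
by rewrite !big_mkord.
Qed.

Lemma half_double (c h : C) : c * (h + h) / 2 = c * h.
Proof. by field. Qed.

Lemma ceval_CImag st : ceval st CImag = 'i :> C.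
Proof. by []. Qed.

Lemma imag_phase : ('i : C) * 'i^* = 1.
Proof. by rewrite conjCi mulrN -expr2 sqrCi opprK. Qed.

(** Multiplying the vanishing sum by d0 gives a sum of nonnegative terms, one of which is the square
    of d0. *)
Lemma balanced (d0 d1 d2 d3 : C) : d0 \is Num.real -> 0 <= d0 * d1 -> 0 <= d0 * d2 ->
  0 <= d0 * d3 -> d0 + d1 + d2 + d3 = 0 -> d0 = 0.
Proof.
move=> dr h1 h2 h3 s; have h0 : 0 <= d0 ^+ 2 by rewrite real_exprn_even_ge0.
have : d0 ^+ 2 + (d0 * d1 + d0 * d2 + d0 * d3) = 0.
  by transitivity (d0 * (d0 + d1 + d2 + d3)); [ring | rewrite s mulr0].
move/eqP; rewrite paddr_eq0 ?addr_ge0// => /andP[/eqP + _].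
by move/eqP; rewrite sqrf_eq0 => /eqP.
Qed.

Lemma trace_defect4 r' c M : trace_defect r' c M = defect r' c M 0 0 +
  defect r' c M 1 1 + defect r' c M 2 2 + defect r' c M 3 3.
Proof. exact: (sum_ord4 (fun x => defect r' c M x x)). Qed.

(** A zero defect passes the sign test, so later balancing steps on that column do nothing. *)
Lemma if_zero (d e : C) (P Q : Prop) : d = 0 -> (if 0 <= d * e then P else Q) -> P.
Proof. by move=> ->; rewrite mul0r lexx. Qed.

Definition entangled_time r' := (9 * (mix_time r' + 6) + 1)%N.

Lemma wp_entangled st r' M lam :
  holds r' M st -> (4 <= r')%N -> tau_diagonal r' M lam ->
  (forall x, (x < 4)%N -> 0 <= lam x) -> \sum_(x < 4) herM r' M x x = 1 ->
  let c := lam 0%N - lam 1%N - lam 2%N - lam 3%N in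
  wp Entangled st (fun T st' => (T <= entangled_time r')%N /\ exists M',
    [/\ holds r' M' st', colstep 0 4 M M' &
      forall x, (x < 4)%N -> tauM r' M' x x = c * herM r' M' x x]).
Proof.
move=> hM r4 hd l0 tot c.
have te x : (x < 4)%N -> ceval st (tauE x x) = lam x.
  by move=> x4; rewrite (ceval_tauE hM)// hd// eqxx.
apply: wp_seq; apply: wp_cset => c' cE.
have {cE} -> : c' = c.
  rewrite cE; have -> : ceval st (tauE 0 0 - tauE 1 1 - tauE 2 2 - tauE 3 3)%CE =
    ceval st (tauE 0 0) - ceval st (tauE 1 1) - ceval st (tauE 2 2) - ceval st (tauE 3 3) by [].
  by rewrite !te.
set st0 := set_cell _ _ _ _ _.
have h0 : holds r' M st0 by split; case: hM.
have cc0 : cell st0 8%N 0%N 0%N = c by [].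
apply: wp_seq; apply: wp_conseq (wp_scale (k := 1) h0 r4 _ _ (ceval_CImag _) imag_phase hd) _ => //.
move=> T1 st1 [hT1 [M1 [h1 c1 d1 f1]]].
apply: wp_seq; apply: wp_conseq (wp_scale (k := 2) h1 r4 _ _ (ceval_CImag _) imag_phase d1) _ => //.
move=> T2 st2 [hT2 [M2 [h2 c2 d2 f2]]].
apply: wp_seq; apply: wp_conseq (wp_scale (k := 3) h2 r4 _ _ (ceval_CImag _) imag_phase d2) _ => //.
move=> T3 st3 [hT3 [M3 [h3 c3 d3 f3]]].
have C3 := colstep_trans (colstep_trans c1 c2) c3.
have cc3 : cell st3 8%N 0%N 0%N = c by rewrite (proj2 f3)// (proj2 f2)// (proj2 f1).
have lr x : (x < 4)%N -> lam x \is Num.real by move=> x4; rewrite ger0_real// l0.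
have cr : c \is Num.real by rewrite /c !realB ?lr.
have ii : ('i : C) ^+ 2 = -1 by rewrite sqrCi.
have rt : real_tau r' M3.
  move=> x y x4 y4; rewrite d3//; case: eqP => // _.
  by rewrite /scol; case: eqP => _; case: eqP => _; case: eqP => _;
    rewrite ?ii ?expr1n ?mul1r ?mulN1r ?realN lr.
have tr3 : trace_defect r' c M3 = 0.
  rewrite /trace_defect /defect sumrB.
  have -> : \sum_(x < 4) c * (herM r' M3 x x + herM r' M3 x x) / 2 = c.
    under eq_bigr do rewrite half_double.
    by rewrite -mulr_sumr (sum_herM_colstep _ C3) tot mulr1.
  rewrite (sum_ord4 (fun x => tauM r' M3 x x)) !d3//= /scol /= !ii !expr1n /c.
  by ring.
apply: wp_seq; apply: wp_conseq (wp_balance (j := 0) (k := 1) h3 r4 _ _ _ cr cc3 rt) _ => //.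
move=> T4 st4 [hT4 [M4 [[h4 c4] cc4 [rt4 tr4] o4 z4]]].
apply: wp_seq; apply: wp_conseq (wp_balance (j := 0) (k := 2) h4 r4 _ _ _ cr cc4 rt4) _ => //.
move=> T5 st5 [hT5 [M5 [[h5 c5] cc5 [rt5 tr5] o5 z5]]].
apply: wp_seq; apply: wp_conseq (wp_balance (j := 0) (k := 3) h5 r4 _ _ _ cr cc5 rt5) _ => //.
move=> T6 st6 [hT6 [M6 [[h6 c6] cc6 [rt6 tr6] o6 z6]]].
apply: wp_seq; apply: wp_conseq (wp_balance (j := 1) (k := 2) h6 r4 _ _ _ cr cc6 rt6) _ => //.
move=> T7 st7 [hT7 [M7 [[h7 c7] cc7 [rt7 tr7] o7 z7]]].
apply: wp_seq; apply: wp_conseq (wp_balance (j := 1) (k := 3) h7 r4 _ _ _ cr cc7 rt7) _ => //.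
move=> T8 st8 [hT8 [M8 [[h8 c8] cc8 [rt8 tr8] o8 z8]]].
apply: wp_conseq (wp_balance (j := 2) (k := 3) h8 r4 _ _ _ cr cc8 rt8) _ => //.
move=> T9 st9 [hT9 [M9 [[h9 c9] cc9 [rt9 tr9] o9 z9]]].
split.
  by clear -hT1 hT2 hT3 hT4 hT5 hT6 hT7 hT8 hT9; rewrite /entangled_time; lia.
have dr M' x : (x < 4)%N -> real_tau r' M' -> defect r' c M' x x \is Num.real.
  by move=> x4 rM'; apply: defect_real.
(* Either one of the three steps clears column 0, and the later ones skip, or all three skip; then
   no other defect has the strictly opposite sign and the zero sum forces this one to vanish. *)
have e6 : defect r' c M6 0 0 = 0.
  case: ifP z4 => [b4 e4|_ e4].
    rewrite {}e4 in z5 h4 c4 cc4 rt4 tr4 o4.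
    case: ifP z5 => [b5 e5|_ e5].
      rewrite {}e5 in z6 h5 c5 cc5 rt5 tr5 o5.
      case: ifP z6 => [b6 e6|//]; rewrite e6.
      by apply: (balanced _ b4 b5 b6); [exact: dr | rewrite -trace_defect4].
    by rewrite (if_zero e5 z6).
  by have e5 := if_zero e4 z5; rewrite -e5 in e4; rewrite (if_zero e4 z6).
have t6 : trace_defect r' c M6 = 0 by rewrite tr6 tr5 tr4.
(* The same argument for the remaining three columns, whose defects still have sum zero. *)
have e8 : defect r' c M8 1 1 = 0.
  case: ifP z7 => [b7 e7|_ e7].
    rewrite {}e7 in z8 h7 c7 cc7 rt7 tr7 o7.
    case: ifP z8 => [b8 e8|//]; rewrite e8.
    apply: (@balanced _ 0 _ _ _ _ b7 b8); [exact: dr | by rewrite mulr0 | ].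
    by transitivity (trace_defect r' c M6); [rewrite trace_defect4 e6; ring | exact: t6].
  by rewrite (if_zero e7 z8).
have e80 : defect r' c M8 0 0 = 0 by rewrite o8// o7.
have t8 : trace_defect r' c M8 = 0 by rewrite tr8 tr7.
have e9 : defect r' c M9 2 2 = 0.
  case: ifP z9 => [b9 e9'|//]; rewrite e9'.
  apply: (@balanced _ 0 0 _ _ _ _ b9); [exact: dr | by rewrite mulr0 | by rewrite mulr0 |].
  by transitivity (trace_defect r' c M8); [rewrite trace_defect4 e80 e8; ring | exact: t8].
have e90 : defect r' c M9 0 0 = 0 by rewrite o9.
have e91 : defect r' c M9 1 1 = 0 by rewrite o9.
have e93 : defect r' c M9 3 3 = 0.
  by transitivity (trace_defect r' c M9); [rewrite trace_defect4 e90 e91 e9; ring | rewrite tr9].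
exists M9; split => //.
  apply: colstep_trans C3 _; apply: colstep_trans c4 _; apply: colstep_trans c5 _.
  by apply: colstep_trans c6 _; apply: colstep_trans c7 _; apply: colstep_trans c8 c9.
move=> x x4; suff : defect r' c M9 x x = 0.
  rewrite /defect half_double => /eqP.
  by rewrite subr_eq0 => /eqP.
by move: x x4; apply: forall_ord4.
Qed.

Lemma wp_hadamard st r' M j k :
  holds r' M st -> (4 <= r')%N -> (j < 4)%N -> (k < 4)%N -> j != k ->
  cell st 8%N 0%N 4%N = sqrtC (1 / 2) ->
  wp (Hadamard j k) st (fun T st' => (T <= mix_time r')%N /\ exists h M',
    [/\ h ^+ 2 = 1 / 2, M' = mixcol M j k h h h (- h), holds r' M' st',
        colstep 0 4 M M' & cell st' 8%N 0%N 4%N = sqrtC (1 / 2)]).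
Proof.
move=> hM r4 j4 k4 jk ch; set h := sqrtC (1 / 2).
have h2 : h ^+ 2 = 1 / 2 by rewrite sqrtCK.
have hr : h \is Num.real by rewrite ger0_real// sqrtC_ge0 divr_ge0.
have he : ceval st (- cell0 8 0 4)%CE = - h by rewrite /= ch.
have ch' : ceval st (cell0 8 0 4) = h by rewrite /= ch.
apply: wp_conseq (wp_mix_col (a := h) (b := h) (c := h) (d := - h) hM r4 j4 k4 jk _
  ch' ch' ch' he (unitary2_hadamard hr h2)) _ => //.
move=> T st' [hT [M' [h' cs e' fr]]]; split => //.
by exists h, M'; split => //; rewrite (proj2 fr).
Qed.

Definition separable_time r' := (6 * mix_time r' + 4)%N.

Lemma wp_separable st r' M lam :
  holds r' M st -> (4 <= r')%N -> tau_diagonal r' M lam ->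
  (forall x, (x < 4)%N -> 0 <= lam x) ->
  [/\ lam 1%N <= lam 0%N, lam 2%N <= lam 1%N & lam 3%N <= lam 1%N] ->
  lam 0%N < lam 1%N + lam 2%N + lam 3%N ->
  wp Separable st (fun T st' => (T <= separable_time r')%N /\ exists M',
    [/\ holds r' M' st', colstep 0 4 M M' &
      forall x, (x < 4)%N -> tauM r' M' x x = 0]).
Proof.
move=> hM r4 hd l0 [l10 l21 l31] lt.
set a := lam 0%N in l10 lt *; set b := lam 1%N in l10 l21 l31 lt *.
set e := lam 2%N + lam 3%N.
have b0' : 0 <= b by apply: l0.
have lt' : a < b + e by rewrite /e addrA.
(* The strict inequality and the ordering make all three sides of the triangle positive, which the
   divisions require. *)
have b0 : 0 < b.
  rewrite lt_def b0' andbT; apply: contraTneq lt' => bz.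
  have l2 : lam 2%N = 0 by apply/eqP; rewrite eq_le l0// -bz l21.
  have l3 : lam 3%N = 0 by apply/eqP; rewrite eq_le l0// -bz l31.
  by rewrite /e l2 l3 bz !addr0 le_gtF// l0.
have a0 : 0 < a by apply: lt_le_trans l10.
have e0 : 0 < e by rewrite -(ltrD2l b) addr0 (le_lt_trans l10).
have h1 : a <= b + e by apply: ltW.
have h2 : b <= a + e by rewrite (le_trans l10)// lerDl ltW.
have h3 : e <= a + b by rewrite /e addrC lerD// (le_trans l31).
have te x : (x < 4)%N -> ceval st (tauE x x) = lam x.
  by move=> x4; rewrite (ceval_tauE hM)// hd// eqxx.
have keep v st1 i : holds r' M st1 -> holds r' M (set_cell st1 8 0 i v).
  by move=> [h0 h]; split.
have te' st1 x : holds r' M st1 -> (x < 4)%N -> ceval st1 (tauE x x) = lam x.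
  by move=> hM1 x4; rewrite (ceval_tauE hM1)// hd// eqxx.
apply: wp_seq; apply: wp_cset => x xE.
have {}xE : x = (b * b - a * a - e * e) / (2 * a * e).
  rewrite xE; pose A := ceval st (tauE 0 0); pose B := ceval st (tauE 1 1).
  pose D := ceval st (tauE 2 2) + ceval st (tauE 3 3).
  transitivity ((B * B - A * A - D * D) / (2 * A * D)) => //.
  by rewrite /A /B /D !te.
have hM1 := keep x _ 1%N hM.
apply: wp_seq; apply: wp_cset => z zE.
have {}zE : z = x + 'i * sqrtC (1 - x * x) by rewrite zE.
have hM2 := keep z _ 2%N hM1.
apply: wp_seq; apply: wp_cset => w wE.
have {}wE : w = - (e + a * z) / b.
  rewrite wE; set st2 := set_cell _ _ _ _ z.
  pose A := ceval st2 (tauE 0 0); pose B := ceval st2 (tauE 1 1).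
  pose D := ceval st2 (tauE 2 2) + ceval st2 (tauE 3 3).
  transitivity (- (D + A * z) / B) => //.
  by rewrite /A /B /D !te'.
have hM3 := keep w _ 3%N hM2.
have [zz ww zw] := triangle_phases a0 b0 e0 h1 h2 h3 xE zE wE.
apply: wp_seq; apply: wp_cset => g gE.
have {}gE : g = sqrtC (1 / 2) by rewrite gE.
have hM4 := keep g _ 4%N hM3.
set st4 := set_cell _ _ _ _ g in hM4 *.
have e4 : ceval st4 (CRoot 2 (cell0 8 0 2)) = sqrtC z by [].
apply: wp_seq; apply: wp_conseq (wp_scale (k := 0) hM4 r4 _ _ e4 (sqrt_phase zz) hd) _ => //.
move=> T5 st5 [hT5 [M5 [h5 c5 d5 f5]]].
have e5 : ceval st5 (CRoot 2 (cell0 8 0 3)) = sqrtC w by rewrite /= (proj2 f5).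
apply: wp_seq; apply: wp_conseq (wp_scale (k := 1) h5 r4 _ _ e5 (sqrt_phase ww) d5) _ => //.
move=> T6 st6 [hT6 [M6 [h6 c6 d6 f6]]].
have g6 : cell st6 8%N 0%N 4%N = sqrtC (1 / 2).
  by rewrite (proj2 f6)// (proj2 f5)//= gE.
have D6 x' y : (x' < 4)%N -> (y < 4)%N -> tauM r' M6 x' y =
    if x' == y then nth 0 [:: z * a; w * b; lam 2%N; lam 3%N] x' else 0.
  move=> x4 y4; rewrite d6//; case: eqP => // _; rewrite /scol /=.
  by case: x' x4 => [|[|[|[|]]]] // _; rewrite /= ?sqrtCK ?expr1n ?mul1r.
apply: wp_seq; apply: wp_conseq (wp_hadamard (j := 0) (k := 1) h6 r4 _ _ _ g6) _ => //.
move=> T7 st7 [hT7 [h [M7 [hh7 E7 h7 c7 g7]]]].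
apply: wp_seq; apply: wp_conseq (wp_hadamard (j := 2) (k := 3) h7 r4 _ _ _ g7) _ => //.
move=> T8 st8 [hT8 [h' [M8 [hh8 E8 h8 c8 g8]]]].
apply: wp_seq; apply: wp_conseq (wp_hadamard (j := 0) (k := 2) h8 r4 _ _ _ g8) _ => //.
move=> T9 st9 [hT9 [h'' [M9 [hh9 E9 h9 c9 g9]]]].
apply: wp_conseq (wp_hadamard (j := 1) (k := 3) h9 r4 _ _ _ g9) _ => //.
move=> T10 st10 [hT10 [h''' [M10 [hh10 E10 h10 c10 g10]]]].
split.
  by clear -hT5 hT6 hT7 hT8 hT9 hT10; rewrite /separable_time; lia.
exists M10; split => //.
  apply: colstep_trans c5 _; apply: colstep_trans c6 _; apply: colstep_trans c7 _.
  by apply: colstep_trans c8 _; apply: colstep_trans c9 c10.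
(* The first two mixings give the diagonal p/2, p/2, e/2, e/2 with p + e = 0. The [tau] values
   between columns 0, 2 and between 1, 3 stay zero, so the last two mixings simply average. *)
set p := z * a + w * b in D6 *.
have pe : p + (lam 2%N + lam 3%N) = 0 by rewrite -zw /p /e; ring.
have [u0 u1] : tauM r' M7 0 0 = p / 2 /\ tauM r' M7 1 1 = p / 2.
  rewrite E7 tauM_jj tauM_kk// !D6//= !mulr0 !addr0 sqrrN hh7 /p.
  by split; field.
have [u2 u3 u23] : [/\ tauM r' M7 2 2 = lam 2%N, tauM r' M7 3 3 = lam 3%N & tauM r' M7 2 3 = 0].
  by rewrite E7 !tauM_out// !D6.
have [u02 u03 u12 u13] : [/\ tauM r' M7 0 2 = 0, tauM r' M7 0 3 = 0,
    tauM r' M7 1 2 = 0 & tauM r' M7 1 3 = 0].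
  rewrite E7 !(tauM_sym r' _ _ 2) !(tauM_sym r' _ _ 3) !tauM_xj// !tauM_xk// !D6//=.
  by rewrite !mulr0 !addr0.
have [v0 v1] : tauM r' M8 0 0 = p / 2 /\ tauM r' M8 1 1 = p / 2.
  by rewrite E8 !tauM_out.
have [v2 v3] : tauM r' M8 2 2 = (lam 2%N + lam 3%N) / 2 /\
    tauM r' M8 3 3 = (lam 2%N + lam 3%N) / 2.
  rewrite E8 tauM_jj tauM_kk// u2 u3 u23 !mulr0 !addr0 sqrrN hh8.
  by split; field.
have [v02 v13] : tauM r' M8 0 2 = 0 /\ tauM r' M8 1 3 = 0.
  by rewrite E8 tauM_xj// tauM_xk// u02 u03 u12 u13 !mulr0 !addr0.
have [w0 w2] : tauM r' M9 0 0 = 0 /\ tauM r' M9 2 2 = 0.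
  rewrite E9 tauM_jj tauM_kk// v0 v2 v02 !mulr0 !addr0 sqrrN.
  by split; rewrite -mulrDr -mulrDl pe mul0r mulr0.
have [w1 w3 w13] : [/\ tauM r' M9 1 1 = p / 2, tauM r' M9 3 3 = (lam 2%N + lam 3%N) / 2 &
    tauM r' M9 1 3 = 0] by rewrite E9 !tauM_out.
apply: forall_ord4; rewrite E10.
- by rewrite tauM_out.
- by rewrite tauM_jj w1 w3 w13 mulr0 addr0 -mulrDr -mulrDl pe mul0r mulr0.
- by rewrite tauM_out.
- by rewrite tauM_kk// w1 w3 w13 mulr0 addr0 sqrrN -mulrDr -mulrDl pe mul0r mulr0.
Qed.

Definition equalize_time r' := (entangled_time r' + separable_time r' + 1)%N.

Lemma wp_equalize st r' M lam :
  holds r' M st -> (4 <= r')%N -> tau_diagonal r' M lam ->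
  (forall x, (x < 4)%N -> 0 <= lam x) ->
  [/\ lam 1%N <= lam 0%N, lam 2%N <= lam 1%N & lam 3%N <= lam 1%N] ->
  \sum_(x < 4) herM r' M x x = 1 ->
  wp Equalize st (fun T st' => (T <= equalize_time r')%N /\ exists c M',
    [/\ holds r' M' st', colstep 0 4 M M', 0 <= c,
      c = 0 \/ c = lam 0%N - lam 1%N - lam 2%N - lam 3%N &
      forall x, (x < 4)%N -> tauM r' M' x x = c * herM r' M' x x]).
Proof.
move=> hM r4 hd l0 srt tot.
have te x : (x < 4)%N -> ceval st (tauE x x) = lam x.
  by move=> x4; rewrite (ceval_tauE hM)// hd// eqxx.
have be : beval st (BCle (tauE 1 1 + tauE 2 2 + tauE 3 3)%CE (tauE 0 0)) =
    (lam 1%N + lam 2%N + lam 3%N <= lam 0%N).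
  have -> : beval st (BCle (tauE 1 1 + tauE 2 2 + tauE 3 3)%CE (tauE 0 0)) =
    (ceval st (tauE 1 1) + ceval st (tauE 2 2) + ceval st (tauE 3 3) <= ceval st (tauE 0 0)) by [].
  by rewrite !te.
apply: wp_if; rewrite be => hle.
  apply: wp_conseq (wp_entangled hM r4 hd l0 tot) _ => T st' [hT [M' [h' cs e]]].
  split; first by rewrite /equalize_time; lia.
  exists (lam 0%N - lam 1%N - lam 2%N - lam 3%N), M'; split => //; last by right.
  by rewrite -!addrA -!opprD subr_ge0 addrA.
have lt : lam 0%N < lam 1%N + lam 2%N + lam 3%N.
  by rewrite real_ltNge// ger0_real// ?addr_ge0// l0.
apply: wp_conseq (wp_separable hM r4 hd l0 srt lt) _ => T st' [hT [M' [h' cs e]]].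
split; first by rewrite /equalize_time; lia.
by exists 0, M'; split => //; [left | move=> x x4; rewrite mul0r e].
Qed.

End EqualizeCorrect.

(** * Composition of the stages *)

Definition Core : cmd :=
  Triangularize ;; Spectrum ;; Takagi ;; Normalize ;; Equalize.

Section CoreCorrect.
Variable R : realType.
Local Notation C := R[i].
Implicit Types (st : store R) (M : nat -> nat -> C) (lam : nat -> C).

(** The scratch row is excluded because each deflation overwrites it. *)
Definition same_gram r' M M' := forall i i', (i < r' + 4)%N -> (i' < r' + 4)%N ->
  row_gram r' M' i i' = row_gram r' M i i'.

Lemma same_gram_trans r' M1 M2 M3 :
  same_gram r' M1 M2 -> same_gram r' M2 M3 -> same_gram r' M1 M3.
Proof. by move=> h1 h2 i i' hi hi'; rewrite h2 ?h1. Qed.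

Lemma colstep_same_gram r' M M' : (4 <= r')%N -> colstep 0 4 M M' -> same_gram r' M M'.
Proof. by move=> r4 cs i i' _ _; apply: (colstep_widen _ _ _ cs). Qed.

Lemma colstep_lower_rows r' M M' : colstep 0 4 M M' -> lower_rows r' M -> lower_rows r' M'.
Proof.
move=> [_ o _] hz l j l4 /andP[j4 jr]; rewrite o ?hz ?j4//.
by rewrite negb_and -[(j < 4)%N]negbK -leqNgt j4 orbT.
Qed.

Lemma same_gram_mx r' M M' : same_gram r' M M' -> gram_mx r' M' = gram_mx r' M.
Proof. by move=> h; apply/matrixP => i j; rewrite !mxE h ?ltn_add2l. Qed.

Lemma sum_herM_gram r' M : (4 <= r')%N -> lower_rows r' M ->
  \sum_(x < 4) herM r' M x x = \sum_(l < 4) row_gram r' M (r' + l) (r' + l).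
Proof.
move=> r4 hz; rewrite /herM exchange_big /=; apply: eq_bigr => l _.
rewrite /row_gram (@big_cat_nat _ _ _ 4)//= big_mkord [X in _ = _ + X]big_nat_cond.
rewrite [X in _ = _ + X]big1 ?addr0// => j /andP[hj _].
by rewrite hz// mul0r.
Qed.

Definition takagi_time r' := (3 * (clear_time r' + 110))%N.

Lemma wp_takagi st r' M : holds r' M st -> (4 <= r')%N ->
  lower_rows r' M -> spectrum_of st (gram_mx r' M) ->
  wp Takagi st (fun T st' => (T <= takagi_time r')%N /\
    exists M', [/\ holds r' M' st', same_gram r' M M', lower_rows r' M' & offdiag r' 3 M']).
Proof.
move=> hM r4 hz sp.
have keep st1 st2 G : deflate_frame st1 st2 -> spectrum_of st1 G -> spectrum_of st2 G.
  by move=> [_ hc] [m0 hch]; split; rewrite !hc.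
have o0 : offdiag r' 0 M by [].
apply: wp_seq; apply: wp_conseq (wp_deflate hM r4 _ hz o0 sp) _ => //.
move=> T0 st0 [hT0 [M0 [h0 g0 z0 of0 f0]]].
have sp0 : spectrum_of st0 (gram_mx r' M0) by rewrite (same_gram_mx g0); apply: keep f0 sp.
apply: wp_seq; apply: wp_conseq (wp_deflate h0 r4 _ z0 of0 sp0) _ => //.
move=> T1 st1 [hT1 [M1 [h1 g1 z1 of1 f1]]].
have sp1 : spectrum_of st1 (gram_mx r' M1) by rewrite (same_gram_mx g1); apply: keep f1 sp0.
apply: wp_conseq (wp_deflate h1 r4 _ z1 of1 sp1) _ => //.
move=> T2 st2 [hT2 [M2 [h2 g2 z2 of2 f2]]].
split; first by rewrite /takagi_time; lia.
exists M2; split => //.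
exact: same_gram_trans (same_gram_trans g0 g1) g2.
Qed.

Definition core_time r' :=
  (4 * (clear_time r' + 3) + 58 + takagi_time r' + 9 * (mix_time r' + 1) + equalize_time r')%N.

(** Two matrices are exposed: [M1], with diagonal [tau], serves the lower bound for all competitors,
    and [M2], with equal concurrences, is the output. *)
Lemma wp_core st r' M0 : holds r' M0 st -> (4 <= r')%N ->
  \sum_(l < 4) row_gram r' M0 (r' + l) (r' + l) = 1 ->
  wp Core st (fun T st' => (T <= core_time r')%N /\ exists c lam M1 M2,
    [/\ holds r' M2 st' /\ same_gram r' M0 M2,
        same_gram r' M0 M1 /\ tau_diagonal r' M1 lam,
        (forall x, (x < 4)%N -> 0 <= lam x) /\ lower_rows r' M1 /\ lower_rows r' M2,
        0 <= c /\ (c = 0 \/ c = lam 0%N - lam 1%N - lam 2%N - lam 3%N) &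
        forall x, (x < 4)%N -> tauM r' M2 x x = c * herM r' M2 x x]).
Proof.
move=> hM0 r4 tot.
apply: wp_seq; apply: wp_conseq (wp_triangularize hM0 r4) _.
move=> T1 st1 [hT1 [Ma [ha ga za _]]].
have sga : same_gram r' M0 Ma by move=> i i' _ _; rewrite ga.
apply: wp_seq; apply: wp_conseq (wp_spectrum ha r4 za) _.
move=> T2 st2 [hT2 sp f2].
have ha2 := holds_frame f2 isT isT ha.
apply: wp_seq; apply: wp_conseq (wp_takagi ha2 r4 za sp) _.
move=> T3 st3 [hT3 [Mb [hb gb zb ob]]].
have sgb := same_gram_trans sga gb.
apply: wp_seq; apply: wp_conseq (wp_normalize hb r4 ob) _.
move=> T4 st4 [hT4 [lam [l0 srt [M1 [h1 c1 d1 _]]]]].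
have sg1 := same_gram_trans sgb (colstep_same_gram r4 c1).
have z1 := colstep_lower_rows c1 zb.
have tot1 : \sum_(x < 4) herM r' M1 x x = 1.
  rewrite (sum_herM_gram r4 z1) -[RHS]tot; apply: eq_bigr => l _.
  by rewrite sg1// ltn_add2l.
apply: wp_conseq (wp_equalize h1 r4 d1 l0 srt tot1) _.
move=> T5 st5 [hT5 [c [M2 [h2 c2 c0 cE e]]]].
split; first by rewrite /core_time; lia.
exists c, lam, M1, M2; split => //.
- by split => //; apply: same_gram_trans sg1 _; apply: colstep_same_gram c2.
- by split => //; split => //; apply: colstep_lower_rows c2 z1.
Qed.

End CoreCorrect.

(** * The complete program *)

Section InitialMatrix.
Variable R : realType.
Local Notation C := R[i].
Implicit Types (M : nat -> nat -> C).

Definition amps (A : 'M[C]_2) (l : nat) : C := A (inord l./2) (inord (odd l)).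

Lemma tau_amps (A : 'M[C]_2) : tau (amps A) (amps A) = qform A.
Proof.
rewrite /qform (expand_det_row _ 0) !big_ord_recl big_ord0 /cofactor !det_mx11 !mxE.
rewrite /tau /amps /=.
have -> : inord 0 = 0 :> 'I_2 by apply: val_inj; rewrite /= inordK.
have -> : inord 1 = 1 :> 'I_2 by apply: val_inj; rewrite /= inordK.
have -> : lift 0 0 = 1 :> 'I_2 by apply: val_inj.
have -> : lift 1 0 = 0 :> 'I_2 by apply: val_inj.
by rewrite /= /bump /=; ring.
Qed.

Lemma sum_amps (A : 'M[C]_2) : \sum_(l < 4) amps A l * (amps A l)^* = weight A.
Proof.
rewrite (sum_ord4 (fun l => amps A l * (amps A l)^*)) weightE.
rewrite !big_ord_recl !big_ord0 -!normCK /amps /=.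
have -> : inord 0 = 0 :> 'I_2 by apply: val_inj; rewrite /= inordK.
have -> : inord 1 = 1 :> 'I_2 by apply: val_inj; rewrite /= inordK.
have -> : lift 0 0 = 1 :> 'I_2 by apply: val_inj.
by rewrite !normCK; ring.
Qed.

Lemma amps0 l : amps 0 l = 0.
Proof. by rewrite /amps mxE. Qed.

(** The size r + 4 guarantees the four columns that the core needs, also for channels with fewer
    operators. *)
Definition init_mat r (K : 'I_r -> 'M[C]_2) (A : 'M[C]_2) : nat -> nat -> C :=
  fun i j => if (i < r + 4)%N then (i == j)%:R
             else if (i < r + 4 + 4)%N then amps (kraus_at K j *m A) (i - (r + 4))
             else 0.

Definition top_block r' M : 'M[C]_r' := \matrix_(i, j) M i j.

Section SameGram.
Variables (r : nat) (K : 'I_r -> 'M[C]_2) (A : 'M[C]_2) (M : nat -> nat -> C).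
Let r' := (r + 4)%N.
Hypothesis sg : same_gram r' (init_mat K A) M.

Lemma top_block_unitary : top_block r' M \is unitarymx.
Proof.
apply/unitarymxP/matrixP => i i'; rewrite !mxE.
have := @sg i i' (ltn_addr 4 (ltn_ord i)) (ltn_addr 4 (ltn_ord i')).
rewrite /row_gram !big_mkord => e.
under eq_bigr do rewrite !mxE; rewrite e.
rewrite (bigD1 i)//= /init_mat !ltn_ord eqxx mul1r big1 ?addr0 => [|l li].
  by rewrite conjC_nat [(val i' == _)]eq_sym.
have /negbTE -> : (i != l :> nat) by rewrite eq_sym val_eqE.
by rewrite mul0r.
Qed.

(** Initially the inner product of amplitude row l with identity row i is an amplitude of K_i A.
    This product is preserved; expanding it in the current columns and inverting the unitary top
    block yields the mixing formula, without any record of the operations performed. *)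
Lemma ampcol_top_block (j : 'I_r') l : (l < 4)%N ->
  ampcol r' M j l = \sum_(i < r') top_block r' M i j * amps (kraus_at K i *m A) l.
Proof.
move=> l4; have uU := top_block_unitary.
have gx (i : 'I_r') : amps (kraus_at K i *m A) l = \sum_(k < r') ampcol r' M k l * (M i k)^*.
  have l4' : (r' + l < r' + 4)%N by rewrite ltn_add2l.
  have := @sg (r' + l)%N i l4' (ltn_addr 4 (ltn_ord i)).
  rewrite /row_gram !big_mkord => ->.
  rewrite (bigD1 i)//= /init_mat ltn_ord eqxx conjC1 mulr1 big1 ?addr0 => [|k ki].
    by rewrite ltnNge leq_addr /= ltn_add2l l4 addKn.
  have /negbTE -> : (i != k :> nat) by rewrite eq_sym val_eqE.
  by rewrite conjC0 mulr0.
under eq_bigr do rewrite gx mulr_sumr.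
rewrite exchange_big /= (bigD1 j)//= [X in _ + X]big1 ?addr0 => [|k kj].
  under eq_bigr do rewrite mxE mulrCA -normCK.
  rewrite -mulr_sumr -[LHS]mulr1; congr (_ * _).
  by rewrite -(unitarymx_col j uU); apply: eq_bigr => i _; rewrite mxE.
under eq_bigr do rewrite mulrCA.
rewrite -mulr_sumr; have := uU; rewrite -trmxC_unitary => /unitarymxP/matrixP/(_ k j).
rewrite !mxE (negbTE kj) => e.
suff -> : \sum_(i < r') top_block r' M i j * (M i k)^* = 0 by rewrite mulr0.
by rewrite -[RHS]e; apply: eq_bigr => i _; rewrite !mxE conjCK mulrC.
Qed.

Lemma amps_mixed_kraus (j : 'I_r') l : (l < 4)%N ->
  amps (mixed_kraus K (top_block r' M) j *m A) l = ampcol r' M j l.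
Proof. by move=> l4; rewrite /amps mixed_kraus_mulmx ampcol_top_block. Qed.

End SameGram.

Lemma init_mat_gram r (K : 'I_r -> 'M[C]_2) (A : 'M[C]_2) :
  \sum_(i < r) weight (K i *m A) = 1 ->
  \sum_(l < 4) row_gram (r + 4) (init_mat K A) (r + 4 + l) (r + 4 + l) = 1.
Proof.
move=> tot; rewrite /row_gram; under eq_bigr do rewrite big_mkord.
rewrite exchange_big /= -[RHS]tot.
rewrite -(@sum_kraus_at _ _ _ _ K (fun _ X => weight (X *m A)) (leq_addr 4 r)).
  apply: eq_bigr => j _; rewrite -sum_amps; apply: eq_bigr => l _.
  by rewrite /init_mat ltnNge leq_addr /= ltn_add2l ltn_ord addKn.
by move=> _; rewrite mul0mx /weight /gram2 mul0mx mxtrace0.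
Qed.

Lemma core_optimal (B : finType) (v : 'I_2 -> ket R B) (phi : ket R ('I_2 * B)%type)
    (A : 'M[C]_2) r (K : 'I_r -> 'M[C]_2) (c : C) (lam : nat -> C) M1 M2 :
  let r' := (r + 4)%N in
  (forall k l, dotk (v k) (v l) = (k == l)%:R) -> factors v phi A ->
  \sum_i weight (K i *m A) = 1 ->
  same_gram r' (init_mat K A) M1 -> same_gram r' (init_mat K A) M2 ->
  tau_diagonal r' M1 lam -> (forall x, (x < 4)%N -> 0 <= lam x) ->
  lower_rows r' M1 -> lower_rows r' M2 ->
  0 <= c -> c = 0 \/ c = lam 0%N - lam 1%N - lam 2%N - lam 3%N ->
  (forall x, (x < 4)%N -> tauM r' M2 x x = c * herM r' M2 x x) ->
  optimal_unraveling phi K (top_block r' M2).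
Proof.
move=> r' ov hphi tot sg1 sg2 hd l0 z1 z2 c0 cE eqc.
have rr : (r <= r')%N by apply: leq_addr.
have tauE4 (x y x' y' : nat -> C) : (forall l, (l < 4)%N -> x l = x' l) ->
    (forall l, (l < 4)%N -> y l = y' l) -> tau x y = tau x' y'.
  by move=> hx hy; rewrite /tau !hx// !hy.
apply: (optimal_unraveling_equal_concurrence ov hphi rr (top_block_unitary sg2) tot c0).
- move=> j; rewrite -tau_amps -sum_amps.
  have -> : tau (amps (mixed_kraus K (top_block r' M2) j *m A))
      (amps (mixed_kraus K (top_block r' M2) j *m A)) = tauM r' M2 j j.
    by apply: tauE4 => l l4; rewrite (amps_mixed_kraus sg2).
  have -> : \sum_(l < 4) amps (mixed_kraus K (top_block r' M2) j *m A) l *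
      (amps (mixed_kraus K (top_block r' M2) j *m A) l)^* = herM r' M2 j j.
    by apply: eq_bigr => l _; rewrite (amps_mixed_kraus sg2).
  have h0 : 0 <= herM r' M2 j j by apply: sumr_ge0 => l _; rewrite -normCK exprn_ge0.
  have [j4|j4] := ltnP j 4; first by rewrite eqc// ger0_norm// mulr_ge0.
  have zz l : (l < 4)%N -> M2 (r' + l)%N j = 0 by move=> l4; rewrite z2// j4 ltn_ord.
  rewrite /herM big1 => [|l _]; last by rewrite zz// mul0r.
  by rewrite /tauM /tau /ampcol !zz// !mul0r !subr0 addr0 normr0 mulr0.
(* For c = 0 the bound is trivial; otherwise c is the difference in Wootters' bound. *)
- move=> m W rm uW; have [->|cE'] := cE; first by apply: sumr_ge0 => j _.
  pose x i l := amps (kraus_at K i *m A) l.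
  (* The later columns carry no amplitudes, so they complete the diagonal family with value zero. *)
  pose lam' (k : 'I_r') : C := if (k < 4)%N then lam k else 0.
  have r0 : (0 < r')%N by rewrite /r' addn4.
  have := @takagi_lower_bound _ r' m r x (top_block r' M1) W lam' (Ordinal r0) rr rm
    (top_block_unitary sg1) uW.
  have x0 i l : (r <= i)%N -> x i l = 0.
    by move=> ri; rewrite /x kraus_at_out// mul0mx amps0.
  have l0' k : 0 <= lam' k by rewrite /lam'; case: ifP => // /l0.
  move=> /(_ x0 l0') /=.
  have yE (j k : 'I_r') : tau (fun l => \sum_(i < r') top_block r' M1 i j * x i l)
      (fun l => \sum_(i < r') top_block r' M1 i k * x i l) = tauM r' M1 j k.
    by apply: tauE4 => l l4; rewrite (ampcol_top_block sg1).
  have zz l (j : 'I_r') : (4 <= j)%N -> (l < 4)%N -> M1 (r' + l)%N j = 0.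
    by move=> j4 l4; rewrite z1// j4 ltn_ord.
  have hd' (j k : 'I_r') : tau (fun l => \sum_(i < r') top_block r' M1 i j * x i l)
      (fun l => \sum_(i < r') top_block r' M1 i k * x i l) = if j == k then lam' j else 0.
    rewrite yE /lam'; have [j4|j4] := ltnP j 4; have [k4|k4] := ltnP k 4.
    - by rewrite hd// val_eqE.
    - have -> : (j == k) = false.
        by apply/eqP => jk; rewrite jk ltnNge k4 in j4.
      by rewrite /tauM /tau /ampcol !(zz _ k)// !mulr0 !subr0 addr0.
    - by rewrite /tauM /tau /ampcol !(zz _ j)// !mul0r !subr0 addr0; case: ifP.
    - by rewrite /tauM /tau /ampcol !(zz _ j)// !mul0r !subr0 addr0; case: ifP.
  move=> /(_ hd') lb.
  have -> : c = lam' (Ordinal r0) - \sum_(k | k != Ordinal r0) lam' k.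
    have s4 : \sum_k lam' k = lam 0%N + lam 1%N + lam 2%N + lam 3%N.
      rewrite -(sum_ord4 lam) (big_ord_widen r' lam (leq_addl r 4)) [RHS]big_mkcond /=.
      by apply: eq_bigr.
    move: s4; rewrite (bigD1 (Ordinal r0))//= {1}/lam' /= => s4.
    rewrite cE' {1}/lam' /=; set S := \sum_(_ | _) _ in s4 *.
    have -> : S = lam 1%N + lam 2%N + lam 3%N.
      by apply: (addrI (lam 0%N)); rewrite s4; ring.
    by ring.
  apply: le_trans lb _; apply: ler_sum => j _.
  rewrite -tau_amps; set t1 := tau _ _; set t2 := tau _ _.
  have -> // : t1 = t2.
  by apply: tauE4 => l l4; rewrite /amps mixed_kraus_mulmx.
Qed.

End InitialMatrix.

(* The input is moved to register and array [m], beyond everything the Schmidt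
   program touches, so that the latter sees exactly its own input. *)
Definition Save (m : nat) : cmd :=
  ISet m (IReg 3) ;;
  For m.+1 (INat 0) (IAdd (IReg m) (IReg m))
    (CSet m (IReg m.+1) (INat 0) (CCell 1 (IReg m.+1) (INat 0)) ;;
     CSet m (IReg m.+1) (INat 1) (CCell 1 (IReg m.+1) (INat 1)) ;;
     CSet 1 (IReg m.+1) (INat 0) (cnat 0) ;;
     CSet 1 (IReg m.+1) (INat 1) (cnat 0)) ;;
  ISet 3 (INat 0).

(** Stores entry (a, k) of K_j A in amplitude row 2a + k of column j, for j in register 2; array 3
    holds A and array [m] the saved Kraus operators. *)
Definition LoadKraus (m a k : nat) : cmd :=
  let row := IAdd (IAdd (IReg 2) (IReg 2)) (INat a) in
  CSet 0 (IAdd (IReg 0) (INat (a + a + k))) (IReg 2)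
    (CCell m row (INat 0) * cell0 3 0 k + CCell m row (INat 1) * cell0 3 1 k)%CE.

Definition LoadColumn (m : nat) : cmd :=
  For 3 (INat 0) (IAdd (IReg 0) (INat 5)) (CSet 0 (IReg 3) (IReg 2) (cnat 0)) ;;
  CSet 0 (IReg 2) (IReg 2) (cnat 1) ;;
  LoadKraus m 0 0 ;; LoadKraus m 0 1 ;; LoadKraus m 1 0 ;; LoadKraus m 1 1.

Definition Build (m : nat) : cmd :=
  CSet 3 (INat 0) (INat 0) (cell0 0 0 0 * cell0 0 1 0)%CE ;;
  CSet 3 (INat 1) (INat 0) (cell0 0 0 0 * cell0 0 1 1)%CE ;;
  CSet 3 (INat 0) (INat 1)
    (CRoot 2 (cnat 1 - cell0 0 0 0 * cell0 0 0 0) * cell0 0 2 0)%CE ;;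
  CSet 3 (INat 1) (INat 1)
    (CRoot 2 (cnat 1 - cell0 0 0 0 * cell0 0 0 0) * cell0 0 2 1)%CE ;;
  ISet 0 (IAdd (IReg m) (INat 4)) ;;
  For 2 (INat 0) (IReg 0) (LoadColumn m).

Section Setup.
Variable R : realType.
Local Notation C := R[i].
Implicit Types (st : store R).

Definition kraus_cell r (K : 'I_r -> 'M[C]_2) (i j : nat) : C :=
  kraus_at K i./2 (inord (odd i)) (inord j).

Lemma wp_save n t (w : seq C) r (K : 'I_r -> 'M[C]_2) m : (12 <= m)%N ->
  wp (Save m) (problem_input n t w K) (fun T st' => [/\ (T <= 12 * r + 4)%N,
    agree (fun x => x < m)%N (fun x => x < m)%N (state_input n t w) st',
    reg st' m = r &
    forall i j, (j < 2)%N -> cell st' m i j = kraus_cell K i j]).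
Proof.
move=> m12; set st0 := problem_input n t w K.
have mE x : (x < m)%N -> (x == m) = false by move=> h; apply/eqP => e; rewrite e ltnn in h.
have mE' x : (x < m)%N -> (m == x) = false by move=> h; rewrite eq_sym mE.
have mS : (m == m.+1) = false by apply/eqP; lia.
have xS x : (x < m)%N -> (x == m.+1) = false by move=> h; apply/eqP; lia.
have m1 : (1 < m)%N by apply: leq_trans m12.
have m3 : (3 < m)%N by apply: leq_trans m12.
have pc i j : (j < 2)%N -> cell st0 1%N i j = kraus_cell K i j.
  move=> j2; rewrite /= j2 /kraus_cell /kraus_at; case: insubP => [k _ _|_] //.
  by rewrite mxE.
pose I k st1 := [/\ reg st1 m.+1 = k /\ reg st1 m = r,
  forall x, (x < m)%N -> reg st1 x = reg st0 x,
  forall a i j, (a < m)%N -> a != 1%N -> cell st1 a i j = cell st0 a i j,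
  forall i j, cell st1 1%N i j = if (i < k)%N && (j < 2)%N then 0 else cell st0 1%N i j &
  forall i j, (j < 2)%N -> cell st1 m i j = if (i < k)%N then kraus_cell K i j else 0].
apply: wp_seq; apply: wp_iset; rewrite /=.
set st1 := set_reg _ m _.
have step := @wp_for R m.+1 (INat 0) (IAdd (IReg m) (IReg m)) _ st1 0 (r + r) 4 I.
apply: wp_seq; apply: wp_conseq (step _ _ _ _ _ _) _ => //.
- split => //=.
  + by rewrite eqxx mS eqxx.
  + by move=> x xm; rewrite xS// mE.
  + move=> i j j2; rewrite !mE'//=; exact: leq_trans m12.
- by move=> k st2 [[h1 h2] _ _ _ _]; rewrite /= h2.
- move=> k st2 /andP[_ kr] [[h1 h2] hr hc c1 cm].
  apply: wp_seq; apply: wp_cset => v0 /=; rewrite h1 => v0E.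
  apply: wp_seq; apply: wp_cset => v1 /=; rewrite h1 (mE 1%N m1) /= => v1E.
  apply: wp_seq; apply: wp_cset => v2 /= v2E.
  apply: wp_cset => v3 /= v3E; rewrite !h1; split => //.
  have e0 : v0 = kraus_cell K k 0 by rewrite v0E c1 ltnn pc.
  have e1 : v1 = kraus_cell K k 1 by rewrite v1E c1 ltnn pc.
  split.
  + by rewrite /= eqxx mS h2.
  + by move=> x xm; rewrite /= xS// hr.
  + move=> a i j am a1; rewrite /= (negbTE a1) (mE _ am) /=; by rewrite hc//= (negbTE a1).
  + move=> i j; rewrite /= (mE 1%N m1) /= c1 (ltnS i k) (leq_eqVlt i k).
    have [->|ik] /= := eqVneq i k; last by [].
    by case: j => [|[|j]]; rewrite /= ?v2E ?v3E ?andbF.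
  + move=> i j j2; rewrite /= (mE' 1%N m1) eqxx /= cm// (ltnS i k) (leq_eqVlt i k).
    have [->|ik] /= := eqVneq i k; last by [].
    by case: j j2 => [|[|j]].
- move=> T st2 [hT [[h1 h2] hr hc c1 cm]]; apply: wp_iset.
  split.
  + by lia.
  + split => [x xm|x i j xm] /=.
      case: eqP => [->//|x3]; rewrite hr//=.
      by case: x {xm} x3 => [|[|[|[|x]]]] x3 //=; rewrite ?nth_nil.
    have [->|x1] := eqVneq x 1%N; last first.
      by rewrite hc// [LHS]/= (negbTE x1).
    rewrite [LHS]c1 /=; case: (ltnP j 2) => j2; rewrite ?andbF ?andbT//.
    case: ltnP => // ri; rewrite insubF//; apply/negbTE; rewrite -leqNgt; lia.
  + by rewrite /= mE'.
  + move=> i j j2; rewrite /= cm//; case: ltnP => // ri.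
    rewrite /kraus_cell kraus_at_out ?mxE//; lia.
Qed.

Definition schmidt_mx (s : R) (u0 u1 : ket R 'I_2) : 'M[C]_2 :=
  \matrix_(a, k) (if k == 0 then s%:C * u0 a else (Num.sqrt (1 - s ^+ 2))%:C * u1 a).

Lemma sqrtC_real (x : R) : 0 <= x -> sqrtC (x%:C) = (Num.sqrt x)%:C.
Proof.
move=> x0; rewrite -{1}(sqr_sqrtr x0) rmorphXn /= exprCK// ler0c.
exact: sqrtr_ge0.
Qed.

Definition build_time r' := (r' * (3 * (r' + 5) + 9) + 7)%N.

Lemma wp_build st r (K : 'I_r -> 'M[C]_2) m (s : R) (u0 u1 : ket R 'I_2) :
  (12 <= m)%N -> 0 <= s <= 1 ->
  cell st 0%N 0%N 0%N = s%:C -> (forall a : 'I_2, cell st 0%N 1%N a = u0 a) ->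
  (forall a : 'I_2, cell st 0%N 2%N a = u1 a) ->
  reg st m = r -> (forall i j, (j < 2)%N -> cell st m i j = kraus_cell K i j) ->
  wp (Build m) st (fun T st' => (T <= build_time (r + 4))%N /\
    holds (r + 4) (init_mat K (schmidt_mx s u0 u1)) st').
Proof.
move=> m12 /andP[s0 s1] cs cu0 cu1 rm cm.
have mE x : (x < 12)%N -> (m == x) = false by move=> h; apply/eqP; lia.
set A := schmidt_mx s u0 u1.
have i0 : inord 0 = 0 :> 'I_2 by apply: val_inj; rewrite /= inordK.
have i1 : inord 1 = 1 :> 'I_2 by apply: val_inj; rewrite /= inordK.
have sq : sqrtC (1 - s%:C * s%:C) = (Num.sqrt (1 - s ^+ 2))%:C.
  rewrite -sqrtC_real; last by rewrite subr_ge0 expr_le1.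
  by rewrite rmorphB rmorph1 rmorphXn /= expr2.
have u00 := cu0 0; have u01 := cu0 1; have u10 := cu1 0; have u11 := cu1 1.
rewrite /= in u00 u01 u10 u11.
apply: wp_seq; apply: wp_cset => a00 /=; rewrite cs u00 => a00E.
apply: wp_seq; apply: wp_cset => a10 /=; rewrite cs u01 => a10E.
apply: wp_seq; apply: wp_cset => a01 /=; rewrite cs u10 sq => a01E.
apply: wp_seq; apply: wp_cset => a11 /=; rewrite cs u11 sq => a11E.
apply: wp_seq; apply: wp_iset; rewrite /= rm.
set st1 := set_reg _ 0 _; set r' := (r + 4)%N.
have A3 b k : (b < 2)%N -> (k < 2)%N -> cell st1 3%N b k = A (inord b) (inord k).
  by case: b => [|[|//]] _; case: k => [|[|//]] _; rewrite /= ?i0 ?i1 /A mxE /= ?a00E ?a10E ?a01E ?a11E.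
have m1 i j : (j < 2)%N -> cell st1 m i j = kraus_cell K i j.
  by move=> j2; rewrite /= mE//= cm.
have rm1 : reg st1 m = r by rewrite /= mE.
pose P := [pred x | x \notin [:: 2%N; 3%N]]; pose Q := [pred x | x \notin [:: 0%N]].
pose M0 := init_mat K A.
pose J j st2 := [/\ reg st2 2%N = j, agree P Q st1 st2 &
  forall i l, (i < r' + 5)%N -> (l < j)%N -> cell st2 0%N i l = M0 i l].
have Pm : P m by rewrite /= !inE !mE.
have Qm : Q m by rewrite /= !inE !mE.
have step := @wp_for R 2 (INat 0) (IReg 0) (LoadColumn m) st1 0 r' (3 * (r' + 5) + 7) J.
apply: wp_conseq (step _ _ _ _ _) _ => //.
- by split => //; split => //= x; rewrite !inE; case: eqP.
- by move=> j st2 [h2 [hr _] _]; split => //=; rewrite hr.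
- move=> j st2 /andP[_ jr] [h2 ag hM].
  have h0 : reg st2 0%N = r' by rewrite (proj1 ag).
  pose I i st3 := [/\ reg st3 3%N = i,
    agree [pred x | x \notin [:: 3%N]] Q st2 st3,
    forall i' l, l != j -> cell st3 0%N i' l = cell st2 0%N i' l &
    forall i', (i' < i)%N -> cell st3 0%N i' j = 0].
  have step2 := @wp_for R 3 (INat 0) (IAdd (IReg 0) (INat 5))
    (CSet 0 (IReg 3) (IReg 2) (cnat 0)) st2 0 (r' + 5) 1 I.
  apply: wp_seq; apply: wp_conseq (step2 _ _ _ _ _) _ => //.
  + by split => //; split => //= x; rewrite inE; case: eqP.
  + by move=> i st3 [h3 [hr _] _ _]; split => //=; rewrite hr//= h0.
  + move=> i st3 /andP[_ ir] [h3 ag3 o3 z3]; apply: wp_cset => v /= vE.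
    have h32 : reg st3 2%N = j by rewrite (proj1 ag3)// h2.
    rewrite h3 h32; split => //; split => //=.
    * have [a1 a2] := ag3; split => [x hx|x i' l hx] /=.
        by case: eqP => [e|_]; [move: hx; rewrite /= e inE | apply: a1].
      by case: eqP => [e|_]; [move: hx; rewrite /Q /= e inE | apply: a2].
    * by move=> i' l lj; rewrite (negbTE lj) andbF o3.
    * move=> i'; rewrite ltnS leq_eqVlt eqxx andbT.
      by have [->|ii] := eqVneq i' i; [rewrite vE | move=> /= /z3].
  move=> T1 st3 [hT1 [h3 ag3 o3 z3]].
  have h32 : reg st3 2%N = j by rewrite (proj1 ag3)// h2.
  have h30 : reg st3 0%N = r' by rewrite (proj1 ag3)// h0.
  have ag13 : agree P Q st1 st3.
    apply: agree_trans ag _; apply: agree_sub ag3 => // x /=.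
    by rewrite !inE negb_or => /andP[].
  apply: wp_seq; apply: wp_cset => v /= vE.
  have kE a k : (a < 2)%N -> (k < 2)%N ->
    amps (kraus_at K j *m A) (a + a + k) =
    cell st3 m (j + j + a)%N 0%N * cell st3 3%N 0%N k +
    cell st3 m (j + j + a)%N 1%N * cell st3 3%N 1%N k.
    move=> a2 k2; rewrite !(proj2 ag13)// !m1// !A3// /kraus_cell /amps mxE.
    rewrite big_ord_recl big_ord1 ord_lift01 i0 i1.
    have -> : (a + a + k)./2 = a by lia.
    have -> : (j + j + a)./2 = j by lia.
    have -> : odd (a + a + k) = (k == 1%N) by lia.
    have -> : odd (j + j + a) = (a == 1%N) by lia.
    have -> : (a == 1%N) = a :> nat by lia.
    by have -> : (k == 1%N) = k :> nat by lia.
  have mm : (m == 0%N) = false by rewrite mE.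
  apply: wp_seq; apply: wp_cset => w0 /=; rewrite h32 h30 !mm /= -kE// => w0E.
  apply: wp_seq; apply: wp_cset => w1 /=; rewrite h32 h30 !mm /= -kE// => w1E.
  apply: wp_seq; apply: wp_cset => w2 /=; rewrite h32 h30 !mm /= -kE// => w2E.
  apply: wp_cset => w3 /=; rewrite h32 h30 !mm /= -kE// => w3E.
  split => //; first by lia.
  split => //.
  + have [a1 a2] := ag13; split => [x|x i l] /= hx; rewrite /=.
      by case: eqP => [e|_]; [rewrite e inE in hx | rewrite a1].
    by case: eqP => [e|_] /=; [rewrite e inE in hx | rewrite a2].
  + move=> i l ir; rewrite /= ltnS leq_eqVlt.
    have [->|lj] /= := eqVneq l j; last first.
      by move=> lj'; rewrite ?andbF/= o3// hM.
    move=> _; rewrite /= !andbT w0E w1E w2E w3E vE z3// /M0 /init_mat -/r' -/A.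
    have [ilt|ige] := ltnP i r'.
      have ne d : (i == r' + d)%N = false by rewrite ltn_eqF// ltn_addr.
      by rewrite !ne; case: (eqVneq i j).
    have -> : (i == j) = false by apply/eqP; lia.
    have {ir} : (i - r' < 5)%N by lia.
    have ne d : (i == r' + d)%N = (i - r' == d)%N by lia.
    have -> : (i < r' + 4)%N = (i - r' < 4)%N by lia.
    by rewrite !ne; case: (i - r')%N => [|[|[|[|[|]]]]].
- move=> T st2 [hT [h2 [hr _] hM]]; split; last by split => [|i l] ; rewrite ?hr //; apply: hM.
  by rewrite /build_time; lia.
Qed.


End Setup.

Definition time_bound r := (12 * r + 4 + build_time (r + 4) + core_time (r + 4))%N.

(** Clearing a row takes linearly many rotations of linear cost, filling the matrix is quadratic
    too, and every stage uses a fixed number of such operations. The constant is crude. *)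
Lemma time_bound_quadratic r : (time_bound r <= 80 ^ 2 * (r + 1) ^ 2)%N.
Proof.
rewrite /time_bound /build_time /core_time /equalize_time /entangled_time.
rewrite /separable_time /takagi_time /mix_time /clear_time /rotate_time.
by rewrite !expnS !expn0 !muln1; nia.
Qed.

(** The type of the output matrix contains a register value. The size is generalized before it is
    identified with [r'], which avoids casts between matrix types. *)
Lemma output_matrix_optimal (R : realType) (B : finType) (phi : ket R ('I_2 * B)%type)
    r (K : 'I_r -> 'M[R[i]]_2) r' M (st : store R) :
  holds r' M st -> optimal_unraveling phi K (top_block r' M) ->
  optimal_unraveling phi K (output_matrix st).
Proof.
move=> [e hM] opt.
suff gen q : q = r' -> forall X : 'M[R[i]]_q, (forall i j : 'I_q, X i j = M i j) ->
    optimal_unraveling phi K X.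
  apply: (gen _ e) => i j; have := ltn_ord i; have := ltn_ord j.
  by rewrite mxE => ? ?; rewrite hM//; lia.
move=> -> X XE; suff -> : X = top_block r' M by [].
by apply/matrixP => i j; rewrite XE mxE.
Qed.

Theorem theorem2 (R : realType) (dec : representation R) :
  schmidt_efficient dec ->
  exists (A : cmd) (c d : nat),
    forall (n : nat) (t : 'I_n) (w : seq R[i]) (psi : ket R (bits 'I_n))
           (r : nat) (K : 'I_r -> 'M[R[i]]_2),
      (1 < n)%N -> represents dec w psi -> is_channel K ->
      exists (T : nat) (st : store R),
        [/\ exec A (problem_input n t w K) T st,
            (T <= c * (n + size w + r) ^ d)%N &
            optimal_unraveling (target_cut t psi) K (output_matrix st)].
Proof.
(* [m] lies beyond every address of the Schmidt program; 12 separates it from the fixed addresses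
   used in saving the input and building the matrix. *)
move=> [S [cS [dS hS]]]; pose m := maxn (addr_max S) 12.
(* Adding constants and exponents dominates both the time of the Schmidt program and the quadratic
   remainder. *)
exists (Seq (Save m) (Seq S (Seq (Build m) Core))), (cS + 80 ^ 2)%N, (dS + 2)%N.
move=> n t w psi r K n1 hw chK.
have [T2 [st2 [ex2 hT2 [s [u0 [u1 [v0 [v1 [sd c0 c1 c2]]]]]]]]] := hS n t w psi n1 hw.
have m12 : (12 <= m)%N by rewrite leq_maxr.
have [T1 [st1 [ex1 [hT1 ag1 r1 k1]]]] := wp_save n t w K m12.
have uS : uses (fun x => x < m)%N (fun x => x < m)%N S by apply: uses_addr_max; rewrite leq_maxl.
(* The Schmidt run on its own input is replayed on the prepared store; [fr] and [fc] say that the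
   saved Kraus data survive it. *)
have [st2' [ex2' [_ ag2] [fr fc]]] := exec_agree ex2 uS ag1.
have m0 : (0 < m)%N by apply: leq_trans m12.
have [s01 _ _ _] := sd.
have [] := @wp_build R st2' r K m s u0 u1 m12 s01.
- by rewrite ag2.
- by move=> a; rewrite ag2.
- by move=> a; rewrite ag2.
- by rewrite fr ?r1//= ltnn.
- by move=> i j j2; rewrite fc ?k1//= ltnn.
move=> T3 [st3 [ex3 [hT3 hM3]]].
have [ov hphi tot] := schmidt_factors sd.
have [T4 [st4 [ex4 [hT4 [c [lam [M1 [M2]]]]]]]] :=
  wp_core hM3 (leq_addl r 4) (init_mat_gram (tot r K chK)).
move=> [[hM2 sg2] [sg1 hd] [l0 [z1 z2]] [cc cE] eqc].
exists (T1 + (T2 + (T3 + T4)))%N, st4; split.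
- by apply: ExSeq ex1 (ExSeq ex2' (ExSeq ex3 ex4)).
- have := time_bound_quadratic r; rewrite /time_bound.
  set N := (n + size w + r)%N => hq.
  have h2 : ((r + 1) ^ 2 <= N ^ (dS + 2))%N.
    have rN : (r + 1 <= N)%N by rewrite /N; lia.
    by apply: (@leq_trans (N ^ 2)); rewrite ?leq_exp2r// leq_pexp2l ?leq_addl//; lia.
  have h1 : ((n + size w) ^ dS <= N ^ (dS + 2))%N.
    apply: (@leq_trans (N ^ dS)); last by rewrite leq_pexp2l ?leq_addr//; lia.
    by case: (dS) => [//|d]; rewrite leq_exp2r// leq_addr.
  have h3 : (80 ^ 2 * (r + 1) ^ 2 <= 80 ^ 2 * N ^ (dS + 2))%N by rewrite leq_mul2l h2 orbT.
  have h4 : (cS * (n + size w) ^ dS <= cS * N ^ (dS + 2))%N by rewrite leq_mul2l h1 orbT.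
  rewrite mulnDl; lia.
- apply: output_matrix_optimal hM2 _.
  exact: core_optimal ov hphi (tot r K chK) sg1 sg2 hd l0 z1 z2 cc cE eqc.
Qed.
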